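(* Let $s \ge 0$. There exists a centered Gaussian distribution $X_s$ on $\mathcal{S}'(K)$ (i.e. a random variable $X_s$ with values in $\mathcal S'(K)$ such that $\{X_s(f)\}_{f\in\mathcal S(K)}$ is a centered Gaussian family) such that for all $f,g \in \mathcal{S}(K)$, \[ \mathbb{E}\big( X_s(f) X_s(g)\big)= \int_{K} (-\Delta)^{-s} f \,(-\Delta)^{-s} g \, d\mu . \]
   Context: Let $p_1,p_2,p_3\in\mathbb C$ be the vertices of an equilateral triangle of side $1$, $V_0=\{p_1,p_2,p_3\}$, $\mathfrak f_i(z)=\frac{z-p_i}{2}+p_i$ ($i=1,2,3$). $K$ is the Sierpinski gasket: the unique non-empty compact set with $K=\bigcup_{i=1}^3\mathfrak f_i(K)$; its boundary is $\partial K=V_0$. $\mu$ is the Borel measure on $K$ with $\mu(\mathfrak f_{i_1}\circ\cdots\circ\mathfrak f_{i_n}(K))=3^{-n}$ for all $n$ and all $i_1,\dots,i_n\in\{1,2,3\}$. Put $V_{m+1}=\bigcup_{i}\mathfrak f_i(V_m)$; $x\sim y$ in the graph $G_m$ on $V_m$ means that $x\neq y$ both belong to a common set $\mathfrak f_{i_1}\circ\cdots\circ\mathfrak f_{i_m}(V_0)$ (edges have length $2^{-m}$). Let $a_m=\frac{3^{m+1}}2$, $\mathcal E_m(f,f)=\frac{5^m}{a_m}\sum_{x,y\in V_m,\,x\sim y}(f(x)-f(y))^2$ (each edge counted once), $\mathcal E(f,f)=\lim_m\mathcal E_m(f,f)$ (a non-decreasing limit), $\mathcal F_0=\{f\in C(K):\mathcal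 E(f,f)<\infty,\ f=0\text{ on }\partial K\}$. $(\mathcal E,\mathcal F_0)$ is a local regular Dirichlet form on $L^2(K,\mu)$; the Dirichlet Laplacian $\Delta$ is its (self-adjoint, nonpositive) generator: $\mathcal E(f,g)=-\int_K\Delta f\,g\,d\mu$. Let $0<\lambda_1\le\lambda_2\le\cdots$ be the eigenvalues of $-\Delta$ (with multiplicity) and $(\Phi_j)_{j\ge1}$ an orthonormal basis of $L^2(K,\mu)$ of continuous eigenfunctions, $\Delta\Phi_j=-\lambda_j\Phi_j$. For $s\ge0$, $f\in L^2(K,\mu)$: $(-\Delta)^{-s}f=\sum_j\lambda_j^{-s}\Phi_j\int_K\Phi_jf\,d\mu$; and $(-\Delta)^{s}f=\sum_j\lambda_j^{s}\Phi_j\int_K\Phi_jf\,d\mu$ when $\sum_j\lambda_j^{2s}(\int_K\Phi_jf\,d\mu)^2<\infty$. $C_0(K)$: continuous functions on $K$ vanishing on $\partial K$. $\mathcal S(K)=\{f\in C_0(K):\forall k\ge0,\ \lim_{n\to\infty}n^k|\int_K\Phi_nf\,d\mu|=0\}$, with the topology defined by the norms $\|f\|_k=\|(-\Delta)^kf\|_{L^2(K,\mu)}$, $k=0,1,2,\dots$; $\mathcal S'(K)$ is its topological dual. *)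

(* Defs.v *)
From HB Require Import structures.
From mathcomp Require Import all_boot all_order all_algebra.
From mathcomp Require Import all_classical all_reals all_analysis.

Set Implicit Arguments.
Unset Strict Implicit.
Unset Printing Implicit Defensive.

Import Order.TTheory GRing.Theory Num.Theory.
Import numFieldNormedType.Exports.

Local Open Scope classical_set_scope.
Local Open Scope ring_scope.

(* The complex plane is R * R, with the product topology and the product
   (that is, Borel) sigma-algebra.  A function on the gasket K is represented
   by a function on the plane; only its values on K matter, every notion below
   (continuity, measurability, integrals, energies) being relative to K.
   Sequences are indexed from 0: lam j and Phi j are the (j+1)-st eigenvalue
   and eigenfunction. *)

Section geometry.
Context {R : realType}.
Implicit Types (p : 'I_3 -> R * R) (K : set (R * R)).

(* The norm of the library on R * R is the max norm, hence the explicit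
   Euclidean distance. *)
Definition equilateral p : Prop := forall i j, i != j ->
  ((p i).1 - (p j).1) ^+ 2 + ((p i).2 - (p j).2) ^+ 2 = 1.

Definition half_map p (i : 'I_3) (z : R * R) : R * R :=
  (2^-1 : R) *: (z - p i) + p i.

Fixpoint cell_map p (w : seq 'I_3) : R * R -> R * R :=
  if w is i :: w' then half_map p i \o cell_map p w' else id.

Definition sierpinski_gasket p K : Prop :=
  [/\ K !=set0, compact K & K = \bigcup_i (half_map p i @` K)].

(* Measures on K are measures on the plane carried by K. *)
Definition gasket_measure p K (mu : {measure set (R * R) -> \bar R}) : Prop :=
  (forall w : seq 'I_3, mu (cell_map p w @` K) = (3^-1 ^+ size w)%:E) /\
  mu (~` K) = 0%E.

Fixpoint vertices p (m : nat) : set (R * R) :=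
  if m is m'.+1 then \bigcup_i (half_map p i @` vertices p m')
  else range p.

Definition graph_adjacent p (m : nat) (x y : R * R) : Prop :=
  x <> y /\ exists w : m.-tuple 'I_3,
    (cell_map p w @` range p) x /\ (cell_map p w @` range p) y.

Definition oriented_edges p (m : nat) : set ((R * R) * (R * R)) :=
  [set e | [/\ vertices p m e.1, vertices p m e.2 & graph_adjacent p m e.1 e.2]].

(* The factor 2^-1 corrects for each edge being met in both orientations. *)
Definition graph_energy p (m : nat) (f g : R * R -> R) : R :=
  5 ^+ m / (3 ^+ m.+1 / 2) *
  (2^-1 * \sum_(e \in oriented_edges p m)
            (f e.1 - f e.2) * (g e.1 - g e.2)).

Definition energy p (f : R * R -> R) : \bar R :=
  limn (fun m => (graph_energy p m f f)%:E).

Definition energy_form p (f g : R * R -> R) : R :=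
  limn (fun m => graph_energy p m f g).

Definition dirichlet_domain p K : set (R * R -> R) :=
  [set f | [/\ {within K, continuous f}, (energy p f < +oo)%E
             & forall i, f (p i) = 0]].

End geometry.

Section laplacian.
Context {R : realType}.
Variables (p : 'I_3 -> R * R) (K : set (R * R)).
Variable (mu : {measure set (R * R) -> \bar R}).
Implicit Types (f g h : R * R -> R).

Definition square_integrable f : Prop :=
  measurable_fun K f /\ (\int[mu]_(x in K) ((f x) ^+ 2)%:E < +oo)%E.

Definition inner f g : R := \int[mu]_(x in K) (f x * g x).

Definition L2_cvg (u : nat -> R * R -> R) f : Prop :=
  (fun n => \int[mu]_(x in K) ((u n x - f x) ^+ 2)%:E)%E @ \oo --> 0%E.

(* The graph of the generator of the Dirichlet form: f is in the domain of the
   Dirichlet Laplacian, which maps it to h. *)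
Definition dirichlet_laplacian f h : Prop :=
  [/\ dirichlet_domain p K f, square_integrable h
    & forall g, dirichlet_domain p K g -> energy_form p f g = - inner h g].

Definition orthonormal_basis (Phi : nat -> R * R -> R) : Prop :=
  [/\ forall j, square_integrable (Phi j),
      forall i j, inner (Phi i) (Phi j) = (i == j)%:R
    & forall f, square_integrable f ->
        L2_cvg (fun n x => \sum_(j < n) inner (Phi j) f * Phi j x) f].

Definition dirichlet_eigensystem (lam : nat -> R) (Phi : nat -> R * R -> R)
    : Prop :=
  [/\ 0 < lam 0%N,
      {homo lam : i j / (i <= j)%N >-> i <= j},
      orthonormal_basis Phi,
      forall j, {within K, continuous (Phi j)}
    & forall j, dirichlet_laplacian (Phi j) (fun x => - lam j * Phi j x)].

Variables (lam : nat -> R) (Phi : nat -> R * R -> R).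

(* (-Delta)^a f for a real exponent a of any sign: a representative of the L2
   sum of the spectral series, and the junk value 0 if the series diverges. *)
Definition neg_laplacian_pow (a : R) f : R * R -> R :=
  xget (cst 0) [set h | square_integrable h /\
    L2_cvg (fun n x => \sum_(j < n) lam j `^ a * inner (Phi j) f * Phi j x) h].

(* As the sequences start at index 0, n ^ k becomes (n + 1) ^ k. *)
Definition schwartz : set (R * R -> R) :=
  [set f | [/\ {within K, continuous f}, (forall i, f (p i) = 0)
             & forall k : nat,
                 (fun n => n.+1%:R ^+ k * `|inner (Phi n) f|) @ \oo --> (0 : R)]].

Definition schwartz_norm (k : nat) f : R :=
  Num.sqrt (\int[mu]_(x in K) (neg_laplacian_pow k%:R f x) ^+ 2).

(* Continuity for the topology of the norms above, a base of neighbourhoods of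
   f being given by the finite intersections of balls centered at f. *)
Definition schwartz_continuous (T : (R * R -> R) -> R) : Prop :=
  forall f, schwartz f -> forall e : R, 0 < e ->
    exists (n : nat) (d : R), 0 < d /\
      forall g, schwartz g ->
        (forall k, (k <= n)%N -> schwartz_norm k (g - f) < d) ->
        `|T g - T f| < e.

(* A distribution is a functional whose restriction to the Schwartz space is
   linear and continuous; its values elsewhere are irrelevant. *)
Definition schwartz_dual : set ((R * R -> R) -> R) :=
  [set T | (forall (a : R) f g, schwartz f -> schwartz g ->
              T (fun x => a * f x + g x) = a * T f + T g) /\
           schwartz_continuous T].

(* The sigma-algebra considered on the dual is the one generated by these sets,
   that is, by the evaluations at the elements of the Schwartz space. *)
Definition schwartz_cylinders : set (set ((R * R -> R) -> R)) :=
  [set C | exists f (A : set R),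
     [/\ schwartz f, measurable A & C = [set T | A (T f)]]].

End laplacian.

Section gaussian.
Context {R : realType} {d : measure_display} {T : measurableType d}.
Variable P : probability T R.

(* The centered Gaussian law of variance s ^ 2, possibly degenerate.  The case
   distinction is needed because normal_prob 0 0 is not the Dirac mass. *)
Definition centered_normal (s : R) (A : set R) : \bar R :=
  if s == 0 then \d_(0 : R) A else normal_prob 0 s A.

Definition centered_gaussian (Y : T -> R) : Prop :=
  measurable_fun setT Y /\
  exists2 s : R, 0 <= s &
    forall A : set R, measurable A -> P (Y @^-1` A) = centered_normal s A.

Definition centered_gaussian_family (I : Type) (D : set I) (Y : I -> T -> R)
    : Prop :=
  forall (n : nat) (c : 'I_n -> R) (t : 'I_n -> I), (forall i, D (t i)) ->
    centered_gaussian (fun x => \sum_(i < n) c i * Y (t i) x).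

End gaussian.

(* Main.v *)
(** Take X_s(f) = sum_j lam_j^-s Z_j <Phi_j, f> with (Z_j) independent standard
    normal variables.  Self-similarity makes the eigenvalues of polynomial
    growth: a combination of 3^m + 1 eigenfunctions that vanishes at one corner
    of each m-cell has a large energy, and rescaled copies of Phi_0 placed in the
    m-cells give 3^m orthogonal test functions of controlled energy.  Hence
    the coefficients of f are at most C_q (j + 1)^-q ||f||_k for every q and a
    suitable k, whereas |Z_j| is almost surely O(j + 1); discarding a null set,
    the series converges for every outcome and every f, and it is continuous
    in f.  Its partial sums are Gaussian of variance sum lam_j^-2s <Phi_j, f>^2,
    which Parseval turns into the squared norm of (-Delta)^-s f; the covariance
    follows by polarization.  The Z_j are built on the space of fair coin tosses,
    whose even and odd coordinates are independent copies of the whole. *)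

Require Import Defs.
From HB Require Import structures.
From mathcomp Require Import all_boot all_order all_algebra.
From mathcomp Require Import all_classical all_reals all_analysis.
From mathcomp Require Import measurable_realfun ring lra.

Set Implicit Arguments.
Unset Strict Implicit.
Unset Printing Implicit Defensive.

Import Order.TTheory GRing.Theory Num.Theory.
Import numFieldNormedType.Exports.

Local Open Scope classical_set_scope.
Local Open Scope ring_scope.

(** * Fair coin tosses *)

(** The two directions of eigenvalue growth serve different ends. Growth from below turns a weight
    (j + 1)^q into a power of lam_j, so that the norms ||(-Delta)^k f||, which define the topology,
    control the coefficients. Growth from above lets decay in j absorb powers of lam_j, so that the
    spectral series of (-Delta)^a f converge on the Schwartz space. Only polynomial orders matter,
    whence the crude constants: 4/5 for the square root of 3/5, cubes for the exact exponents. Both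
    directions, and the bounds on the eigenfunctions, rest on one estimate: the energy of f bounds
    its difference along an edge of level n by a constant times (4/5)^n, and a sum over nested cells
    bounds the oscillation of f on a cell. Joint laws enter only through linear combinations: every
    finite sum of c_j Z_j is centered normal, and independence is never stated separately. *)

Fixpoint cylinder (w : seq bool) : set (nat -> bool) :=
  if w is a :: w' then [set b | b 0%N = a /\ cylinder w' (b \o S)] else setT.

(** The empty set is added because incompatible words have disjoint cylinders: the class becomes
    stable under intersection, as the uniqueness theorem for measures requires. *)
Definition cylinders : set (set (nat -> bool)) :=
  [set C | C = set0 \/ exists w, C = cylinder w].

Definition bit_seq := g_sigma_algebraType cylinders.

Lemma cylinders_setI_closed : setI_closed cylinders.
Proof.
move=> A B [->|[w ->]]; first by left; rewrite set0I.
case=> [->|[v ->]]; first by left; rewrite setI0.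
elim: w v => [|a w IH] [|b v] /=.
- by right; exists [::]; rewrite setTI.
- by right; exists (b :: v); rewrite setTI.
- by right; exists (a :: w); rewrite setIT.
- have [<-|ab] := eqVneq a b; last first.
    left; apply/seteqP; split => // x /= [[x0 _] [x1 _]].
    by move/eqP: ab; rewrite -x0 -x1.
  have [h|[u h]] := IH v.
    left; apply/seteqP; split => // x /= [[_ xw] [_ xv]].
    by suff: (cylinder w `&` cylinder v) (x \o S) by rewrite h.
  right; exists (a :: u); apply/seteqP; split => x /=.
    by move=> [[x0 xw] [_ xv]]; split => //; rewrite -h.
  by rewrite -h => -[x0 [xw xv]].
Qed.

Lemma measurable_cylinder w : measurable (cylinder w : set bit_seq).
Proof. by apply: sub_sigma_algebra; right; exists w. Qed.

Lemma bit_seq_measure_unique (R : realType)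
    (m1 m2 : {measure set bit_seq -> \bar R}) :
  (m1 setT < +oo)%E ->
  (forall w, m1 (cylinder w) = m2 (cylinder w)) ->
  forall A, measurable A -> m1 A = m2 A.
Proof.
move=> m1T m12 A mA.
apply: (@measure_unique _ R bit_seq cylinders (fun=> setT)) => //.
- exact: cylinders_setI_closed.
- by move=> _; right; exists [::].
- by rewrite bigcup_const.
- by move=> B [->|[w ->]]; rewrite ?measure0.
Qed.

Definition interleave (x : (nat -> bool) * (nat -> bool)) : nat -> bool :=
  fun k => if odd k then x.2 k./2 else x.1 k./2.

(** The two sequences are exchanged because the parity of every remaining position changes;
    [unzip_bits] swaps its components at each letter for the same reason. *)
Lemma interleaveS x : interleave x \o S = interleave (x.2, x.1 \o S).
Proof.
by apply/funext => k; rewrite /interleave /= uphalf_half; case: (odd k).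
Qed.

Fixpoint unzip_bits (w : seq bool) : seq bool * seq bool :=
  if w is a :: w' then (a :: (unzip_bits w').2, (unzip_bits w').1)
  else ([::], [::]).

Lemma size_unzip_bits w :
  (size (unzip_bits w).1 + size (unzip_bits w).2)%N = size w.
Proof. by elim: w => //= a w <-; rewrite addSn addnC. Qed.

Lemma preimage_interleave w : interleave @^-1` cylinder w =
  cylinder (unzip_bits w).1 `*` cylinder (unzip_bits w).2.
Proof.
suff h x : cylinder w (interleave x) <->
    cylinder (unzip_bits w).1 x.1 /\ cylinder (unzip_bits w).2 x.2.
  by apply/seteqP; split => x /h.
elim: w x => [|a w IH] [x y] //=.
rewrite interleaveS IH /=; tauto.
Qed.

Lemma measurable_interleave :
  measurable_fun setT (interleave : bit_seq * bit_seq -> bit_seq).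
Proof.
apply: (@measurability _ _ (bit_seq * bit_seq)%type bit_seq setT _ cylinders) => //.
move=> A [B [->|[w ->]] <-]; rewrite setTI ?preimage_set0//.
by rewrite preimage_interleave; apply: measurableX; exact: measurable_cylinder.
Qed.

Definition even_bits (x : nat -> bool) : nat -> bool := fun k => x k.*2.
Definition odd_bits (x : nat -> bool) : nat -> bool := fun k => x k.*2.+1.

Lemma even_bits_interleave x y : even_bits (interleave (x, y)) = x.
Proof.
by apply/funext => k; rewrite /even_bits /interleave odd_double doubleK.
Qed.

Lemma odd_bits_interleave x y : odd_bits (interleave (x, y)) = y.
Proof.
apply/funext => k; rewrite /odd_bits /interleave /= odd_double /=.
by rewrite uphalf_double.
Qed.

Lemma measurable_coordinate k : measurable [set x : bit_seq | x k].
Proof.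
suff h : measurable [set x : bit_seq | x k] /\
   forall a, measurable [set x : bit_seq | x k = a].
  by case: h.
have h w : measurable [set x : bit_seq | cylinder w x] by exact: measurable_cylinder.
suff h2 : forall a, measurable [set x : bit_seq | x k = a] by split => //; exact: (h2 true).
move=> a.
(* A cylinder prescribes an initial segment, so the condition on position k becomes a finite union
   over the k letters before it. *)
rewrite (_ : mkset _ = \big[setU/set0]_(t : k.-tuple bool) cylinder (rcons t a)).
  by apply: bigsetU_measurable => t _; exact: measurable_cylinder.
apply/seteqP; split => x /=.
  move=> xk; rewrite -bigcup_seq; exists (mktuple (fun i : 'I_k => x i)) => /=.
    by rewrite mem_index_enum.
  rewrite -xk (_ : map _ _ = mkseq x k); last first.
    by rewrite /mkseq -val_enum_ord -map_comp.
  elim: k x {xk h} => //= k IH x; split => //.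
  by rewrite (_ : x k.+1 = (x \o S) k)// -[X in rcons X](_ : mkseq (x \o S) k = _)//
    /mkseq (iotaDl 1 0) -map_comp.
rewrite -bigcup_seq => -[[t /= /eqP st] _].
elim: k t x st {h} => [|k IH] [|b t] x //=; first by move=> _ [].
by move=> [st] [_ /IH]; apply.
Qed.

Lemma measurable_to_bits (d : measure_display) (T : measurableType d) (f : T -> bit_seq) :
  (forall k, measurable [set x | f x k]) -> measurable_fun setT f.
Proof.
move=> mf; apply: (@measurability _ _ T bit_seq setT _ cylinders) => //.
move=> A [B [->|[w ->]] <-]; rewrite setTI ?preimage_set0//.
suff h j : measurable [set x | cylinder w (fun k => f x (j + k)%N)] by exact: (h 0%N).
elim: w j => [|b w IH] j /=.
  by rewrite (_ : mkset _ = setT).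
rewrite (_ : mkset _ = [set x | f x j = b] `&`
    [set x | cylinder w (fun k => f x (j.+1 + k)%N)]); last first.
  apply/seteqP; split => x /=; rewrite addn0 => -[h1 h2]; split => //;
   move: h2; congr (cylinder w _); apply/funext => k /=; by rewrite addSnnS.
apply: measurableI; last exact: IH.
case: b; first exact: mf.
rewrite (_ : mkset _ = ~` [set x | f x j]); first exact: measurableC.
by apply/seteqP; split => x /=; [move=> ->|move/negP/negbTE].
Qed.

Lemma measurable_even_bits : measurable_fun setT (even_bits : bit_seq -> bit_seq).
Proof. by apply: measurable_to_bits => k; exact: measurable_coordinate. Qed.

Lemma measurable_odd_bits : measurable_fun setT (odd_bits : bit_seq -> bit_seq).
Proof. by apply: measurable_to_bits => k; exact: measurable_coordinate. Qed.

(** * Binary digits and the fair measure *)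

Section fair_bits.
Variable R : realType.

(** The map x -> 2x mod 1 of [0, 1), whose orbit reads off the binary digits of x. *)
Definition doubling (x : R) : R := if 2^-1 <= x then 2 * x - 1 else 2 * x.

Definition digits (x : R) : bit_seq := fun k => 2^-1 <= iter k doubling x.

Lemma digitsS x : digits x \o S = digits (doubling x).
Proof. by apply/funext => k; rewrite /digits /= -iterS iterSr. Qed.

(** [doubling] maps each half of [0, 1) affinely onto [0, 1); prefixing the letter b to a word
    therefore halves its dyadic interval and moves the left end a to (b + a) / 2. *)
Lemma digits_cylinder w : exists a : R, [/\ 0 <= a, a + 2^-1 ^+ size w <= 1 &
  forall x, `[0, 1[%classic x /\ cylinder w (digits x) <->
            `[a, a + 2^-1 ^+ size w[%classic x].
Proof.
elim: w => [|b w [a [a0 a1 IH]]] /=.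
  exists 0; split; rewrite ?expr0 ?add0r// => x; tauto.
have e0 : (0 : R) <= 2^-1 ^+ size w by rewrite exprn_ge0.
exists (((b : nat)%:R + a) / 2); split.
- by rewrite divr_ge0// addr_ge0.
- by rewrite exprS; case: b => /=; lra.
move=> x; rewrite digitsS exprS.
have := IH (doubling x); rewrite /= !in_itv /=.
rewrite -[digits x 0%N]/(2^-1 <= x).
set W := cylinder w _; rewrite /doubling => {}IH.
split.
  move=> [/andP[x0 x1] [bE h]]; move: IH; rewrite bE.
  case: b bE => /= bE IH.
    have /andP[] : a <= 2 * x - 1 < a + 2^-1 ^+ size w.
      by apply/IH; split => //; apply/andP; split; lra.
    by move=> h1 h2; apply/andP; split; lra.
  have /andP[] : a <= 2 * x < a + 2^-1 ^+ size w.
    apply/IH; split => //; apply/andP; move/negbT: bE; rewrite -ltNge => bE.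
    by split; lra.
  by move=> h1 h2; apply/andP; split; lra.
move=> /andP[h1 h2]; move: IH.
case: b h1 h2 => /= h1 h2.
  have -> : 2^-1 <= x by lra.
  move=> IH; have [|/andP[h3 h4] h5] := (IH.2 _).
    by apply/andP; split; lra.
  by split => //; apply/andP; split; lra.
have -> : 2^-1 <= x = false by apply/negbTE; rewrite -ltNge; lra.
move=> IH; have [|/andP[h3 h4] h5] := (IH.2 _).
  by apply/andP; split; lra.
by split => //; apply/andP; split; lra.
Qed.

Lemma measurable_digits :
  measurable_fun setT (digits : R -> bit_seq).
Proof.
have mdoubling : measurable_fun setT (doubling : R -> R).
  rewrite /doubling; apply: measurable_fun_if => //.
  - exact: measurable_fun_ler.
  - by apply: measurable_funTS; apply: measurable_funB => //.
have miter k : measurable_fun setT (iter k doubling : R -> R).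
  elim: k => [|k IH]; first exact: measurable_id.
  exact: (measurableT_comp mdoubling IH).
apply: measurable_to_bits => k.
rewrite -[X in measurable X]setTI.
have : measurable_fun setT (fun x : R => digits x k) by apply: measurable_fun_ler.
by move=> /(_ measurableT [set true]); apply.
Qed.

(** The product of the fair measures on {0, 1}, obtained as the law of the binary digits of a
    uniform point of [0, 1). *)
Definition fair_bits : set bit_seq -> \bar R :=
  fun A => lebesgue_measure (digits @^-1` A `&` `[0, 1[).

Let fair_bits0 : fair_bits set0 = 0%E.
Proof. by rewrite /fair_bits preimage_set0 set0I measure0. Qed.

Let fair_bits_ge0 A : (0 <= fair_bits A)%E.
Proof. exact: measure_ge0. Qed.

Let mpre (A : set bit_seq) : measurable A ->
  measurable (digits @^-1` A : set (measurableTypeR R)).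
Proof. by move=> mA; rewrite -[X in measurable X]setTI; exact: measurable_digits. Qed.

Let fair_bits_sigma_additive : semi_sigma_additive fair_bits.
Proof.
move=> F mF tF mUF; rewrite /fair_bits preimage_bigcup setI_bigcupl.
apply: measure_sigma_additive.
- by move=> n; apply: measurableI => //; exact: mpre.
- move=> i j _ _ [x [[h1 _] [h2 _]]]; apply: (tF i j I I).
  by exists (digits x).
Qed.

HB.instance Definition _ := isMeasure.Build _ _ _ fair_bits
  fair_bits0 fair_bits_ge0 fair_bits_sigma_additive.

Lemma fair_bits_cylinder w : fair_bits (cylinder w) = (2^-1 ^+ size w)%:E.
Proof.
have [a [a0 a1 h]] := digits_cylinder w.
rewrite /fair_bits (_ : _ `&` _ = `[a, a + 2^-1 ^+ size w[%classic).
  rewrite lebesgue_measure_itv /= lte_fin ltrDl exprn_gt0 ?invr_gt0//.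
  by rewrite -EFinB addrAC subrr add0r.
by apply/seteqP; split => x; [move=> [h1 h2]; apply/h|move=> /h[]].
Qed.

Let fair_bits_setT : fair_bits setT = 1%E.
Proof. by rewrite -[setT]/(cylinder [::]) fair_bits_cylinder. Qed.

HB.instance Definition _ :=
  @Measure_isProbability.Build _ _ R fair_bits fair_bits_setT.

(** A cylinder pulls back to a product of two cylinders whose lengths add up to the original one, so
    both measures give it 2^-|w|. One sequence of tosses thus carries two independent ones. *)
Lemma interleave_fair_bits (A : set bit_seq) : measurable A ->
  (fair_bits \x fair_bits)%E (interleave @^-1` A) = fair_bits A.
Proof.
move=> mA.
have mT := measurable_interleave.
pose m1 : {measure set bit_seq -> \bar R} :=
  pushforward (fair_bits \x fair_bits)%E (interleave : bit_seq * bit_seq -> bit_seq).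
apply: (@bit_seq_measure_unique R (m1 mT)) => //.
  rewrite /m1/= /pushforward preimage_setT -setXTT product_measure1E//.
  by rewrite [X in (X * _)%E]fair_bits_setT [X in (_ * X)%E]fair_bits_setT mule1 ltry.
move=> w; rewrite /m1/= /pushforward preimage_interleave.
rewrite product_measure1E; try exact: measurable_cylinder.
by rewrite fair_bits_cylinder -size_unzip_bits exprD EFinM -!fair_bits_cylinder.
Qed.

Definition uniform_of_bits (b : bit_seq) : R :=
  limn (fun n => \sum_(k < n) (b k)%:R * 2^-1 ^+ k.+1 : R).

Lemma uniform_of_digits x : `[0, 1[%classic x -> uniform_of_bits (digits x) = x.
Proof.
rewrite /= in_itv /= => xI.
have xnI n : 0 <= iter n doubling x < 1.
  elim: n => //= n; set y := iter n _ _ => /andP[h1 h2]; rewrite /doubling.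
  by case: ifPn; rewrite -?ltNge => h3; apply/andP; split; lra.
(* The remainder after n digits is 2^-n times the n-th iterate of [doubling], which stays in [0,
   1). *)
have xE n : \sum_(k < n) (digits x k)%:R * 2^-1 ^+ k.+1 =
    x - 2^-1 ^+ n * iter n doubling x :> R.
  elim: n => [|n IH]; first by rewrite big_ord0 expr0 mul1r subrr.
  rewrite big_ord_recr /= IH /digits exprS; set y := iter n _ _.
  by rewrite /doubling; case: ifPn => _ /=; field.
apply/cvg_lim => //; rewrite (funext xE) -[X in _ --> X]subr0.
apply: (@cvgB _ R^o); first exact: cvg_cst.
apply: (@squeeze_cvgr nat _ _ R (fun=> (0:R)) (fun n => (2^-1:R) ^+ n)).
- apply: nearW => n; have /andP[h1 h2] := xnI n.
  have e0 : (0 : R) <= 2^-1 ^+ n by rewrite exprn_ge0.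
  by rewrite mulr_ge0//= ler_piMr// ltW.
- exact: cvg_cst.
- by apply: cvg_expr; rewrite ger0_norm// invf_lt1 ?ltr1n.
Qed.

Lemma is_cvg_bits (b : bit_seq) :
  cvgn (fun n => \sum_(k < n) (b k)%:R * 2^-1 ^+ k.+1 : R).
Proof.
apply: nondecreasing_is_cvgn.
  apply/nondecreasing_seqP => n; rewrite big_ord_recr /= lerDl.
  by rewrite mulr_ge0// exprn_ge0.
exists 1 => _ [n _ <-].
suff : \sum_(k < n) (b k)%:R * 2^-1 ^+ k.+1 <= 1 - 2^-1 ^+ n :> R.
  by move/le_trans; apply; rewrite gerBl exprn_ge0.
elim: n => [|n IH]; first by rewrite big_ord0 expr0 subrr.
rewrite big_ord_recr /= (le_trans (lerD IH (_ : _ <= 1 * 2^-1 ^+ n.+1)))//.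
  by rewrite ler_wpM2r ?exprn_ge0// lern1 leq_b1.
by rewrite exprS; lra.
Qed.

Lemma measurable_uniform_of_bits : measurable_fun setT uniform_of_bits.
Proof.
apply: (@measurable_fun_cvg _ _ _ _ (fun n (b : bit_seq) => \sum_(k < n) (b k)%:R * 2^-1 ^+ k.+1)).
  move=> n; apply: measurable_sum => k; apply: measurable_funM => //.
  rewrite (_ : (fun _ => _) = \1_[set x : bit_seq | x k]); last first.
    by apply/funext => x; rewrite indicE; case: (boolP (x k)) => h;
      [rewrite mem_set|rewrite memNset//; exact/negP].
  by apply: measurable_indic; exact: measurable_coordinate.
by move=> b _; exact: is_cvg_bits.
Qed.

Lemma uniform_of_bits_law (A : set R) : measurable A ->
  fair_bits (uniform_of_bits @^-1` A) = lebesgue_measure (A `&` `[0, 1[%classic).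
Proof.
move=> mA; rewrite /fair_bits; congr lebesgue_measure.
by apply/seteqP; split => x /= [h1 h2]; split => //; move: h1; rewrite uniform_of_digits.
Qed.

End fair_bits.

(** * Normal laws *)

Section integral_density.
Local Open Scope ereal_scope.
Context d (T : measurableType d) (R : realType).
Variables (mu nu : {measure set T -> \bar R}) (g : T -> R).
Hypothesis mg : measurable_fun setT g.
Hypothesis g0 : forall x, (0 <= g x)%R.
Hypothesis nuE : forall A, measurable A -> nu A = \int[mu]_(x in A) (g x)%:E.

Import HBNNSimple.

Let integral_density_indic (A : set T) : measurable A ->
  \int[nu]_x (\1_A x)%:E = \int[mu]_x ((\1_A x)%:E * (g x)%:E).
Proof.
move=> mA; rewrite integral_indic// setIT nuE// integral_mkcond.
apply: eq_integral => x _; rewrite patchE indicE.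
by case: ifPn; rewrite ?mul1e ?mul0e.
Qed.

Let mEg : measurable_fun setT (EFin \o g).
Proof. exact/measurable_EFinP. Qed.

Let integral_density_nnsfun (h : {nnsfun T >-> R}) :
  \int[nu]_x (h x)%:E = \int[mu]_x ((h x)%:E * (g x)%:E).
Proof.
under [LHS]eq_integral do rewrite fimfunE -fsumEFin//.
rewrite [LHS]ge0_integral_fsum//; last 2 first.
  - by move=> r; exact/measurable_EFinP/measurableT_comp.
  - by move=> n x _; rewrite EFinM nnfun_muleindic_ge0.
under [RHS]eq_integral.
  move=> x _; rewrite fimfunE -fsumEFin// ge0_mule_fsuml; last first.
    by move=> r; rewrite EFinM nnfun_muleindic_ge0.
  over.
rewrite [RHS]ge0_integral_fsum//; last 2 first.
  - move=> r; apply: emeasurable_funM; last exact: mEg.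
    by apply/measurable_EFinP; exact: measurableT_comp.
  - by move=> n x _; rewrite mule_ge0 ?lee_fin// -lee_fin EFinM nnfun_muleindic_ge0.
apply: eq_fsbigr => r _.
rewrite integralZl_indic_nnsfun// integral_density_indic//.
have [r0|r0] := ltP r 0%R.
  rewrite preimage_nnfun0// [X in _ * X]integral0_eq; last first.
    by move=> x _; rewrite indic0 mul0e.
  by rewrite mule0 integral0_eq// => x _; rewrite indic0 mulr0 mul0e.
rewrite -ge0_integralZl//=.
- by apply: eq_integral => x _; rewrite EFinM muleA.
- apply: emeasurable_funM; last exact: mEg.
  exact/measurable_EFinP.
- by move=> x _; rewrite mule_ge0 ?lee_fin.
Qed.

(** The usual three stages: indicators by [nuE], simple functions by linearity, and monotone
    convergence along [nnsfun_approx]. It turns integrals against a normal law into Lebesgue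
    integrals of densities. *)
Lemma ge0_integral_density (f : T -> \bar R) :
  measurable_fun setT f -> (forall x, 0 <= f x) ->
  \int[nu]_x f x = \int[mu]_x (f x * (g x)%:E).
Proof.
move=> mf f0; pose f_ := nnsfun_approx measurableT mf.
have f_f x : EFin \o f_^~ x @ \oo --> f x.
  by apply: cvg_nnsfun_approx => // y _; exact: f0.
transitivity (limn (fun n => \int[nu]_x (f_ n x)%:E)).
  rewrite -monotone_convergence//=.
  - by apply: eq_integral => x _; apply/esym/cvg_lim => //; exact: f_f.
  - by move=> n; exact/measurable_EFinP/measurable_funTS.
  - by move=> n x _; rewrite lee_fin.
  - by move=> x _ a b ab; rewrite lee_fin; exact/lefP/nd_nnsfun_approx.
under eq_fun do rewrite integral_density_nnsfun.
rewrite -monotone_convergence//=.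
- apply: eq_integral => x _; apply/cvg_lim => //.
  by apply: cvgeZr => //; exact: f_f.
- move=> n; apply: emeasurable_funM; last exact: mEg.
  exact/measurable_EFinP/measurable_funTS.
- by move=> n x _; rewrite mule_ge0// lee_fin.
- move=> x _ a b ab; rewrite lee_wpmul2r// ?lee_fin//.
  exact/lefP/nd_nnsfun_approx.
Qed.

End integral_density.

Lemma measure_unique_itvoy (R : realType)
    (m1 m2 : {measure set (measurableTypeR R) -> \bar R}) :
  (m1 setT < +oo)%E -> m1 setT = m2 setT ->
  (forall x : R, m1 `]x, +oo[%classic = m2 `]x, +oo[%classic) ->
  forall A : set R, measurable A -> m1 A = m2 A.
Proof.
move=> m1T m12T m12 A mA.
(* [setT] joins the half-lines to serve as the exhausting sequence of finite measure. *)
pose G : set (set (measurableTypeR R)) :=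
  [set B | B = setT \/ exists x : R, B = `]x, +oo[%classic].
apply: (@measure_unique _ R (measurableTypeR R) G (fun=> setT)) => //.
- rewrite [LHS](RGenOInfty.measurableE R); apply/seteqP; split.
    apply: smallest_sub; first exact: smallest_sigma_algebra.
    by move=> _ [x ->]; apply: sub_sigma_algebra; right; exists x.
  apply: smallest_sub; first exact: smallest_sigma_algebra.
  move=> B [->|[x ->]]; first exact: (@measurableT _ (g_sigma_algebraType (@RGenOInfty.G R))).
  by apply: sub_sigma_algebra; exists x.
- move=> _ _ [->|[x ->]] [->|[y ->]]; rewrite ?setTI ?setIT.
  + by left.
  + by right; exists y.
  + by right; exists x.
  + right; exists (Num.max x y); apply/seteqP; split => z /=; rewrite !in_itv /= !andbT gt_max.
      by move=> [-> ->].
    by move=> /andP.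
- by move=> _; left.
- by rewrite bigcup_const.
- by move=> B [->|[x ->]].
Qed.

(** * Lebesgue measure under affine maps *)

Section affine_lebesgue.
Variable R : realType.
Local Notation mu := (@lebesgue_measure R).

Lemma lebesgue_measure_translation (y : R) (A : set R) : measurable A ->
  mu ((fun x => y + x) @^-1` A) = mu A.
Proof.
move=> mA.
have mf : measurable_fun setT (fun x : measurableTypeR R => y + x : measurableTypeR R).
  by apply: measurable_funD.
pose m : {measure set (measurableTypeR R) -> \bar R} :=
  pushforward mu (fun x : measurableTypeR R => (y + x)%R : measurableTypeR R).
rewrite [RHS](@lebesgue_measure_unique R (m mf))//.
move=> _ [[a b]] _ <-.
transitivity (mu `]a - y, b - y]%classic).
  by rewrite !lebesgue_measure_itv /= !lte_fin -!EFinB ltrD2r [in RHS]opprB [in RHS]addrA subrK.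
congr (mu _); apply/seteqP; split => x /=; rewrite !in_itv /= => /andP[] *; apply/andP; split; lra.
Qed.

Lemma lebesgue_measure_scaling (c : R) (A : set R) : 0 < c -> measurable A ->
  mu A = (c%:E * mu ((fun x => c * x)%R @^-1` A))%E.
Proof.
move=> c0 mA.
have mf : measurable_fun setT (fun x : measurableTypeR R => c * x : measurableTypeR R).
  exact: mulrl_measurable.
pose m : {measure set (measurableTypeR R) -> \bar R} :=
  pushforward mu (fun x : measurableTypeR R => (c * x)%R : measurableTypeR R).
rewrite (@lebesgue_measure_unique R (mscale (NngNum (ltW c0)) (m mf)))//.
move=> _ [[a b]] _ <-; rewrite /m /mscale/= /pushforward.
transitivity (c%:E * mu `](a / c)%R, (b / c)%R]%classic)%E.
  rewrite !lebesgue_measure_itv /= !lte_fin -!EFinB ltr_pM2r ?invr_gt0//.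
  case: ifPn => _; last by rewrite mule0.
  by rewrite -EFinM; congr EFin; field; rewrite gt_eqF.
congr (_ * mu _)%E; apply/seteqP; split => x /=; rewrite !in_itv /= => /andP[h1 h2].
  by move: h1 h2; rewrite ltr_pdivrMr// ler_pdivlMr// !(mulrC x) => -> ->.
  by rewrite ltr_pdivrMr// ler_pdivlMr// !(mulrC x) h1 h2.
Qed.

Lemma ge0_integral_translation (f : R -> \bar R) (y : R) :
  measurable_fun setT f -> (forall x, 0 <= f x)%E ->
  (\int[mu]_x f (y + x)%R = \int[mu]_x f x)%E.
Proof.
move=> mf f0.
have mt : measurable_fun setT (fun x : measurableTypeR R => y + x : measurableTypeR R).
  by apply: measurable_funD.
transitivity (\int[pushforward mu (fun x : measurableTypeR R => (y + x)%R : measurableTypeR R)]_x f x)%E.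
  by rewrite ge0_integral_pushforward//.
apply: eq_measure_integral => /= A mA _.
exact: lebesgue_measure_translation.
Qed.

Lemma ge0_integral_scaling (f : R -> \bar R) (c : R) : 0 < c ->
  measurable_fun setT f -> (forall x, 0 <= f x)%E ->
  (\int[mu]_x f x = c%:E * \int[mu]_x f (c * x)%R)%E.
Proof.
move=> c0 mf f0.
have mt : measurable_fun setT (fun x : measurableTypeR R => c * x : measurableTypeR R).
  exact: mulrl_measurable.
pose m : {measure set (measurableTypeR R) -> \bar R} := 
  pushforward mu (fun x : measurableTypeR R => (c * x)%R : measurableTypeR R).
transitivity (\int[mscale (NngNum (ltW c0)) (m mt)]_x f x)%E.
  apply: eq_measure_integral => /= A mA _; exact: lebesgue_measure_scaling.
rewrite ge0_integral_mscale//=; congr (_ * _)%E.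
by rewrite ge0_integral_pushforward//.
Qed.

End affine_lebesgue.

(** * Scaling and convolution of centered normal laws *)

Section normal_law.
Variable R : realType.
Local Notation mu := (@lebesgue_measure R).
Implicit Types a b c s m x y : R.

Lemma normal_peak_scaling c s : 0 < c -> normal_peak s = c * normal_peak (c * s).
Proof.
move=> c0; rewrite /normal_peak.
have -> : (c * s) ^+ 2 * pi *+ 2 = c ^+ 2 * (s ^+ 2 * pi *+ 2) by ring.
rewrite [in RHS]sqrtrM ?sqr_ge0//.
by rewrite sqrtr_sqr gtr0_norm// invfM mulrA divff ?mul1r// gt_eqF.
Qed.

Lemma normal_pdf_scaling c s x : 0 < c -> s != 0 ->
  normal_pdf 0 s x = c * normal_pdf 0 (c * s) (c * x).
Proof.
move=> c0 s0; have cs0 : c * s != 0 by rewrite mulf_neq0// gt_eqF.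
rewrite !normal_pdfE// (normal_peak_scaling s c0) -mulrA; congr (_ * (_ * _)).
by rewrite /normal_fun; congr expR; rewrite !subr0; field; rewrite s0 gt_eqF.
Qed.

Lemma normal_prob_scaling c s (A : set R) : 0 < c -> s != 0 -> measurable A ->
  normal_prob 0 s ((fun x => c * x)%R @^-1` A) = normal_prob 0 (c * s) A.
Proof.
move=> c0 s0 mA; rewrite /normal_prob [LHS]integral_mkcond [RHS]integral_mkcond.
rewrite [RHS](@ge0_integral_scaling R _ c)//; last 2 first.
- apply/(measurable_restrictT _ _).1 => //.
  by apply/measurable_EFinP/measurable_funTS; exact: measurable_normal_pdf.
- by move=> x; apply: erestrict_ge0 => y _; rewrite lee_fin normal_pdf_ge0.
rewrite -ge0_integralZl//=; last 3 first.
- apply: measurableT_comp; last exact: mulrl_measurable.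
  apply/(measurable_restrictT _ _).1 => //.
  by apply/measurable_EFinP/measurable_funTS; exact: measurable_normal_pdf.
- by move=> x _; apply: erestrict_ge0 => y _; rewrite lee_fin normal_pdf_ge0.
- by rewrite lee_fin ltW.
apply: eq_integral => x _; rewrite !patchE.
have -> : (x \in (fun x => c * x) @^-1` A) = (c * x \in A) by [].
case: ifPn => _; last by rewrite mule0.
by rewrite (normal_pdf_scaling x c0 s0) EFinM.
Qed.

Lemma normal_prob_oppr s (A : set R) : s != 0 -> measurable A ->
  normal_prob 0 s (-%R @^-1` A) = normal_prob 0 s A.
Proof.
move=> s0 mA; rewrite /normal_prob.
have mN : measurable_fun setT (-%R : measurableTypeR R -> measurableTypeR R).
  exact: oppr_measurable.
transitivity (\int[pushforward mu (-%R : measurableTypeR R -> measurableTypeR R)]_(x in A)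
  (normal_pdf 0 s x)%:E)%E; last first.
  by apply: eq_measure_integral => /= B mB _; exact: lebesgue_measureN.
rewrite ge0_integral_pushforward//=.
- apply: eq_integral => x _ /=; rewrite !normal_pdfE//.
  by rewrite /normal_fun !subr0 sqrrN.
- by apply/measurable_EFinP/measurable_funTS; exact: measurable_normal_pdf.
- by move=> x _; rewrite lee_fin normal_pdf_ge0.
Qed.

(* Completing the square in x. *)
Lemma normal_pdf_convolution a b u x : a != 0 -> b != 0 ->
  let s := Num.sqrt (a ^+ 2 + b ^+ 2) in
  normal_pdf 0 b (u - x) * normal_pdf 0 a x =
  normal_pdf 0 s u * normal_pdf (u * a ^+ 2 / s ^+ 2) (a * b / s) x.
Proof.
move=> a0 b0 s.
have a2 : 0 < a ^+ 2 by rewrite exprn_even_gt0.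
have b2 : 0 < b ^+ 2 by rewrite exprn_even_gt0.
have s2 : s ^+ 2 = a ^+ 2 + b ^+ 2 by rewrite sqr_sqrtr// addr_ge0// ltW.
have s0 : s != 0 by rewrite gt_eqF// sqrtr_gt0 addr_gt0.
have ab0 : a * b / s != 0 by rewrite !mulf_neq0// invr_neq0.
rewrite !normal_pdfE// mulrACA [RHS]mulrACA; congr (_ * _).
  rewrite /normal_peak -!invfM; congr (_^-1).
  rewrite -!sqrtrM; last 2 first.
  - by rewrite mulrn_wge0// mulr_ge0 ?sqr_ge0 ?pi_ge0.
  - by rewrite mulrn_wge0// mulr_ge0 ?sqr_ge0 ?pi_ge0.
  by congr Num.sqrt; field.
rewrite /normal_fun -!expRD; congr expR.
rewrite !subr0 !expr_div_n s2; field.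
by rewrite a0 b0 gt_eqF// addr_gt0.
Qed.

(** Substituting u = x + y makes A a condition on u alone. Tonelli then integrates first in x, where
    [normal_pdf_convolution] leaves a normal density of mass 1 times the density of the sum at u. *)
Lemma normal_prob_convolution a b (A : set R) : a != 0 -> b != 0 ->
  measurable A ->
  (\int[normal_prob 0 a]_x normal_prob 0 b ((fun y => x + y)%R @^-1` A) =
   normal_prob 0 (Num.sqrt (a ^+ 2 + b ^+ 2)) A)%E.
Proof.
move=> a0 b0 mA; set s := Num.sqrt _.
have mpdf m' s' : measurable_fun setT (normal_pdf m' s' : R -> R).
  exact: measurable_normal_pdf.
pose F (z : measurableTypeR R * measurableTypeR R) : \bar R :=
  ((\1_A z.2 : R) * (normal_pdf 0 b (z.2 - z.1) * normal_pdf 0 a z.1))%:E.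
have F0 z : (0 <= F z)%E by rewrite lee_fin !mulr_ge0// normal_pdf_ge0.
have mF : measurable_fun setT F.
  apply/measurable_EFinP; apply: measurable_funM.
    by apply: measurableT_comp; [exact: measurable_indic|exact: measurable_snd].
  apply: measurable_funM.
    apply: measurableT_comp; first exact: mpdf.
    by apply: measurable_funB; [exact: measurable_snd|exact: measurable_fst].
  by apply: measurableT_comp; [exact: mpdf|exact: measurable_fst].
have shiftE x : normal_prob 0 b ((fun y => x + y)%R @^-1` A) =
    (\int[mu]_u ((\1_A u)%:E * (normal_pdf 0 b (u - x))%:E))%E.
  rewrite -(@ge0_integral_translation R _ x); last 2 first.
  - apply: emeasurable_funM; first exact/measurable_EFinP/measurable_indic.
    apply/measurable_EFinP; apply: measurableT_comp; first exact: mpdf.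
    exact: measurable_funB.
  - by move=> u; rewrite -EFinM lee_fin mulr_ge0// normal_pdf_ge0.
  rewrite /normal_prob integral_mkcond; apply: eq_integral => y _.
  rewrite patchE indicE addrAC subrr add0r.
  have -> : (y \in (fun y => x + y) @^-1` A) = (x + y \in A) by [].
  by case: ifP => _; rewrite ?mul1e ?mul0e.
have shiftE2 x : (normal_prob 0 b ((fun y => x + y)%R @^-1` A) *
    (normal_pdf 0 a x)%:E = \int[mu]_u F (x, u))%E.
  rewrite shiftE -ge0_integralZr//=.
  - by apply: eq_integral => u _; rewrite -muleA.
  - apply: emeasurable_funM; first exact/measurable_EFinP/measurable_indic.
    apply/measurable_EFinP; apply: measurableT_comp; first exact: mpdf.
    exact: measurable_funB.
  - by move=> u _; rewrite -EFinM lee_fin mulr_ge0// normal_pdf_ge0.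
  - by rewrite lee_fin normal_pdf_ge0.
rewrite (@ge0_integral_density _ (measurableTypeR R) R mu (normal_prob 0 a) (normal_pdf 0 a))//; last 3 first.
- exact: mpdf.
- by move=> x; rewrite normal_pdf_ge0.
- under eq_fun do rewrite shiftE.
  pose G (z : measurableTypeR R * measurableTypeR R) : \bar R :=
    ((\1_A z.2 : R) * (normal_pdf 0 b (z.2 - z.1)))%:E.
  apply: (@measurable_fun_fubini_tonelli_F _ _ (measurableTypeR R) (measurableTypeR R) R mu G).
  + apply/measurable_EFinP; apply: measurable_funM.
      by apply: measurableT_comp; [exact: measurable_indic|exact: measurable_snd].
    apply: measurableT_comp; first exact: mpdf.
    by apply: measurable_funB; [exact: measurable_snd|exact: measurable_fst].
  + by move=> z; rewrite lee_fin mulr_ge0// normal_pdf_ge0.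
under eq_integral do rewrite shiftE2.
rewrite -[LHS]/(\int[mu]_x fubini_F mu F x)%E.
rewrite (@fubini_tonelli _ _ (measurableTypeR R) (measurableTypeR R) R mu mu F mF F0) /fubini_G.
rewrite /normal_prob [RHS]integral_mkcond; apply: eq_integral => u _.
rewrite patchE /F /= indicE; case: ifPn => _; last first.
  by rewrite integral0_eq// => x _; rewrite mul0r.
under eq_integral do rewrite mul1r normal_pdf_convolution// EFinM.
rewrite ge0_integralZl//=.
- by rewrite integral_normal_pdf mule1.
- by apply/measurable_EFinP; exact: mpdf.
- by move=> x _; rewrite lee_fin normal_pdf_ge0.
- by rewrite lee_fin normal_pdf_ge0.
Qed.

End normal_law.

(** * The second moment of a normal law *)

Section normal_moment.
Variable R : realType.
Local Notation mu := (@lebesgue_measure R).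
Local Notation phi := (@normal_pdf R 0 1).

Let phiE x : phi x = normal_peak 1 * expR (- (x ^+ 2) / 2).
Proof. by rewrite normal_pdfE ?oner_eq0// /normal_fun subr0 expr1n. Qed.

(** The integration by parts behind the second moment: over [0, n] it compares the mass of [phi]
    with that of x^2 [phi], up to a boundary term tending to 0. *)
Let is_derive_xphi (x : R) : is_derive x 1 (fun x => x * phi x) (phi x - x ^+ 2 * phi x).
Proof.
rewrite (_ : (fun x => x * phi x) = (fun x => normal_peak 1 * (x * expR (- (x ^+ 2) / 2)))); last first.
  by apply/funext => y; rewrite phiE mulrCA.
apply: is_derive_eq.
rewrite phiE /GRing.scale /=; by field.
Qed.

Let cphi : continuous phi.
Proof. by apply: continuous_normal_pdf; rewrite oner_eq0. Qed.

Let cx2phi : continuous (fun x : R => x ^+ 2 * phi x : R).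
Proof. by move=> x; apply: cvgM; [exact: exprn_continuous|exact: cphi]. Qed.

Let integral_0n (n : nat) :
  (\int[mu]_(x in `[0%R, n%:R]) (phi x)%:E =
   \int[mu]_(x in `[0%R, n%:R]) (x ^+ 2 * phi x)%:E + (n%:R * phi n%:R)%:E)%E.
Proof.
case: n => [|n]; first by rewrite mul0r adde0 !set_itv1 !integral_set1.
have n0 : (0 : R) < n.+1%:R by rewrite ltr0n.
pose G x := x * phi x.
have dG x : derivable G x 1 by have [] := is_derive_xphi x.
have -> : n.+1%:R * phi n.+1%:R = G n.+1%:R - G 0 by rewrite /G mul0r subr0.
rewrite EFinB -(@continuous_FTC2 R (fun x => phi x - x ^+ 2 * phi x) G 0 n.+1%:R)//; last 3 first.
- apply: continuous_subspaceT => x; apply: (@cvgB _ R^o); [exact: cphi|exact: cx2phi].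
- have cG : continuous G by move=> x; apply/differentiable_continuous/derivable1_diffP.
  by split => //; [exact/cvg_at_right_filter/cG|exact/cvg_at_left_filter/cG].
- by move=> x _; rewrite derive1E; have [_] := is_derive_xphi x.
have ic (f : R -> R) : continuous f -> mu.-integrable `[0, n.+1%:R] (EFin \o f).
  by move=> cf; apply: continuous_compact_integrable; [exact: segment_compact|exact: continuous_subspaceT].
rewrite -integralD//=.
- by apply: eq_integral => x _; rewrite -EFinD addrC subrK.
- exact: (ic _ cx2phi).
- by apply: (ic (fun x => phi x - x ^+ 2 * phi x)) => x; apply: (@cvgB _ R^o); [exact: cphi|exact: cx2phi].
Qed.

Let cvg_nphi : (fun n => (n%:R * phi n%:R)) @ \oo --> (0 : R).
Proof.
apply: (@squeeze_cvgr nat _ _ R (fun=> (0:R)) (fun n => (2 * normal_peak 1) * n%:R^-1)).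
- near=> n.
  have n0 : (0 : R) < n%:R by rewrite ltr0n; near: n; exact: nbhs_infty_gt.
  rewrite mulr_ge0 ?normal_pdf_ge0//= phiE mulrCA [leRHS]mulrAC [leRHS]mulrC.
  rewrite ler_wpM2l ?normal_peak_ge0// mulNr expRN.
  rewrite ler_pdivrMr ?expR_gt0//.
  (* The bound exp t >= 1 + t at t = n^2 / 2 suffices: it gives n phi(n) <= 2 phi(0) / n. *)
  have h : n%:R ^+ 2 / 2 <= expR (n%:R ^+ 2 / 2) :> R.
    by apply: le_trans (expR_ge1Dx _); rewrite lerDr.
  apply: le_trans (_ : 2 / n%:R * (n%:R ^+ 2 / 2) <= _); last first.
    by rewrite ler_wpM2l// divr_ge0// ltW.
  by rewrite le_eqVlt; apply/orP; left; apply/eqP; field; rewrite gt_eqF.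
- exact: cvg_cst.
- rewrite -[X in _ --> X](mulr0 (2 * normal_peak 1)).
  apply: cvgM; first exact: cvg_cst.
  by rewrite -(cvg_shiftS (fun n : nat => n%:R^-1 : R)); exact: cvg_harmonic.
Unshelve. all: by end_near. Qed.

Let second_moment_std : (\int[mu]_x (x ^+ 2 * phi x)%:E = 1)%E.
Proof.
rewrite -(@integral_normal_pdf R 0 1).
rewrite !ge0_symfun_integralT//=; last 4 first.
- by move=> x; exact: normal_pdf_ge0.
- by move=> x /=; rewrite !phiE sqrrN.
- by move=> x; rewrite mulr_ge0 ?sqr_ge0// normal_pdf_ge0.
- by move=> x /=; rewrite !phiE !sqrrN.
congr (_ * _)%E; rewrite (_ : [set x | _] = `[0, +oo[%classic); last first.
  by apply/seteqP; split => x/=; rewrite in_itv/= andbT.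
have h1 := @ge0_cvgn_integral R mu phi (@normal_pdf_ge0 R 0 1) (@measurable_normal_pdf R 0 1).
have h2 := @ge0_cvgn_integral R mu (fun x => x ^+ 2 * phi x)
  (fun x => mulr_ge0 (sqr_ge0 x) (@normal_pdf_ge0 R 0 1 x)) (continuous_measurable_fun cx2phi).
apply: (@cvg_unique _ _ _ _ _ _ h2) => //.
rewrite (_ : (fun n => _) = (fun n : nat => \int[mu]_(x in `[0%R, n%:R]) (phi x)%:E - (n%:R * phi n%:R)%:E)%E); last first.
  by apply/funext => n; rewrite integral_0n addeK.
have h0 : (fun n : nat => (n%:R * phi n%:R)%:E) @ \oo --> 0%E.
  by apply: cvg_EFin; [exact: nearW|exact: cvg_nphi].
have := cvgeB _ h1 h0; rewrite sube0; apply.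
by rewrite oppe0 fin_num_adde_defl.
Qed.

Lemma normal_second_moment (s : R) : s != 0 ->
  (\int[mu]_x (x ^+ 2 * normal_pdf 0 s x)%:E = (s ^+ 2)%:E)%E.
Proof.
wlog s0 : s / 0 < s.
  move=> h s0; have [sn|sp|s00] := ltgtP s 0; first last.
  - by rewrite s00 eqxx in s0.
  - exact: h.
  have := h (- s); rewrite oppr_gt0 oppr_eq0 sqrrN => /(_ sn s0) <-.
  apply: eq_integral => x _.
  by rewrite !normal_pdfE ?oppr_eq0// /normal_peak /normal_fun sqrrN.
move=> s0'.
have mf : measurable_fun setT (fun x : R => (x ^+ 2 * normal_pdf 0 s x)%:E).
  apply/measurable_EFinP/measurable_funM; last exact: measurable_normal_pdf.
  exact: exprn_measurable.
have f0 x : (0 <= (x ^+ 2 * normal_pdf 0 s x)%:E)%E.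
  by rewrite lee_fin mulr_ge0 ?sqr_ge0// normal_pdf_ge0.
rewrite (ge0_integral_scaling s0 mf f0).
under eq_integral => x _.
  rewrite (_ : (s * x) ^+ 2 * _ = s * (x ^+ 2 * (s * normal_pdf 0 (s * 1) (s * x)))); last first.
    by rewrite mulr1; ring.
  rewrite -normal_pdf_scaling ?oner_eq0// EFinM.
  over.
rewrite ge0_integralZl//=.
- by rewrite second_moment_std mule1 -EFinM expr2.
- by apply/measurable_EFinP; exact: continuous_measurable_fun.
- by move=> x _; rewrite lee_fin mulr_ge0 ?sqr_ge0// normal_pdf_ge0.
- by rewrite lee_fin ltW.
Qed.

End normal_moment.

(** * A Gaussian sequence *)

Lemma ge0_integral_law (d d' : measure_display) (T : measurableType d)
    (Y : measurableType d') (R : realType) (P : {measure set T -> \bar R})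
    (m : {measure set Y -> \bar R}) (X : T -> Y) (h : Y -> \bar R) :
  measurable_fun setT X -> (forall B, measurable B -> P (X @^-1` B) = m B) ->
  measurable_fun setT h -> (forall y, 0 <= h y)%E ->
  (\int[P]_x h (X x) = \int[m]_y h y)%E.
Proof.
move=> mX XE mh h0.
transitivity (\int[pushforward P X]_y h y)%E.
  by rewrite ge0_integral_pushforward.
by apply: eq_measure_integral => B mB _; exact: XE.
Qed.

(** * The quantile transform *)

Section quantile.
Variables (R : realType) (m : probability (measurableTypeR R) R).

Let idTR : measurableTypeR R -> R := idfun.

#[local] HB.instance Definition _ :=
  @isMeasurableFun.Build _ _ _ _ idTR (@measurable_id _ _ setT).

Let F (x : R) : R := fine (m `]-oo, x]%classic).

Let cdfE x : cdf (idTR : {RV m >-> R}) x = (F x)%:E.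
Proof. by rewrite /F fineK ?fin_num_measure. Qed.

Let F_nd x y : x <= y -> F x <= F y.
Proof. by move=> xy; rewrite -lee_fin -!cdfE; exact: cdf_nondecreasing. Qed.

Let F_right x u : F x < u -> exists2 y, x < y & F y < u.
Proof.
move=> Fxu; have := @cdf_right_continuous _ _ _ m (idTR : {RV m >-> R}) x.
rewrite (_ : cdf _ = EFin \o F); last by apply/funext => z; exact: cdfE.
move=> /fine_cvg /= /(@cvgr_lt _ _ _ _ _ (F x)) /(_ u Fxu) h.
have [y []] : exists y, F y < u /\ x < y.
  by near (at_right x) => y; exists y; split; near: y; [exact: h|exact: nbhs_right_gt].
by exists y.
Unshelve. all: by end_near. Qed.

Let F_large u : u < 1 -> exists x, u <= F x.
Proof.
move=> u1; have := @cvg_cdfy1 _ _ _ m (idTR : {RV m >-> R}).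
rewrite (_ : cdf _ = EFin \o F); last by apply/funext => z; exact: cdfE.
move=> /fine_cvg /= /(@cvgr_ge _ _ _ _ _ 1) /(_ u u1) h.
by near (pinfty_nbhs R) => y; exists y; near: y; exact: h.
Unshelve. all: by end_near. Qed.

Let F_small u : 0 < u -> exists x, F x < u.
Proof.
move=> u1; have := @cvg_cdfNy0 _ _ _ m (idTR : {RV m >-> R}).
rewrite (_ : cdf _ = EFin \o F); last by apply/funext => z; exact: cdfE.
move=> /fine_cvg /= /(@cvgr_lt _ _ _ _ _ 0) /(_ u u1) h.
by near (ninfty_nbhs R) => y; exists y; near: y; exact: h.
Unshelve. all: by end_near. Qed.

(** The generalized inverse of the distribution function [F]. On [0, 1[ the default value is taken
    at the single point u = 0. *)
Definition quantile (u : R) : R :=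
  if 0 < u < 1 then sup [set x | F x < u] else 0.

(** The implication from right to left rests on the right-continuity of [F]: if F x < u, then F y <
    u for some y > x, which places x strictly below the supremum. *)
Lemma quantile_gt u x : 0 < u < 1 -> (x < quantile u) = (F x < u).
Proof.
move=> /[dup] u01 /andP[u0 u1]; rewrite /quantile u01.
have hs : has_sup [set x | F x < u].
  split; first exact: F_small.
  have [y uy] := F_large u1; exists y => z /= Fzu; rewrite leNgt; apply/negP => yz.
  by have := lt_le_trans Fzu (le_trans uy (F_nd (ltW yz))); rewrite ltxx.
apply/idP/idP.
  by move=> /(sup_gt hs.1)[y Fyu xy]; exact: le_lt_trans (F_nd (ltW xy)) Fyu.
move=> /F_right[y xy Fyu]; apply: lt_le_trans xy _.
by apply: ub_le_sup => //; exact: hs.2.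
Qed.

Lemma measurable_quantile : measurable_fun setT quantile.
Proof.
apply: (measurability _ (RGenOInfty.measurableE R)).
move=> _ [_ [x ->] <-]; rewrite setTI.
(* Outside ]0, 1[ the default value 0 exceeds x exactly when x < 0. *)
rewrite (_ : _ @^-1` _ = (`]0, 1[%classic `&` `]F x, +oo[%classic) `|`
   (if x < 0 then ~` `]0, 1[%classic else set0)).
  by apply: measurableU; [exact: measurableI|case: ifP => // _; exact: measurableC].
apply/seteqP; split => u /=; rewrite !in_itv /= !andbT.
  have [u01|u01] := boolP (0 < u < 1).
    by rewrite quantile_gt// => ->; left.
  rewrite /quantile (negbTE u01) => x0; right; rewrite x0 /=.
  by rewrite in_itv /=; exact/negP.
move=> [[u01 Fxu]|]; first by rewrite quantile_gt.
case: ifP => //= x0; rewrite in_itv /= => /negP u01.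
by rewrite /quantile (negbTE u01).
Qed.

Lemma quantile_law (A : set R) : measurable A ->
  lebesgue_measure (quantile @^-1` A `&` `[0, 1[) = m A.
Proof.
move=> mA.
have mq := measurable_quantile.
have m1 (B : set R) : measurable B -> measurable (quantile @^-1` B `&` `[0, 1[).
  by move=> mB; apply: measurableI => //; rewrite -[X in measurable X]setTI; exact: mq.
have := @uniform_of_bits_law R _ (_ : measurable (quantile @^-1` A)).
move=> <-; last by rewrite -[X in measurable X]setTI; exact: mq.
have mU : measurable_fun setT ((quantile \o @uniform_of_bits R) : bit_seq -> measurableTypeR R).
  by apply: measurableT_comp => //; exact: measurable_uniform_of_bits.
pose nu : {measure set (measurableTypeR R) -> \bar R} :=
  pushforward (fair_bits R) ((quantile \o @uniform_of_bits R) : bit_seq -> measurableTypeR R).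
have nuE B : nu mU B = fair_bits R (@uniform_of_bits R @^-1` (quantile @^-1` B)) by [].
rewrite -nuE; apply: (@measure_unique_itvoy R (nu mU) m) => //.
- by rewrite nuE !preimage_setT probability_setT ltry.
- by rewrite nuE !preimage_setT; exact: etrans (probability_setT _) (esym (probability_setT m)).
move=> x; rewrite nuE uniform_of_bits_law; last first.
  by rewrite -[X in measurable X]setTI; exact: mq.
(* By [quantile_gt] the two sets differ at most at u = 0, where the default value may exceed x. *)
transitivity (lebesgue_measure `]F x, 1[%classic).
  apply/eqP; rewrite eq_le; apply/andP; split.
    apply: (@le_trans _ _ (lebesgue_measure (`]F x, 1[%classic `|` [set 0]))).
      apply: le_measure; rewrite ?inE.
      - exact: m1.
      - by apply: measurableU.
      move=> u [] /=; rewrite !in_itv /= !andbT => xu /andP[u0 u1].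
      move: u0; rewrite le_eqVlt => /predU1P[<-|u0]; first by right.
      by left; move: xu; rewrite quantile_gt ?u0// => ->.
    by rewrite measureU0//= lebesgue_measure_set1.
  apply: le_measure; rewrite ?inE//; first exact: m1.
  move=> u /=; rewrite !in_itv /= !andbT => /andP[Fu u1].
  have u0 : 0 < u by apply: le_lt_trans Fu; rewrite fine_ge0.
  by rewrite quantile_gt ?u0// Fu u1 ltW.
have F1 : F x <= 1 by rewrite -lee_fin -cdfE; exact: cdf_le1.
rewrite lebesgue_measure_itv /= lte_fin -EFinB.
have -> : m `]x, +oo[%classic = (1 - F x)%:E.
  rewrite -setCitvl; rewrite probability_setC// EFinB -cdfE. done.
case: ltP => // h; have -> : F x = 1; first by apply/le_anti; rewrite F1 h.
by rewrite subrr.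
Qed.

End quantile.

(** * Independent standard normal variables *)

Section standard_normal_sequence.
Variable R : realType.
Implicit Types (A : set R) (c : nat -> R).

Definition normal_of_bits : bit_seq -> R :=
  quantile (normal_prob (0 : R) 1) \o @uniform_of_bits R.

Lemma measurable_normal_of_bits : measurable_fun setT normal_of_bits.
Proof.
apply: measurableT_comp; last exact: measurable_uniform_of_bits.
exact: measurable_quantile.
Qed.

Lemma normal_of_bits_law A : measurable A ->
  fair_bits R (normal_of_bits @^-1` A) = normal_prob 0 1 A.
Proof.
move=> mA; rewrite -quantile_law// -uniform_of_bits_law//.
by rewrite -[X in measurable X]setTI; exact: measurable_quantile.
Qed.

(* Even coordinates of a sequence of tosses are used up, odd ones kept for the
   subsequent variables. *)
Definition normal_seq (n : nat) (w : bit_seq) : R :=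
  normal_of_bits (even_bits (iter n odd_bits w)).

Lemma measurable_normal_seq n : measurable_fun setT (normal_seq n).
Proof.
have mi : measurable_fun setT (iter n odd_bits : bit_seq -> bit_seq).
  elim: n => [|n IH]; first exact: measurable_id.
  exact: (measurableT_comp measurable_odd_bits IH).
exact: (measurableT_comp measurable_normal_of_bits (measurableT_comp measurable_even_bits mi)).
Qed.

(** Even and odd bits are independent fair sequences: [interleave] carries the product measure to
    the fair one, and splitting undoes it. *)
Lemma interleave_law (F : bit_seq * bit_seq -> R) A : measurable_fun setT F ->
  measurable A ->
  fair_bits R [set w | A (F (even_bits w, odd_bits w))] =
  (fair_bits R \x fair_bits R)%E (F @^-1` A).
Proof.
move=> mF mA; rewrite -interleave_fair_bits; last first.
  rewrite -[X in measurable X]setTI.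
  have : measurable_fun setT (fun w : bit_seq => F (even_bits w, odd_bits w)).
    have mp : measurable_fun setT (fun w : bit_seq => (even_bits w, odd_bits w) : bit_seq * bit_seq).
      by apply: measurable_fun_pair; [exact: measurable_even_bits|exact: measurable_odd_bits].
    exact: (measurableT_comp mF mp).
  move=> /(_ measurableT A mA); exact.
congr ((_ \x _)%E _); apply/seteqP; split => -[x y] /=;
  by rewrite even_bits_interleave odd_bits_interleave.
Qed.

Lemma normal_prob_linear (a : R) A : measurable A ->
  normal_prob 0 1 ((fun z : R => a * z) @^-1` A) = centered_normal `|a| A.
Proof.
move=> mA; rewrite /centered_normal normr_eq0.
have mN : measurable (-%R @^-1` A).
  by rewrite -[X in measurable X]setTI; exact: oppr_measurable.
case: (ltgtP a 0) => [an|ap|->].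
- have an' : 0 < - a by rewrite oppr_gt0.
  rewrite (ltr0_norm an); transitivity (normal_prob 0 (- a * 1) A); last by rewrite mulr1.
  transitivity (normal_prob 0 (- a * 1) (-%R @^-1` A)); last first.
    by apply: normal_prob_oppr => //; rewrite mulr1 gt_eqF.
  rewrite -normal_prob_scaling ?oner_eq0//.
  by congr (normal_prob _ _ _); apply/seteqP; split => x /=; rewrite mulNr opprK.
- rewrite (gtr0_norm ap); transitivity (normal_prob 0 (a * 1) A); last by rewrite mulr1.
  by rewrite -normal_prob_scaling ?oner_eq0.
- rewrite diracE; case: (boolP (0 \in A)); rewrite ?inE ?notin_setE => A0.
    rewrite (_ : _ @^-1` _ = setT) ?[LHS]probability_setT//.
    by apply/seteqP; split => x //= _; rewrite mul0r.
  rewrite (_ : _ @^-1` _ = set0) ?measure0//.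
  by apply/seteqP; split => x //=; rewrite mul0r.
Qed.

(** The densities convolve when a and s are both nonzero; if one of them is 0, the corresponding
    summand is the constant 0 and the law of the other one remains. *)
Lemma centered_normal_convolution (a s : R) A : 0 <= s -> measurable A ->
  (\int[normal_prob 0 1]_z centered_normal s ((fun y => a * z + y)%R @^-1` A) =
   centered_normal (Num.sqrt (a ^+ 2 + s ^+ 2)) A)%E.
Proof.
move=> s0 mA.
have [->|sneq] := eqVneq s 0.
  rewrite expr0n /= addr0 sqrtr_sqr -normal_prob_linear//.
  have mpA : measurable ((fun z : R => a * z) @^-1` A).
    by rewrite -[X in measurable X]setTI; exact: mulrl_measurable.
  transitivity (\int[normal_prob 0 1]_x (\1_((fun z : R => a * z)%R @^-1` A) x)%:E)%E; last first.
    by rewrite integral_indic// setIT.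
  apply: eq_integral => z _; rewrite /centered_normal eqxx diracE indicE.
  rewrite (_ : (0 \in _) = (z \in (fun z : R => a * z) @^-1` A))//.
  by apply/idP/idP; rewrite !inE /= addr0.
have [->|aneq] := eqVneq a 0.
  rewrite expr0n /= add0r sqrtr_sqr ger0_norm//.
  under eq_integral => z _.
    rewrite (_ : _ @^-1` A = A); last first.
      by apply/seteqP; split => y /=; rewrite mul0r add0r.
    over.
  by rewrite integral_cst// [X in (_ * X)%E]probability_setT mule1.
have q0 : Num.sqrt (a ^+ 2 + s ^+ 2) != 0.
  by rewrite gt_eqF// sqrtr_gt0 ltr_wpDr ?sqr_ge0// exprn_even_gt0.
rewrite /centered_normal (negbTE sneq) (negbTE q0).
have an0 : `|a| != 0 by rewrite normr_eq0.
have -> : a ^+ 2 + s ^+ 2 = `|a| ^+ 2 + s ^+ 2 by rewrite real_normK ?num_real.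
rewrite -(normal_prob_convolution an0 sneq mA).
pose g (x : measurableTypeR R) := normal_prob 0 s ((fun y => x + y) @^-1` A).
have mg : measurable_fun setT g.
  pose B : set (measurableTypeR R * measurableTypeR R) := [set z | A (z.1 + z.2)].
  have mB : measurable B.
    rewrite -[X in measurable X]setTI.
    have : measurable_fun setT (fun z : measurableTypeR R * measurableTypeR R => z.1 + z.2 : R).
      by apply: measurable_funD; [exact: measurable_fst|exact: measurable_snd].
    exact.
  have := @measurable_fun_xsection _ _ (measurableTypeR R) (measurableTypeR R) R (normal_prob 0 s) B mB.
  congr (measurable_fun _ _); apply/funext => x /=; congr (normal_prob _ _ _).
  by apply/seteqP; split => y; rewrite /xsection /= inE.
have ma : measurable_fun setT (fun z : measurableTypeR R => a * z : measurableTypeR R).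
  exact: mulrl_measurable.
apply: (@ge0_integral_law _ _ (measurableTypeR R) (measurableTypeR R) R (normal_prob 0 1)
  (normal_prob 0 `|a|) (fun z => a * z)) => //.
by move=> B mB; have := normal_prob_linear a mB; rewrite /centered_normal (negbTE an0).
Qed.

(** The first variable reads the even bits; the others, as functions of the odd bits, are the same
    sequence started again at index 0. The two halves being independent, the inductive step is one
    convolution. Holding for all coefficients, the formula encodes both independence and
    normality. *)
Lemma normal_seq_sum_law n c A : measurable A ->
  fair_bits R ((fun w => \sum_(j < n) c j * normal_seq j w) @^-1` A) =
  centered_normal (Num.sqrt (\sum_(j < n) c j ^+ 2)) A.
Proof.
elim: n c A => [|n IH] c A mA.
  rewrite big_ord0 sqrtr0 /centered_normal eqxx diracE.
  case: (boolP (0 \in A)); rewrite ?inE ?notin_setE => A0.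
    rewrite (_ : _ @^-1` _ = setT) ?[LHS]probability_setT//.
    by apply/seteqP; split => x //= _; rewrite big_ord0.
  rewrite (_ : _ @^-1` _ = set0) ?measure0//.
  by apply/seteqP; split => x //=; rewrite big_ord0.
pose S (w : bit_seq) := \sum_(j < n) c j.+1 * normal_seq j w.
have mS : measurable_fun setT S.
  apply: measurable_sum => j; apply: measurable_funM => //.
  exact: measurable_normal_seq.
pose F (x : bit_seq * bit_seq) : R := c 0%N * normal_of_bits x.1 + S x.2.
have mF : measurable_fun setT F.
  apply: measurable_funD; last by apply: measurableT_comp => //; exact: measurable_snd.
  apply: measurable_funM => //.
  by apply: measurableT_comp; [exact: measurable_normal_of_bits|exact: measurable_fst].
rewrite (_ : _ @^-1` _ = [set w | A (F (even_bits w, odd_bits w))]); last first.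
  apply/seteqP; split => w /=; rewrite big_ord_recl /F /S /normal_seq /=;
  congr (A (_ + _)); apply: eq_bigr => j _; rewrite /bump /=;
  by rewrite -iterS iterSr.
rewrite interleave_law// /product_measure1 /=.
rewrite big_ord_recl -[in RHS](@sqr_sqrtr _ (\sum_(i < n) _)); last first.
  by apply: sumr_ge0 => i _; exact: sqr_ge0.
rewrite -centered_normal_convolution ?sqrtr_ge0//.
set s := Num.sqrt _.
pose h (z : measurableTypeR R) := centered_normal s ((fun y => c 0%N * z + y) @^-1` A).
have madd t : measurable ((fun y : R => t + y) @^-1` A).
  rewrite -[X in measurable X]setTI.
  have : measurable_fun setT (fun y : R => t + y) by exact: measurable_funD.
  exact.
have hE x : fair_bits R (xsection (F @^-1` A) x) = h (normal_of_bits x).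
  rewrite /h -(IH (fun j => c j.+1))//; congr (fair_bits R _).
  by apply/seteqP; split => y; rewrite /xsection /= inE.
have mh : measurable_fun setT h.
  pose B : set (measurableTypeR R * bit_seq) := [set z | A (c 0%N * z.1 + S z.2)].
  have mB : measurable B.
    have mG : measurable_fun setT (fun z : measurableTypeR R * bit_seq => c 0%N * z.1 + S z.2 : R).
      apply: measurable_funD; last by apply: (measurableT_comp mS); exact: measurable_snd.
      by apply: measurable_funM => //; exact: measurable_fst.
    by rewrite -[X in measurable X]setTI; exact: (mG measurableT A mA).
  have := @measurable_fun_xsection _ _ (measurableTypeR R) bit_seq R (fair_bits R) B mB.
  congr (measurable_fun _ _); apply/funext => z; rewrite /h -(IH (fun j => c j.+1))//=.
  by congr (fair_bits R _); apply/seteqP; split => y; rewrite /xsection /= inE.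
have mnob : measurable_fun setT (normal_of_bits : bit_seq -> measurableTypeR R).
  exact: measurable_normal_of_bits.
transitivity (\int[fair_bits R]_x h (normal_of_bits x))%E.
  by apply: eq_integral => x _; exact: hE.
apply: (@ge0_integral_law _ _ bit_seq (measurableTypeR R) R (fair_bits R) (normal_prob 0 1) normal_of_bits) => //.
  exact: normal_of_bits_law.
by move=> z; rewrite /h /centered_normal; case: ifP => _; exact: measure_ge0.
Qed.

End standard_normal_sequence.

(** * Laws of pointwise limits *)

Section limit_law.
Context (d : measure_display) (T : measurableType d) (R : realType).
Variable P : probability T R.

(* Bounded continuous functions increasing to the indicator of ]x, +oo[. *)
Let ramp (x : R) (k : nat) (t : R) : R := Num.min 1 (Num.max 0 (k%:R * (t - x))).

Let ramp_ge0 x k t : 0 <= ramp x k t.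
Proof. by rewrite /ramp le_min ler01 le_max lexx. Qed.

Let ramp_le1 x k t : ramp x k t <= 1.
Proof. by rewrite /ramp ge_min lexx. Qed.

Let ramp_continuous x k : continuous (ramp x k).
Proof.
have h : continuous (fun t : R => k%:R * (t - x) : R).
  move=> t; apply: cvgM; first exact: cvg_cst.
  by apply: (@cvgB _ R^o); [exact: cvg_id|exact: cvg_cst].
have c0 : continuous (fun _ : R => 0 : R) by move=> t; exact: cvg_cst.
have c1 : continuous (fun _ : R => 1 : R) by move=> t; exact: cvg_cst.
exact: (min_fun_continuous c1 (max_fun_continuous c0 h)).
Qed.

Let ramp_nd x t : {homo (ramp x ^~ t) : k l / (k <= l)%N >-> k <= l}.
Proof.
move=> k l kl; rewrite /ramp; have [tx|tx] := leP t x.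
  rewrite !max_l//; by rewrite mulr_ge0_le0// subr_le0.
rewrite !max_r; try by rewrite mulr_ge0// subr_ge0 ltW.
rewrite le_min ge_min lexx /= ge_min ler_wpM2r ?orbT ?ler_nat//.
by rewrite subr_ge0 ltW.
Qed.

Let ramp_cvg x t : (ramp x k t @[k --> \oo]) --> ((x < t)%R%:R : R).
Proof.
have [tx|tx] := ltP x t; last first.
  rewrite (_ : (fun k => _) = cst 0); first exact: cvg_cst.
  apply/funext => k; rewrite /ramp max_l ?min_r//.
  by rewrite mulr_ge0_le0// subr_le0.
apply: cvg_near_cst; near=> k; rewrite /ramp.
have tx0 : 0 < t - x by rewrite subr_gt0.
rewrite max_r; last by rewrite mulr_ge0// ltW.
apply/min_idPl; rewrite -ler_pdivrMr// mul1r.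
near: k; exact: nbhs_infty_ger.
Unshelve. all: by end_near. Qed.

Let measurable_ramp x k (X : T -> R) : measurable_fun setT X ->
  measurable_fun setT (fun w => (ramp x k (X w))%:E).
Proof.
move=> mX; apply/measurable_EFinP; apply: measurableT_comp => //.
by apply: continuous_measurable_fun; exact: ramp_continuous.
Qed.

Let bounded_convergence (f_ : nat -> T -> R) (f : T -> R) :
  (forall n, measurable_fun setT (f_ n)) ->
  (forall n w, 0 <= f_ n w <= 1) ->
  (forall w, f_ n w @[n --> \oo] --> f w) ->
  (fun n => \int[P]_w (f_ n w)%:E)%E @ \oo --> (\int[P]_w (f w)%:E)%E.
Proof.
move=> mf_ f01 f_f.
have mf : measurable_fun setT f.
  by apply: (@measurable_fun_cvg _ _ _ _ f_) => // w _; exact: f_f.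
have [] // := @dominated_convergence _ T R P setT measurableT
  (fun n w => (f_ n w)%:E) (fun w => (f w)%:E) (cst 1%E).
- by move=> n; exact/measurable_EFinP.
- exact/measurable_EFinP.
- apply: aeW => w _; apply: cvg_EFin; first exact: nearW.
  exact: f_f.
- exact: finite_measure_integrable_cst.
- apply: aeW => w n _ /=; have /andP[f0 f1] := f01 n w.
  by rewrite lee_fin ger0_norm.
Qed.

Let ramp_limit x k (X : nat -> T -> R) (X0 : T -> R) :
  (forall n, measurable_fun setT (X n)) ->
  (forall w, X n w @[n --> \oo] --> X0 w) ->
  (fun n => \int[P]_w (ramp x k (X n w))%:E)%E @ \oo -->
   (\int[P]_w (ramp x k (X0 w))%:E)%E.
Proof.
move=> mX XX0; apply: bounded_convergence.
- by move=> n; apply/measurable_EFinP; exact: measurable_ramp.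
- by move=> n w; rewrite ramp_ge0 ramp_le1.
- by move=> w; apply: (cvg_comp _ _ (XX0 w)); exact: ramp_continuous.
Qed.

Let ramp_sup x (X : T -> R) : measurable_fun setT X ->
  (fun k => \int[P]_w (ramp x k (X w))%:E)%E @ \oo --> P (X @^-1` `]x, +oo[).
Proof.
move=> mX.
have mA : measurable (X @^-1` `]x, +oo[).
  by rewrite -[Y in measurable Y]setTI; exact: mX.
rewrite -[Y in P Y](setIT) -integral_indic//.
apply: bounded_convergence.
- by move=> k; apply/measurable_EFinP; exact: measurable_ramp.
- by move=> k w; rewrite ramp_ge0 ramp_le1.
- move=> w; rewrite indicE.
  rewrite (_ : (w \in _) = (x < X w)); first exact: ramp_cvg.
  by apply/idP/idP; rewrite inE /= in_itv /= andbT.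
Qed.

Lemma law_measure (X : T -> R) : measurable_fun setT X ->
  exists m : {measure set (measurableTypeR R) -> \bar R},
    forall B, m B = P (X @^-1` B).
Proof.
move=> mX.
pose m : {measure set (measurableTypeR R) -> \bar R} :=
  pushforward P (X : T -> measurableTypeR R).
by exists (m mX).
Qed.

(** Expectations of a ramp agree at every n and pass to the limit by bounded convergence; as the
    slope k grows they converge to the upper tails, which determine the law. Comparing two sequences
    spares any convergence of normal laws, in particular towards a Dirac mass. *)
Lemma limit_law (X Y : nat -> T -> R) (X0 Y0 : T -> R) :
  (forall n, measurable_fun setT (X n)) -> (forall n, measurable_fun setT (Y n)) ->
  (forall w, X n w @[n --> \oo] --> X0 w) ->
  (forall w, Y n w @[n --> \oo] --> Y0 w) ->
  (forall n A, measurable A -> P (X n @^-1` A) = P (Y n @^-1` A)) ->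
  forall A, measurable A -> P (X0 @^-1` A) = P (Y0 @^-1` A).
Proof.
move=> mX mY XX0 YY0 XY A mA.
have mX0 : measurable_fun setT X0.
  by apply: (@measurable_fun_cvg _ _ _ _ X) => // w _; exact: XX0.
have mY0 : measurable_fun setT Y0.
  by apply: (@measurable_fun_cvg _ _ _ _ Y) => // w _; exact: YY0.
have [nuX nuXE] := law_measure mX0; have [nuY nuYE] := law_measure mY0.
have EXY x k n : (\int[P]_w (ramp x k (X n w))%:E = \int[P]_w (ramp x k (Y n w))%:E)%E.
  pose h (t : measurableTypeR R) : \bar R := (ramp x k t)%:E.
  have mh : measurable_fun setT h.
    by apply/measurable_EFinP; apply: continuous_measurable_fun; exact: ramp_continuous.
  have h0 t : (0 <= h t)%E by rewrite lee_fin.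
  rewrite -[LHS]/(\int[P]_w (h (X n w)))%E -[RHS]/(\int[P]_w (h (Y n w)))%E.
  have [m mE] := law_measure (mX n).
  rewrite (ge0_integral_law (m := m) (mX n) _ mh h0)//.
  by rewrite (ge0_integral_law (m := m) (mY n) _ mh h0)// => B mB; rewrite mE XY.
rewrite -nuXE -nuYE; apply: (@measure_unique_itvoy R nuX nuY) => //.
- by rewrite nuXE preimage_setT probability_setT ltry.
- by rewrite nuXE nuYE !preimage_setT.
move=> x; rewrite nuXE nuYE; apply: (cvg_unique _ (ramp_sup (x := x) mX0)) => //.
rewrite (_ : (fun k => _) = (fun k => \int[P]_w (ramp x k (Y0 w))%:E)%E).
  exact: ramp_sup.
apply/funext => k; apply: (cvg_unique _ (ramp_limit (x := x) (k := k) mX XX0)) => //.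
rewrite (_ : (fun n => _) = (fun n => \int[P]_w (ramp x k (Y n w))%:E)%E).
  exact: ramp_limit.
by apply/funext => n; exact: EXY.
Qed.

Lemma centered_normal_second_moment (X : T -> R) (s : R) : 0 <= s ->
  measurable_fun setT X ->
  (forall A : set R, measurable A -> P (X @^-1` A) = centered_normal s A) ->
  (\int[P]_w ((X w) ^+ 2)%:E = (s ^+ 2)%:E)%E.
Proof.
move=> s0 mX; rewrite /centered_normal.
pose h (t : measurableTypeR R) : \bar R := (t ^+ 2)%:E.
have mh : measurable_fun setT h.
  by apply/measurable_EFinP; exact: exprn_measurable.
have h0 t : (0 <= h t)%E by rewrite lee_fin sqr_ge0.
rewrite -[X in X = _]/(\int[P]_w (h (X w)))%E.
case: eqP => [->|/eqP sneq] XE.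
  rewrite (ge0_integral_law (m := \d_(0 : measurableTypeR R)) mX XE mh h0).
  by rewrite integral_dirac// diracE mem_set// mul1e.
rewrite (ge0_integral_law (m := normal_prob 0 s) mX XE mh h0).
rewrite (@ge0_integral_density _ (measurableTypeR R) R lebesgue_measure (normal_prob 0 s) (normal_pdf 0 s) _ _ _ h)//.
- by rewrite -(normal_second_moment sneq); apply: eq_integral => x _; rewrite EFinM.
- exact: measurable_normal_pdf.
- exact: normal_pdf_ge0.
Qed.

End limit_law.

Section gaussian_series.
Context (d : measure_display) (T : measurableType d) (R : realType).
Variables (P : probability T R) (Z : nat -> T -> R).
Hypothesis mZ : forall n, measurable_fun setT (Z n).
Hypothesis Z_law : forall n (c : nat -> R) (A : set R), measurable A ->
  P ((fun w => \sum_(j < n) c j * Z j w) @^-1` A) =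
  centered_normal (Num.sqrt (\sum_(j < n) c j ^+ 2)) A.

Let scaled_law (a : R) (A : set R) : 0 <= a -> measurable A ->
  P ((fun w => a * Z 0%N w) @^-1` A) = centered_normal a A.
Proof.
move=> a0 mA; have := @Z_law 1 (fun=> a) A mA.
rewrite big_ord1 sqrtr_sqr ger0_norm// => <-.
by congr (P _); apply/seteqP; split => w /=; rewrite big_ord1.
Qed.

(** The n-th partial sum has the law of [sn n] times Z_0, a multiple of one fixed variable, and
    these multiples converge pointwise to s Z_0. *)
Lemma gaussian_series_law (c : nat -> R) (X : T -> R) (s : R) : 0 <= s ->
  (forall w, (fun n => \sum_(j < n) c j * Z j w) @ \oo --> X w) ->
  (fun n => \sum_(j < n) c j ^+ 2) @ \oo --> s ^+ 2 ->
  forall A : set R, measurable A -> P (X @^-1` A) = centered_normal s A.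
Proof.
move=> s0 cX cs A mA; rewrite -scaled_law//.
pose sn n := Num.sqrt (\sum_(j < n) c j ^+ 2).
apply: (@limit_law _ _ _ P (fun n w => \sum_(j < n) c j * Z j w)
  (fun n w => sn n * Z 0%N w)) => //.
- by move=> n; apply: measurable_sum => j; apply: measurable_funM.
- by move=> n; apply: measurable_funM.
- move=> w; apply: cvgM; last exact: cvg_cst.
  rewrite -[X in _ --> X](ger0_norm s0) -sqrtr_sqr.
  by apply: continuous_cvg => //; exact: sqrt_continuous.
- by move=> n B mB; rewrite Z_law// scaled_law// sqrtr_ge0.
Qed.

End gaussian_series.

(** * A Gaussian sequence of controlled growth *)

Section gaussian_sequence.
Variable R : realType.
Local Notation P := (fair_bits R).

(** This equals 1 / (j + 1) - 1 / (j + 2), so its sums telescope and stay below 1. *)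
Definition pair_weight (j : nat) : R := ((j.+1)%:R * (j.+2)%:R)^-1.

Lemma pair_weight_gt0 j : 0 < pair_weight j.
Proof. by rewrite invr_gt0 mulr_gt0 ?ltr0n. Qed.

Lemma pair_weight_sum n : \sum_(j < n) pair_weight j = 1 - n.+1%:R^-1.
Proof.
elim: n => [|n IH]; first by rewrite big_ord0 invr1 subrr.
rewrite big_ord_recr /= IH /pair_weight -!natr1; field.
by rewrite !natr1 !pnatr_eq0.
Qed.

Let weight_gt0 := pair_weight_gt0.

Let normal_seq_moment j : (\int[P]_w ((@normal_seq R j w) ^+ 2)%:E = 1)%E.
Proof.
rewrite -(expr1n R 2); apply: centered_normal_second_moment => //.
  exact: measurable_normal_seq.
move=> A mA.
have := @normal_seq_sum_law R j.+1 (fun i => (i == j)%:R) A mA.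
rewrite big_ord_recr /= eqxx big1 ?add0r; last first.
  by move=> i _; rewrite (ltn_eqF (ltn_ord i)) expr0n.
rewrite expr1n sqrtr1 => <-; congr (P _).
have h w : \sum_(i < j.+1) (i == j :> nat)%:R * @normal_seq R i w = @normal_seq R j w.
  rewrite big_ord_recr /= eqxx mul1r big1 ?add0r// => i _.
  by rewrite (ltn_eqF (ltn_ord i)) mul0r.
by apply/seteqP; split => w /=; rewrite h.
Qed.

Let S (w : bit_seq) : \bar R :=
  (\sum_(j <oo) (pair_weight j * (@normal_seq R j w) ^+ 2)%:E)%E.

Let term_ge0 j w : (0 <= (pair_weight j * (@normal_seq R j w) ^+ 2)%:E)%E.
Proof. by rewrite lee_fin mulr_ge0 ?sqr_ge0// ltW. Qed.

Let mterm j : measurable_fun setT (fun w => (pair_weight j * (@normal_seq R j w) ^+ 2)%:E).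
Proof.
apply/measurable_EFinP/measurable_funM => //; apply: measurable_funX.
exact: measurable_normal_seq.
Qed.

Let integrable_S : P.-integrable setT S.
Proof.
apply/integrableP; split.
  by apply: ge0_emeasurable_sum => // j w _ _; exact: term_ge0.
under eq_integral do rewrite gee0_abs ?nneseries_ge0//.
rewrite integral_nneseries//.
apply: (@le_lt_trans _ _ 1%E); last exact: ltry.
apply: lime_le.
  by apply: is_cvg_nneseries => j _ _; apply: integral_ge0.
apply: nearW => n; rewrite big_mkord.
have E j : (\int[P]_w (pair_weight j * (@normal_seq R j w) ^+ 2)%:E = (pair_weight j)%:E)%E.
  under eq_integral do rewrite EFinM.
  rewrite ge0_integralZl//=; first by rewrite normal_seq_moment mule1.
  - apply/measurable_EFinP/measurable_funX; exact: measurable_normal_seq.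
  - by move=> w _; rewrite lee_fin sqr_ge0.
  - by rewrite lee_fin ltW.
under eq_bigr do rewrite E.
by rewrite sumEFin lee_fin pair_weight_sum gerBl invr_ge0.
Qed.

(* The sum of Z_j^2 / ((j + 1) (j + 2)) has finite expectation; the Z_j are set
   to 0 on the null set where it diverges. *)
Lemma gaussian_sequence : exists Z : nat -> bit_seq -> R,
  [/\ forall n, measurable_fun setT (Z n),
      forall w, exists C : R, forall j, (Z j w) ^+ 2 <= C * (j.+1%:R * j.+2%:R)
    & forall n (c : nat -> R) (A : set R), measurable A ->
        P ((fun w => \sum_(j < n) c j * Z j w) @^-1` A) =
        centered_normal (Num.sqrt (\sum_(j < n) c j ^+ 2)) A].
Proof.
have [N [mN N0 hN]] := integrable_ae measurableT integrable_S.
pose Z j w : R := \1_(~` N) w * @normal_seq R j w.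
have mZ n : measurable_fun setT (Z n).
  apply: measurable_funM; last exact: measurable_normal_seq.
  by apply: measurable_indic; exact: measurableC.
exists Z; split => //.
  move=> w; have [wN|wN] := pselect (N w).
    exists 0 => j; rewrite /Z indicE memNset; last by move=> /(_ wN).
    by rewrite mul0r expr0n mul0r.
  exists (fine (S w)) => j.
  have Sfin : S w \is a fin_num.
    by apply: contrapT => h; apply: wN; apply: hN => /(_ I).
  rewrite /Z indicE mem_set// mul1r -ler_pdivrMr ?mulr_gt0 ?ltr0n// mulrC.
  rewrite -lee_fin fineK//.
  apply: (@le_trans _ _ (\sum_(0 <= i < j.+1) (pair_weight i * (@normal_seq R i w) ^+ 2)%:E)%E).
    by rewrite big_nat_recr//= leeDr// sume_ge0.
  by apply: nneseries_lim_ge => i _ _; exact: term_ge0.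
move=> n c A mA; rewrite -normal_seq_sum_law//.
have mpre (Y : bit_seq -> R) : measurable_fun setT Y -> measurable (Y @^-1` A).
  by move=> mY; rewrite -[X in measurable X]setTI; exact: mY.
have PD (B : set bit_seq) : measurable B -> P B = P (B `\` N).
  move=> mB; rewrite (measureDI P mB mN) [X in (_ + X)%E](_ : _ = 0%E) ?adde0//.
  apply: (@subset_measure0 _ _ _ P (B `&` N) N) => //; exact: measurableI.
rewrite PD; last by apply: mpre; apply: measurable_sum => j; apply: measurable_funM.
rewrite [RHS]PD; last first.
  apply: mpre; apply: measurable_sum => j; apply: measurable_funM => //.
  exact: measurable_normal_seq.
congr (P _); apply/seteqP; split => w [/= Aw Nw]; split => //; move: Aw;
  by congr (A _); apply: eq_bigr => j _; rewrite /Z indicE mem_set// mul1r.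
Qed.

End gaussian_sequence.

(** * Geometry of the gasket *)

Lemma I3_ind (P : 'I_3 -> Prop) : P 0 -> P 1 -> P 2 -> forall i, P i.
Proof.
move=> P0 P1 P2 [[|[|[|//]]] h].
- by rewrite (_ : Ordinal h = 0)//; exact: val_inj.
- by rewrite (_ : Ordinal h = 1)//; exact: val_inj.
- by rewrite (_ : Ordinal h = 2)//; exact: val_inj.
Qed.

Lemma sum_I3 (V : zmodType) (F : 'I_3 -> V) : \sum_i F i = F 0 + F 1 + F 2.
Proof.
rewrite !big_ord_recl big_ord0 addr0 addrA.
by congr (F _ + F _ + F _); exact: val_inj.
Qed.

Section gasket.
Context {R : realType}.
Variables (p : 'I_3 -> R * R) (K : set (R * R)).
Hypothesis p_eq : equilateral p.
Hypothesis K_gasket : sierpinski_gasket p K.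

(* The barycentric coordinates of [z] with respect to [p]: for an equilateral
   triangle of side 1 with centroid [c], they are 1/3 + 2 <z - c, p_i - c>. *)
Definition bary (i : 'I_3) (z : R * R) : R :=
  let c1 := ((p 0).1 + (p 1).1 + (p 2).1) / 3 in
  let c2 := ((p 0).2 + (p 1).2 + (p 2).2) / 3 in
  3^-1 + 2 * ((z.1 - c1) * ((p i).1 - c1) + (z.2 - c2) * ((p i).2 - c2)).

Lemma half_map_fst i z : (half_map p i z).1 = 2^-1 * (z.1 - (p i).1) + (p i).1.
Proof. by []. Qed.

Lemma half_map_snd i z : (half_map p i z).2 = 2^-1 * (z.2 - (p i).2) + (p i).2.
Proof. by []. Qed.

Let side01 := p_eq (isT : (0 : 'I_3) != 1).
Let side02 := p_eq (isT : (0 : 'I_3) != 2).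
Let side12 := p_eq (isT : (1 : 'I_3) != 2).

Lemma bary_vertex i j : bary i (p j) = (i == j)%:R.
Proof.
(* After expansion, each of the nine values is an affine function of the three squared side lengths,
   so linear arithmetic suffices. *)
have h01 := side01; have h02 := side02; have h12 := side12.
by rewrite /bary /=; elim/I3_ind: i; elim/I3_ind: j => /=;
  rewrite ?eqxx /=; lra.
Qed.

Lemma bary_sum z : bary 0 z + bary 1 z + bary 2 z = 1.
Proof. by rewrite /bary /=; field. Qed.

Lemma bary_half_map i j z : bary i (half_map p j z) = (bary i z + (i == j)%:R) / 2.
Proof.
by rewrite -bary_vertex /bary half_map_fst half_map_snd /=; field.
Qed.

Lemma bary_inj z z' : (forall i, bary i z = bary i z') -> z = z'.
Proof.
move=> h; have := h 0; have := h 1; rewrite /bary /=.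
have h01 := side01; have h02 := side02; have h12 := side12.
case: z {h} => x y; case: z' => x' y' /=.
set a := (p 0).1 in h01 h02 h12 *; set b := (p 0).2 in h01 h02 h12 *.
set c := (p 1).1 in h01 h02 h12 *; set d := (p 1).2 in h01 h02 h12 *.
set e := (p 2).1 in h01 h02 h12 *; set f := (p 2).2 in h01 h02 h12 *.
pose X0 := a - (a + c + e) / 3; pose Y0 := b - (b + d + f) / 3.
pose X1 := c - (a + c + e) / 3; pose Y1 := d - (b + d + f) / 3.
move=> e1 e0.
have E0 : (x - x') * X0 + (y - y') * Y0 = 0 by rewrite /X0 /Y0; lra.
have E1 : (x - x') * X1 + (y - y') * Y1 = 0 by rewrite /X1 /Y1; lra.
(* The vectors from the centroid to [p 0] and [p 1] have squared norm 1/3 and inner product -1/6, so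
   their Gram determinant is 1/9 - 1/36; Cramer's rule concludes. *)
have D : (X0 * Y1 - X1 * Y0) ^+ 2 = 12^-1.
  have n0 : X0 ^+ 2 + Y0 ^+ 2 = 3^-1 by rewrite /X0 /Y0; lra.
  have n1 : X1 ^+ 2 + Y1 ^+ 2 = 3^-1 by rewrite /X1 /Y1; lra.
  have n2 : X0 * X1 + Y0 * Y1 = - 6^-1 by rewrite /X0 /Y0 /X1 /Y1; lra.
  have -> : (X0 * Y1 - X1 * Y0) ^+ 2 =
    (X0 ^+ 2 + Y0 ^+ 2) * (X1 ^+ 2 + Y1 ^+ 2) - (X0 * X1 + Y0 * Y1) ^+ 2 by ring.
  by rewrite n0 n1 n2; lra.
have D0 : X0 * Y1 - X1 * Y0 != 0.
  apply/eqP => D0; move: D; rewrite D0 expr0n /=; lra.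
have xx : x - x' = 0.
  apply: (mulfI D0); rewrite mulr0.
  transitivity (((x - x') * X0 + (y - y') * Y0) * Y1 - ((x - x') * X1 + (y - y') * Y1) * Y0).
    by ring.
  by rewrite E0 E1; ring.
have yy : y - y' = 0.
  apply: (mulfI D0); rewrite mulr0.
  transitivity (((x - x') * X1 + (y - y') * Y1) * X0 - ((x - x') * X0 + (y - y') * Y0) * X1).
    by ring.
  by rewrite E0 E1; ring.
by congr pair; apply/eqP; rewrite -subr_eq0 ?xx ?yy.
Qed.

Lemma bary_continuous i : continuous (bary i).
Proof.
move=> z; rewrite /bary; apply: cvgD; first exact: cvg_cst.
apply: cvgM; first exact: cvg_cst.
apply: cvgD; apply: cvgM; try exact: cvg_cst.
- by apply: cvgB; [exact: cvg_fst|exact: cvg_cst].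
- by apply: cvgB; [exact: cvg_snd|exact: cvg_cst].
Qed.

Lemma vertex_inj : injective p.
Proof.
move=> i j pij; have := bary_vertex i j; rewrite -pij bary_vertex eqxx.
by case: eqVneq => // _ /eqP; rewrite oner_eq0.
Qed.

Lemma half_map_inj i : injective (half_map p i).
Proof.
move=> x y xy; apply: bary_inj => j; have := congr1 (bary j) xy.
by rewrite !bary_half_map; lra.
Qed.

Lemma half_map_vertex i : half_map p i (p i) = p i.
Proof. by rewrite /half_map subrr scaler0 add0r. Qed.

Lemma half_map_vertexC i j : half_map p i (p j) = half_map p j (p i).
Proof.
apply: bary_inj => k; rewrite !bary_half_map !bary_vertex; ring.
Qed.

Lemma gasket_half_map i z : K z -> K (half_map p i z).
Proof.
by move=> Kz; case: K_gasket => _ _ ->; exists i => //; exists z.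
Qed.

Lemma gasket_split z : K z -> exists i, exists2 y, K y & half_map p i y = z.
Proof.
by case: K_gasket => _ _ KE; rewrite {1}KE => -[i _ [y Ky <-]]; exists i, y.
Qed.

(** Let m be the minimum over K, attained at the image of some y in K under the j-th map. By
    [bary_half_map], m >= m / 2, hence m >= 0: K lies in the triangle. *)
Lemma bary_ge0 i z : K z -> 0 <= bary i z.
Proof.
move=> Kz; case: K_gasket => K0 cK _.
have [c cK' cmin] := compact_EVT_min K0 cK (continuous_subspaceT (@bary_continuous i)).
have [j [y Ky yc]] := gasket_split (set_mem cK').
apply: le_trans (cmin z (mem_set Kz)).
have := cmin y (mem_set Ky); rewrite -yc bary_half_map.
by have : (0 : R) <= (i == j)%:R by []; lra.
Qed.

Lemma bary_eq1 i z : K z -> 1 <= bary i z -> z = p i.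
Proof.
move=> Kz h; apply: bary_inj => j; rewrite bary_vertex.
have := bary_sum z; have := bary_ge0 0 Kz; have := bary_ge0 1 Kz.
have := bary_ge0 2 Kz; move: h.
by elim/I3_ind: i; elim/I3_ind: j => /=; rewrite ?eqxx /=; lra.
Qed.

(** The maximum M of [bary i] over K satisfies M >= (M + 1) / 2, as the i-th map sends K into K; so
    M >= 1, and only the vertex reaches 1. *)
Lemma gasket_vertex i : K (p i).
Proof.
case: K_gasket => K0 cK _.
have [c /set_mem cK' cmax] := compact_EVT_max K0 cK (continuous_subspaceT (@bary_continuous i)).
suff <- : c = p i by [].
apply: bary_eq1 => //.
by have := cmax _ (mem_set (gasket_half_map i cK')); rewrite bary_half_map eqxx /=; lra.
Qed.

(** The j-th coordinate of a point of cell j is at least 1/2, whereas in cell i it is half that of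
    x, so x has j-th coordinate at least 1. Distinct cells thus share at most one point, on which
    all decompositions over cells depend. *)
Lemma half_map_overlap i j x y : i != j -> K x -> K y ->
  half_map p i x = half_map p j y -> x = p j /\ y = p i.
Proof.
move=> ij Kx Ky xy; split; apply: bary_eq1 => //.
  have := congr1 (bary j) xy; rewrite !bary_half_map eqxx (eq_sym j) (negbTE ij) /=.
  by have := bary_ge0 j Ky; lra.
have := congr1 (bary i) xy; rewrite !bary_half_map eqxx (negbTE ij) /=.
by have := bary_ge0 i Kx; lra.
Qed.

Lemma cell_map_cat v w x : cell_map p (v ++ w) x = cell_map p v (cell_map p w x).
Proof. by elim: v => //= i v ->. Qed.

Lemma gasket_cell_map w z : K z -> K (cell_map p w z).
Proof. by elim: w => //= i w IH Kz; exact/gasket_half_map/IH. Qed.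

Lemma gasket_cover n z : K z -> exists w : seq 'I_3, size w = n /\ exists2 y, K y & cell_map p w y = z.
Proof.
elim: n z => [|n IH] z Kz; first by exists [::]; split => //; exists z.
have [i [y Ky <-]] := gasket_split Kz; have [w [sw [x Kx <-]]] := IH y Ky.
by exists (i :: w); split; [rewrite /= sw|exists x].
Qed.

Lemma half_map_diff i x y : half_map p i x - half_map p i y = 2^-1 *: (x - y).
Proof.
rewrite /half_map opprD addrACA subrr addr0 -scalerBr.
by rewrite opprB addrA subrK.
Qed.

Lemma cell_map_diff w x y :
  cell_map p w x - cell_map p w y = 2^-1 ^+ size w *: (x - y).
Proof.
elim: w => [|i w IH] /=; first by rewrite expr0 scale1r.
by rewrite half_map_diff IH scalerA -exprS.
Qed.

End gasket.

(** * Energy *)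

Section edge_sums.
Context {R : realType}.
Variables (p : 'I_3 -> R * R).
Implicit Types f g h : R * R -> R.

(* Without the normalization, and with each edge counted twice. *)
Fixpoint edge_sum (m : nat) f g : R :=
  if m is m'.+1 then
    \sum_i edge_sum m' (f \o half_map p i) (g \o half_map p i)
  else \sum_i \sum_j (f (p i) - f (p j)) * (g (p i) - g (p j)).

Lemma edge_sumC m f g : edge_sum m f g = edge_sum m g f.
Proof.
elim: m f g => [|m IH] f g /=; last by apply: eq_bigr => i _; exact: IH.
by apply: eq_bigr => i _; apply: eq_bigr => j _; rewrite mulrC.
Qed.

Lemma edge_sumDl m (a : R) f g h :
  edge_sum m (fun x => a * f x + g x) h = a * edge_sum m f h + edge_sum m g h.
Proof.
elim: m f g h => [|m IH] f g h /=; rewrite mulr_sumr -big_split /=; last first.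
  by apply: eq_bigr => i _; exact: IH.
apply: eq_bigr => i _; rewrite mulr_sumr -big_split /=.
by apply: eq_bigr => j _; ring.
Qed.

Lemma edge_sumDr m (a : R) f g h :
  edge_sum m h (fun x => a * f x + g x) = a * edge_sum m h f + edge_sum m h g.
Proof. by rewrite edge_sumC edge_sumDl !(edge_sumC _ h). Qed.

Lemma edge_sumZl m (a : R) f h : edge_sum m (fun x => a * f x) h = a * edge_sum m f h.
Proof.
elim: m f h => [|m IH] f h /=; rewrite mulr_sumr; last by apply: eq_bigr => i _; exact: IH.
apply: eq_bigr => i _; rewrite mulr_sumr; apply: eq_bigr => j _; ring.
Qed.

Lemma edge_sumZr m (a : R) f h : edge_sum m h (fun x => a * f x) = a * edge_sum m h f.
Proof. by rewrite edge_sumC edge_sumZl edge_sumC. Qed.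

Lemma edge_sum_ge0 m f : 0 <= edge_sum m f f.
Proof.
elim: m f => [|m IH] f /=; apply: sumr_ge0 => i _ //.
by apply: sumr_ge0 => j _; rewrite -expr2 sqr_ge0.
Qed.

Lemma edge_sum_cell f (w : seq 'I_3) i j :
  (f (cell_map p w (p i)) - f (cell_map p w (p j))) ^+ 2 <= edge_sum (size w) f f.
Proof.
elim: w f => [|a w IH] f /=.
  rewrite (bigD1 i)//= (bigD1 j)//= -expr2 -addrA lerDl addr_ge0//.
    by apply: sumr_ge0 => k _; rewrite -expr2 sqr_ge0.
  by apply: sumr_ge0 => k _; apply: sumr_ge0 => l _; rewrite -expr2 sqr_ge0.
rewrite (bigD1 a)//= (le_trans (IH (f \o half_map p a)))// lerDl.
by apply: sumr_ge0 => k _; exact: edge_sum_ge0.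
Qed.

End edge_sums.

Section gasket_energy.
Context {R : realType}.
Variables (p : 'I_3 -> R * R) (K : set (R * R)).
Hypothesis p_eq : equilateral p.
Hypothesis K_gasket : sierpinski_gasket p K.
Implicit Types f g h : R * R -> R.

Lemma vertices_gasket m x : vertices p m x -> K x.
Proof.
elim: m x => [|m IH] x /=; first by move=> [i _ <-]; exact: gasket_vertex K_gasket i.
by move=> [i _ [y /IH Ky <-]]; apply: (gasket_half_map K_gasket).
Qed.

Lemma vertices_cell m x : vertices p m x <->
  exists w : seq 'I_3, size w = m /\ exists i, cell_map p w (p i) = x.
Proof.
elim: m x => [|m IH] x /=.
  split; first by move=> [i _ <-]; exists [::]; split => //; exists i.
  by move=> [w [/size0nil -> [i <-]]]; exists i.
split.
  move=> [a _ [y /IH[w [sw [i <-]]] <-]]; exists (a :: w); split; first by rewrite /= sw.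
  by exists i.
move=> [[|a w] [] //= [sw] [i <-]]; exists a => //; exists (cell_map p w (p i)) => //.
by apply/IH; exists w; split => //; exists i.
Qed.

Lemma oriented_edges0 : oriented_edges p 0 =
  [set (p ij.1, p ij.2) | ij in [set ij : 'I_3 * 'I_3 | ij.1 != ij.2]].
Proof.
apply/seteqP; split => -[x y] /=.
  case=> /= -[i _ <-] [j _ <-] [xy _]; exists (i, j) => //=.
  by apply/eqP => ij; apply: xy; rewrite ij.
move=> [[i j] /= ij E]; case: E => <- <-; split; [by exists i|by exists j|].
split; first by move=> /(vertex_inj p_eq) eij; rewrite eij eqxx in ij.
by exists [tuple]; split => /=; [exists (p i)|exists (p j)] => //; [exists i|exists j].
Qed.

Definition edge_map (a : 'I_3) (e : (R * R) * (R * R)) :=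
  (half_map p a e.1, half_map p a e.2).

Lemma oriented_edgesS m : oriented_edges p m.+1 =
  edge_map 0 @` oriented_edges p m `|` edge_map 1 @` oriented_edges p m
    `|` edge_map 2 @` oriented_edges p m.
Proof.
suff -> : oriented_edges p m.+1 = \bigcup_a (edge_map a @` oriented_edges p m).
  apply/seteqP; split => e.
    by move=> [a _]; elim/I3_ind: a => h; [left; left|left; right|right].
  by move=> [[h|h]|h]; [exists 0|exists 1|exists 2].
apply/seteqP; split => -[x y] /=.
  case=> /= _ _ [xy [[[//|a w] /= sw] [[_ [i _ <-] xE] [_ [j _ <-] yE]]]]; subst x y.
  exists a => //; exists (cell_map p w (p i), cell_map p w (p j)) => //=.
  move: sw => /eqP[sw].
  split => /=.
  - by apply/vertices_cell; exists w; split => //; exists i.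
  - by apply/vertices_cell; exists w; split => //; exists j.
  - split; first by move=> h; apply: xy => /=; rewrite h.
    have sw' : size w == m by apply/eqP.
    by exists (Tuple sw'); split => /=; [exists (p i)|exists (p j)] => //; [exists i|exists j].
move=> [a _ [[x' y'] [/= vx vy [xy [w [wx wy]]]] E]].
have /= <- := congr1 fst E; have /= <- := congr1 snd E.
split => /=.
- by exists a => //; exists x'.
- by exists a => //; exists y'.
- split; first by move=> /(half_map_inj p_eq).
  exists [tuple of a :: w]; split => /=.
    by case: wx => z pz <-; exists z.
  by case: wy => z pz <-; exists z.
Qed.

Lemma edge_map_inj a : injective (edge_map a).
Proof.
move=> [x y] [x' y'] E; congr pair; apply: (@half_map_inj _ _ p_eq a).
- exact: (congr1 fst E).
- exact: (congr1 snd E).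
Qed.

Lemma finite_oriented_edges m : finite_set (oriented_edges p m).
Proof.
elim: m => [|m IH]; first by rewrite oriented_edges0; exact: finite_image.
by rewrite oriented_edgesS !finite_setU; split; [split|]; exact: finite_image.
Qed.

(** Two distinct cells meet in one point at most, so an edge lying in both would have equal ends. *)
Lemma edge_map_disjoint a b m : a != b ->
  edge_map a @` oriented_edges p m `&` edge_map b @` oriented_edges p m = set0.
Proof.
move=> ab; apply/seteqP; split => // _ [[[x y] [/= vx vy [xy _]] <-] [[x' y'] [/= vx' vy' _] E]].
have [xb _] := half_map_overlap p_eq K_gasket ab (vertices_gasket vx)
  (vertices_gasket vx') (esym (congr1 fst E)).
have [yb _] := half_map_overlap p_eq K_gasket ab (vertices_gasket vy)
  (vertices_gasket vy') (esym (congr1 snd E)).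
by apply: xy; rewrite xb yb.
Qed.

(** Edges of level m + 1 split into three disjoint copies of those of level m, which is the
    recursion of [edge_sum]; at level 0 the pairs with i = j only add zeros. *)
Lemma edge_sumE m f g :
  \sum_(e \in oriented_edges p m) (f e.1 - f e.2) * (g e.1 - g e.2) = edge_sum p m f g.
Proof.
elim: m f g => [|m IH] f g.
  rewrite oriented_edges0 fsbig_image; last first.
    by move=> [i j] [i' j'] _ _ /= [/(vertex_inj p_eq)-> /(vertex_inj p_eq)->].
  rewrite (fsbig_widen _ setT)//; last first.
    move=> [i j] [_ /= /negP]; rewrite negbK => /eqP ->.
    by rewrite subrr mul0r.
  rewrite /= pair_bigA /= (fsbigE (index_enum _)) ?index_enum_uniq//.
    by apply: eq_bigl => i; apply/mem_set.
  by move=> i _; rewrite /= mem_index_enum.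
have fin a : finite_set (edge_map a @` oriented_edges p m).
  by apply: finite_image; exact: finite_oriented_edges.
have sumE a : \sum_(e \in edge_map a @` oriented_edges p m) (f e.1 - f e.2) * (g e.1 - g e.2)
    = edge_sum p m (f \o half_map p a) (g \o half_map p a).
  rewrite fsbig_image; last by move=> e e' _ _; exact: edge_map_inj.
  exact: (IH (f \o half_map p a) (g \o half_map p a)).
rewrite oriented_edgesS fsbigU0; last first.
- by rewrite setIUl !edge_map_disjoint// setU0.
- exact: fin.
- by rewrite finite_setU; split.
rewrite fsbigU0; last first.
- by rewrite edge_map_disjoint.
- exact: fin.
- exact: fin.
by rewrite [RHS]/= sum_I3 !sumE.
Qed.

Lemma graph_energyE m f g :
  graph_energy p m f g = (5 / 3) ^+ m / 3 * edge_sum p m f g.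
Proof.
rewrite /graph_energy edge_sumE mulrA; congr (_ * _).
by rewrite exprS expr_div_n; field; rewrite expf_eq0 pnatr_eq0 andbF.
Qed.

(** The harmonic extension gives a midpoint 2/5 of the values at its two neighbouring vertices and
    1/5 of the opposite one, with equality here. In the deviations [u], [v], [t] from it, the
    difference of the two sides is a positive definite quadratic form. Hence the factor 5/3 and the
    monotonicity of the energies. *)
Lemma edge_sum_step0 f : edge_sum p 0 f f <= 5 / 3 * edge_sum p 1 f f.
Proof.
rewrite /= !sum_I3 /= !half_map_vertex.
rewrite (half_map_vertexC p_eq 1 0) (half_map_vertexC p_eq 2 0) (half_map_vertexC p_eq 2 1).
set A := f (p 0); set B := f (p 1); set C := f (p 2).
set x := f (half_map p 1 (p 2)); set y := f (half_map p 0 (p 2)); set z := f (half_map p 0 (p 1)).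
pose u := x - (A + 2 * B + 2 * C) / 5.
pose v := y - (2 * A + B + 2 * C) / 5.
pose t := z - (2 * A + 2 * B + C) / 5.
rewrite -subr_ge0.
rewrite [X in 0 <= X](_ : _ = 5 / 3 * 2 * (2 * (u ^+ 2 + v ^+ 2 + t ^+ 2) +
  (u - v) ^+ 2 + (v - t) ^+ 2 + (t - u) ^+ 2)); last by rewrite /u /v /t; field.
by rewrite mulr_ge0// !addr_ge0 ?sqr_ge0// mulr_ge0// !addr_ge0 ?sqr_ge0.
Qed.

Lemma edge_sum_step m f : edge_sum p m f f <= 5 / 3 * edge_sum p m.+1 f f.
Proof.
elim: m f => [|m IH] f; first exact: edge_sum_step0.
rewrite [leLHS]/= [X in _ <= _ * X]/= mulr_sumr; apply: ler_sum => i _.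
exact: IH.
Qed.

Lemma graph_energy_ge0 m f : 0 <= graph_energy p m f f.
Proof. by rewrite graph_energyE mulr_ge0 ?edge_sum_ge0// divr_ge0// exprn_ge0. Qed.

Lemma graph_energy_nd f : nondecreasing_seq (fun m => graph_energy p m f f).
Proof.
apply/nondecreasing_seqP => m; rewrite !graph_energyE exprSr -!mulrA.
rewrite ler_wpM2l ?exprn_ge0//.
by have := edge_sum_step m f; lra.
Qed.

Lemma energy_cvg f : (fun m => (graph_energy p m f f)%:E) @ \oo --> energy p f.
Proof.
apply: ereal_nondecreasing_is_cvgn => m n mn; rewrite lee_fin.
exact: graph_energy_nd.
Qed.

Definition finite_energy f := (energy p f < +oo)%E.

Lemma finite_energyP f :
  finite_energy f <-> exists C, forall m, graph_energy p m f f <= C.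
Proof.
split.
  move=> fin; have fE : energy p f \is a fin_num.
    rewrite ge0_fin_numE//; apply: lime_ge; first exact: energy_cvg.
    by apply: nearW => m; rewrite lee_fin graph_energy_ge0.
  exists (fine (energy p f)) => m; rewrite -lee_fin fineK//.
  apply: lime_ge; first exact: energy_cvg.
  by exists m => // n /= mn; rewrite lee_fin graph_energy_nd.
move=> [C hC]; apply: (@le_lt_trans _ _ C%:E); last exact: ltry.
by apply: lime_le; [exact: energy_cvg|apply: nearW => m; rewrite lee_fin].
Qed.

Lemma finite_energy_lin (a : R) f g : finite_energy f -> finite_energy g ->
  finite_energy (fun x => a * f x + g x).
Proof.
move=> /finite_energyP[C hC] /finite_energyP[D hD]; apply/finite_energyP.
exists (2 * a ^+ 2 * C + 2 * D) => m.
have : graph_energy p m (fun x => a * f x + g x) (fun x => a * f x + g x) <=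
   2 * a ^+ 2 * graph_energy p m f f + 2 * graph_energy p m g g.
  have := graph_energy_ge0 m (fun x => -1 * g x + a * f x).
  rewrite !graph_energyE !(edge_sumDl, edge_sumDr, edge_sumZl, edge_sumZr) (edge_sumC _ _ g f).
  lra.
move/le_trans; apply; apply: lerD; last by rewrite ler_pM2l.
by rewrite ler_wpM2l// mulr_ge0 ?sqr_ge0.
Qed.

Lemma graph_energyDl m (a : R) f g h :
  graph_energy p m (fun x => a * f x + g x) h =
  a * graph_energy p m f h + graph_energy p m g h.
Proof. by rewrite !graph_energyE edge_sumDl; ring. Qed.

Lemma graph_energyC m f g : graph_energy p m f g = graph_energy p m g f.
Proof. by rewrite !graph_energyE edge_sumC. Qed.

Lemma is_cvg_graph_energy f : finite_energy f ->
  cvgn (fun m => graph_energy p m f f).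
Proof.
move=> /finite_energyP[C hC]; apply: nondecreasing_is_cvgn.
  exact: graph_energy_nd.
by exists C => _ [m _ <-].
Qed.

(** Polarization reduces the claim to energies of single functions, which are monotone and
    bounded. *)
Lemma energy_form_cvg f g : finite_energy f -> finite_energy g ->
  (fun m => graph_energy p m f g) @ \oo --> energy_form p f g.
Proof.
move=> ff fg; have ffg := finite_energy_lin 1 ff fg.
suff : cvgn (fun m => graph_energy p m f g) by [].
pose u m := graph_energy p m (fun x => 1 * f x + g x) (fun x => 1 * f x + g x).
rewrite (_ : (fun m => _) = (fun m => 2^-1 * (u m - graph_energy p m f f - graph_energy p m g g))).
  apply: (@cvgP _ _ (2^-1 * (limn u - limn (fun m => graph_energy p m f f) -
    limn (fun m => graph_energy p m g g)))).
  apply: cvgM; first exact: cvg_cst.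
  by apply: cvgB; [apply: cvgB|]; exact: is_cvg_graph_energy.
rewrite /u; apply/funext => m; rewrite !graph_energyDl !(graph_energyC m _ (fun x => 1 * f x + g x)).
by rewrite !graph_energyDl (graph_energyC m g f); lra.
Qed.

Lemma energy_formC f g : energy_form p f g = energy_form p g f.
Proof. by rewrite /energy_form; under eq_fun do rewrite graph_energyC. Qed.

Lemma energy_formDl (a : R) f g h :
  finite_energy f -> finite_energy g -> finite_energy h ->
  energy_form p (fun x => a * f x + g x) h =
  a * energy_form p f h + energy_form p g h.
Proof.
move=> ff fg fh; apply/cvg_lim => //.
under eq_fun do rewrite graph_energyDl.
apply: cvgD; last exact: energy_form_cvg.
by apply: cvgM; [exact: cvg_cst|exact: energy_form_cvg].
Qed.

Lemma energy_form_ge m f : finite_energy f ->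
  graph_energy p m f f <= energy_form p f f.
Proof.
move=> ff; apply: limr_ge; first exact: is_cvg_graph_energy.
by exists m => // n /= mn; exact: graph_energy_nd.
Qed.

Lemma energy_form_ge0 f : finite_energy f -> 0 <= energy_form p f f.
Proof. by move=> ff; apply: le_trans (energy_form_ge 0 ff); exact: graph_energy_ge0. Qed.

(** At level n a squared difference enters the energy with a weight of at least (5/3)^n / 3, so it
    is at most 3 (3/5)^n times the whole energy. *)
Lemma edge_osc f (w : seq 'I_3) i j : finite_energy f ->
  `|f (cell_map p w (p i)) - f (cell_map p w (p j))| <=
  Num.sqrt (3 * energy_form p f f) * (4 / 5) ^+ size w.
Proof.
move=> ff; have E0 := energy_form_ge0 ff.
rewrite -ler_sqr ?nnegrE ?mulr_ge0 ?sqrtr_ge0 ?exprn_ge0// ?divr_ge0//.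
rewrite real_normK ?num_real// exprMn sqr_sqrtr ?mulr_ge0//.
apply: le_trans (edge_sum_cell p f w i j) _.
have := energy_form_ge (size w) ff; rewrite graph_energyE => h.
have h1 : ((3 / 5) ^+ size w : R) <= (4 / 5) ^+ size w ^+ 2.
  by rewrite exprAC lerXn2r// ?nnegrE; lra.
apply: (@le_trans _ _ (3 * energy_form p f f * (3 / 5) ^+ size w)); last first.
  by rewrite ler_wpM2l// mulr_ge0.
have h2 : ((5 / 3) ^+ size w : R) * (3 / 5) ^+ size w = 1.
  by rewrite -exprMn (_ : 5 / 3 * (3 / 5) = 1) ?expr1n//; field.
have h3 : (0 : R) <= (3 / 5) ^+ size w by rewrite exprn_ge0// divr_ge0.
have := ler_wpM2r h3 h.
rewrite (_ : (5 / 3) ^+ size w / 3 * edge_sum p (size w) f f * (3 / 5) ^+ size w =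
  edge_sum p (size w) f f / 3 * ((5 / 3) ^+ size w * (3 / 5) ^+ size w)); last by ring.
rewrite h2; lra.
Qed.

(* Each step of the chain of nested cells [w ++ v] moves along an edge, by
   [edge_osc]; the bound is a geometric sum of ratio 4/5, chosen because its
   square exceeds 3/5. *)
Lemma cell_corner_osc f (w v : seq 'I_3) : finite_energy f ->
  `|f (cell_map p (w ++ v) (p 0)) - f (cell_map p w (p 0))| <=
  4 * Num.sqrt (3 * energy_form p f f) *
    ((4 / 5) ^+ size w - (4 / 5) ^+ (size w + size v)%N).
Proof.
move=> ff; elim: v w => [|a v IH] w.
  by rewrite cats0 addn0 !subrr mulr0 normr0.
rewrite cell_map_cat /=; set B := Num.sqrt _.
have := IH (w ++ [:: a]); rewrite !cell_map_cat !size_cat /= addn1 addnS addSn => h.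
have := edge_osc (w ++ [:: 0]) a 0 ff; rewrite size_cat /= addn1 !cell_map_cat /=.
rewrite half_map_vertex (half_map_vertexC p_eq 0 a) => h'.
set y := f (cell_map p w (p 0)) in h' *.
set z := f (cell_map p w (half_map p a (p 0))) in h h'.
rewrite -[X in `|X - _|](subrK z) -addrA.
apply: le_trans (ler_normD _ _) _; apply: le_trans (lerD h h') _.
by rewrite -/B exprS; lra.
Qed.

(** By continuity the point may be replaced, up to e, by a corner of a small enough subcell
    containing it, and [cell_corner_osc] is uniform in the depth of that subcell. *)
Lemma cell_osc f (w : seq 'I_3) x : {within K, continuous f} -> finite_energy f -> K x ->
  `|f (cell_map p w x) - f (cell_map p w (p 0))| <=
  4 * Num.sqrt (3 * energy_form p f f) * (4 / 5) ^+ size w.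
Proof.
move=> cf ff Kx; apply/ler_addgt0Pr => e e0.
have Kwx : K (cell_map p w x) by exact: gasket_cell_map.
have /subspace_continuousP/(_ _ Kwx)/cvgr_dist_lt/(_ e e0) := cf.
rewrite near_withinE => /nbhs_ballP[/= d d0 hd].
have [_ cK _] := K_gasket.
have [M [_ hM]] := compact_bounded cK.
have M1 : 0 < `|M| + 1 by rewrite ltr_wpDl.
have KM y : K y -> `|y| <= `|M| + 1.
  by move=> Ky; apply: (hM (`|M| + 1)) => //; rewrite (le_lt_trans (ler_norm M))// ltrDl.
have [n hn] : exists n : nat, 2^-1 ^+ n * (2 * (`|M| + 1)) < d.
  have : (fun n => 2^-1 ^+ n * (2 * (`|M| + 1))) @ \oo --> (0 : R).
    rewrite -[X in _ --> X](mul0r (2 * (`|M| + 1))); apply: cvgM; last exact: cvg_cst.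
    by apply: cvg_expr; rewrite ger0_norm// invf_lt1 ?ltr1n.
  by move/cvgr_lt => /(_ d d0) [n _ hn]; exists n; apply: hn => /=.
have [v [sv [y Ky yx]]] := gasket_cover K_gasket n Kx.
have := hd (cell_map p (w ++ v) (p 0)).
rewrite -ball_normE /= -yx -cell_map_cat cell_map_diff normrZ => h.
have {}h : `|f (cell_map p (w ++ v) y) - f (cell_map p (w ++ v) (p 0))| < e.
  apply: h; last by apply: gasket_cell_map => //; exact: gasket_vertex K_gasket 0.
  apply: le_lt_trans hn; rewrite size_cat exprD normrM -mulrA sv.
  rewrite !(@ger0_norm _ (2^-1 ^+ _)) ?exprn_ge0//.
  apply: (@le_trans _ _ (1 * (2^-1 ^+ n * `|y - p 0|))).
    by rewrite ler_wpM2r ?mulr_ge0 ?exprn_ge0// exprn_ile1// invf_le1// ler1n.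
  rewrite mul1r ler_wpM2l ?exprn_ge0//.
  apply: le_trans (ler_normB _ _) _; rewrite mulrDl mul1r.
  have := KM _ Ky; have := KM _ (gasket_vertex p_eq K_gasket 0); lra.
have h' := cell_corner_osc w v ff.
have q0 : (0 : R) <= (4 / 5) ^+ (size w + size v)%N by rewrite exprn_ge0// divr_ge0.
have B0 := sqrtr_ge0 (3 * energy_form p f f).
rewrite -(subrK (f (cell_map p (w ++ v) (p 0))) (f (cell_map p (w ++ v) y))) -addrA.
apply: le_trans (ler_normD _ _) _; rewrite [leRHS]addrC.
apply: lerD; first exact: ltW.
apply: le_trans h' _; rewrite mulrBr gerBl mulr_ge0// mulr_ge0//.
Qed.

(** The case of the empty word in [cell_osc], with f vanishing at [p 0]; 48 is 4^2 * 3. *)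
Lemma dirichlet_sup f x : dirichlet_domain p K f -> K x ->
  f x ^+ 2 <= 48 * energy_form p f f.
Proof.
move=> [cf ff f0] Kx; have := cell_osc [::] cf ff Kx.
rewrite /= f0 subr0 expr0 mulr1 -ler_sqr ?nnegrE ?mulr_ge0 ?sqrtr_ge0//.
rewrite real_normK ?num_real// exprMn sqr_sqrtr ?mulr_ge0 ?energy_form_ge0//.
by move/le_trans; apply; rewrite le_eqVlt; apply/orP; left; apply/eqP; ring.
Qed.

Lemma dirichlet_domain_lin (a : R) f g :
  dirichlet_domain p K f -> dirichlet_domain p K g ->
  dirichlet_domain p K (fun x => a * f x + g x).
Proof.
move=> [cf ff f0] [cg fg g0]; split.
- move=> x; apply: cvgD; last exact: cg.
  by apply: cvgM; [exact: cvg_cst|exact: cf].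
- exact: finite_energy_lin.
- by move=> i; rewrite f0 g0 mulr0 addr0.
Qed.

End gasket_energy.

(** * Square-integrable functions *)

Section plane_measurability.
Context {R : realType}.

(** An open set is the countable union of the rational boxes that it contains, and these belong to
    the product sigma-algebra. *)
Lemma open_plane_measurable (O : set (R * R)) : open O -> measurable O.
Proof.
move=> oO.
pose box (q : rat * rat * nat) : set (R * R) :=
  ball (ratr q.1.1 : R) (q.2.+1%:R^-1) `*` ball (ratr q.1.2 : R) (q.2.+1%:R^-1).
have -> : O = \bigcup_(q : rat * rat * nat) (if `[< box q `<=` O >] then box q else set0).
  apply/seteqP; split => z; last by move=> [q _]; case: asboolP => // /[apply].
  move=> Oz; have /nbhs_ballP[/= e e0 he] := open_nbhs_nbhs (conj oO Oz).
  (* Twice the radius must stay below e, since the box around z is centered at a rational point, not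
     at z. *)
  pose n := Num.truncn (2 / e).
  have n0 : (0 : R) < n.+1%:R^-1 by rewrite invr_gt0 ltr0n.
  have ne : 2 * n.+1%:R^-1 < e.
    by rewrite ltr_pdivrMr ?ltr0n// mulrC -ltr_pdivrMr//; exact: truncnS_gt.
  have ratball (t : R) : exists q : rat, ball (ratr q : R) n.+1%:R^-1 t.
    have [|y [/= ty [q _ qy]]] := @dense_rat R (ball t n.+1%:R^-1) _ (ball_open t _).
      by exists t; exact: ballxx.
    by exists q; rewrite qy; exact: ball_sym.
  have [q1 h1] := ratball z.1; have [q2 h2] := ratball z.2.
  exists (q1, q2, n) => //; case: asboolP => [_|]; first by split.
  case=> -[a b] [/= ha hb]; apply: he.
  have half (u v w : R) : ball u n.+1%:R^-1 v -> ball u n.+1%:R^-1 w -> ball v e w.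
    rewrite -!ball_normE /= => h h'; apply: le_lt_trans ne.
    rewrite (_ : v - w = (u - w) - (u - v)); last by ring.
    apply: le_trans (ler_normB _ _) _.
    by rewrite mulr_natl mulr2n; apply: lerD; exact: ltW.
  by split => /=; [exact: half h1 ha|exact: half h2 hb].
apply: countable_bigcupT_measurable => //.
move=> q; case: ifP => // _.
by apply: measurableX; apply: measurable_ball.
Qed.

Lemma closed_plane_measurable (C : set (R * R)) : closed C -> measurable C.
Proof.
move=> cC; rewrite -(setCK C); apply: measurableC; apply: open_plane_measurable.
exact: closed_openC.
Qed.

Lemma compact_plane_measurable (C : set (R * R)) : compact C -> measurable C.
Proof.
move=> cC; apply: closed_plane_measurable.
exact: (@compact_closed (R * R)%type C (@norm_hausdorff _ (R * R)%type) cC).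
Qed.

Lemma within_continuous_measurable_fun (K : set (R * R)) (f : R * R -> R) :
  {within K, continuous f} -> measurable_fun K f.
Proof.
move=> cf mK; apply: (measurability _ (RGenOInfty.measurableE R)) => //.
move=> _ [_ [x ->] <-].
have oX : open (`]x, +oo[%classic : set R) by rewrite set_itvoy; exact: open_gt.
have /continuousP/(_ _ oX) := cf.
move=> /open_subspaceP[V oV hV].
rewrite setIC -hV; apply: measurableI => //; exact: open_plane_measurable.
Qed.

End plane_measurability.

Section square_integrable.
Context {R : realType}.
Variables (K : set (R * R)) (mu : {measure set (R * R) -> \bar R}).
Hypothesis mK : measurable K.
Implicit Types f g h : R * R -> R.
Local Notation sqi := (square_integrable K mu).
Local Notation inner := (inner K mu).

Lemma sqi_mul_integrable f g : sqi f -> sqi g ->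
  mu.-integrable K (fun x => (f x * g x)%:E).
Proof.
move=> [mf f2] [mg g2].
have i2 h : measurable_fun K h -> (\int[mu]_(x in K) (h x ^+ 2)%:E < +oo)%E ->
    mu.-integrable K (fun x => (h x ^+ 2)%:E).
  move=> mh h2; apply/integrableP; split.
    by apply/measurable_EFinP; exact: measurable_funX.
  rewrite (eq_integral (fun x => (h x ^+ 2)%:E))// => x _.
  by rewrite abse_EFin ger0_norm ?sqr_ge0.
apply: (le_integrable mK _ _ (integrableD mK (i2 f mf f2) (i2 g mg g2))).
  by apply/measurable_EFinP; exact: measurable_funM.
move=> x Kx; apply: (@le_trans _ _ (f x ^+ 2 + g x ^+ 2)%:E); last first.
  by rewrite EFinD; exact: lee_abs.
rewrite abse_EFin lee_fin normrM.
rewrite -(real_normK (num_real (f x))) -(real_normK (num_real (g x))).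
have := sqr_ge0 (`|f x| - `|g x|); have := normr_ge0 (f x); have := normr_ge0 (g x); nra.
Qed.

Lemma sqi_lin (a : R) f g : sqi f -> sqi g -> sqi (fun x => a * f x + g x).
Proof.
move=> sf sg; have [mf f2] := sf; have [mg g2] := sg.
have mh : measurable_fun K (fun x => a * f x + g x).
  by apply: measurable_funD => //; exact: measurable_funM.
split => //.
have iff := sqi_mul_integrable sf sf; have ifg := sqi_mul_integrable sf sg.
have igg := sqi_mul_integrable sg sg.
have : mu.-integrable K (fun x => ((a * f x + g x) ^+ 2)%:E).
  apply: eq_integrable (integrableD mK (integrableD mK (integrableZl mK (a ^+ 2) iff)
     (integrableZl mK (2 * a) ifg)) igg) => // x _ /=.
  by rewrite -!EFinM -!EFinD; congr EFin; ring.
move=> /integrableP[_]; rewrite (eq_integral (fun x => ((a * f x + g x) ^+ 2)%:E))// => x _.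
by rewrite abse_EFin ger0_norm ?sqr_ge0.
Qed.

Lemma sqi0 : sqi (fun=> 0).
Proof.
split; first exact: measurable_cst.
by rewrite integral0_eq// => x _; rewrite expr0n.
Qed.

Lemma sqiZ a f : sqi f -> sqi (fun x => a * f x).
Proof.
move=> sf; have := sqi_lin a sf sqi0.
by congr (sqi _); apply/funext => x; rewrite addr0.
Qed.

Lemma sqiB f g : sqi f -> sqi g -> sqi (fun x => f x - g x).
Proof.
move=> sf sg; have := sqi_lin (-1) sg sf.
by congr (sqi _); apply/funext => x; rewrite mulN1r addrC.
Qed.

Lemma sqi_sum n (F : nat -> R * R -> R) : (forall j, sqi (F j)) ->
  sqi (fun x => \sum_(j < n) F j x).
Proof.
move=> sF; elim: n => [|n IH].
  by have := sqi0; congr (sqi _); apply/funext => x; rewrite big_ord0.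
have := sqi_lin 1 (sF n) IH.
by congr (sqi _); apply/funext => x; rewrite big_ord_recr /= mul1r addrC.
Qed.

Lemma sqi_integral f : sqi f ->
  (\int[mu]_(x in K) (f x ^+ 2)%:E)%E = (inner f f)%:E.
Proof.
move=> sf; rewrite /inner /Rintegral fineK.
  by apply: eq_integral => x _; rewrite expr2.
exact: (integrable_fin_num mK (sqi_mul_integrable sf sf)).
Qed.

Lemma innerC f g : inner f g = inner g f.
Proof. by apply: eq_Rintegral => x _; rewrite mulrC. Qed.

Lemma innerDl (a : R) f g h : sqi f -> sqi g -> sqi h ->
  inner (fun x => a * f x + g x) h = a * inner f h + inner g h.
Proof.
move=> sf sg sh; rewrite /inner.
have ifh := sqi_mul_integrable sf sh; have igh := sqi_mul_integrable sg sh.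
rewrite -RintegralZl// -RintegralD//.
  by apply: eq_Rintegral => x _; ring.
by apply: eq_integrable (integrableZl mK a ifh) => // x _.
Qed.

Lemma innerDr (a : R) f g h : sqi f -> sqi g -> sqi h ->
  inner h (fun x => a * f x + g x) = a * inner h f + inner h g.
Proof. by move=> sf sg sh; rewrite innerC innerDl// !(innerC _ h). Qed.

Lemma innerZl (a : R) f h : sqi f -> sqi h ->
  inner (fun x => a * f x) h = a * inner f h.
Proof.
move=> sf sh; rewrite /inner -RintegralZl//; last exact: sqi_mul_integrable.
by apply: eq_Rintegral => x _; rewrite mulrA.
Qed.

Lemma innerBl f g h : sqi f -> sqi g -> sqi h ->
  inner (fun x => f x - g x) h = inner f h - inner g h.
Proof.
move=> sf sg sh; rewrite (_ : (fun x => _) = (fun x => -1 * g x + f x)).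
  by rewrite innerDl// mulN1r addrC.
by apply/funext => x; rewrite mulN1r addrC.
Qed.

Lemma inner_suml n (F : nat -> R * R -> R) h : (forall j, sqi (F j)) -> sqi h ->
  inner (fun x => \sum_(j < n) F j x) h = \sum_(j < n) inner (F j) h.
Proof.
move=> sF sh; elim: n => [|n IH].
  rewrite big_ord0 /inner; under eq_Rintegral do rewrite big_ord0 mul0r.
  by rewrite /Rintegral integral0_eq.
rewrite big_ord_recr /= -IH addrC -[X in X + _]mul1r -innerDl//; last exact: sqi_sum.
by congr (inner _ _); apply/funext => x; rewrite big_ord_recr /= mul1r addrC.
Qed.

Lemma inner_ge0 f : 0 <= inner f f.
Proof. by apply: Rintegral_ge0 => x _; rewrite -expr2 sqr_ge0. Qed.

Lemma cauchy_schwarz f g : sqi f -> sqi g ->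
  inner f g ^+ 2 <= inner f f * inner g g.
Proof.
move=> sf sg.
have quad t : 0 <= t ^+ 2 * inner f f + 2 * t * inner f g + inner g g.
  have := inner_ge0 (fun x => t * f x + g x).
  rewrite innerDl//; last exact: sqi_lin.
  rewrite !innerDr// (innerC g f); lra.
have [f0|f0] := eqVneq (inner f f) 0.
  have [fg0|fg0] := eqVneq (inner f g) 0; first by rewrite fg0 f0 mul0r expr0n.
  (* Without its quadratic term the form is affine in t, and at this t it equals -1. *)
  have := quad (- (inner g g + 1) / (2 * inner f g)).
  rewrite f0 mulr0 add0r.
  have -> : 2 * (- (inner g g + 1) / (2 * inner f g)) * inner f g = - (inner g g + 1) by field.
  lra.
have fpos : 0 < inner f f by rewrite lt_neqAle eq_sym f0 inner_ge0.
have := quad (- inner f g / inner f f).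
have -> : (- inner f g / inner f f) ^+ 2 * inner f f +
    2 * (- inner f g / inner f f) * inner f g + inner g g =
    inner g g - inner f g ^+ 2 / inner f f by field.
by rewrite subr_ge0 ler_pdivrMr// mulrC.
Qed.

Lemma L2_cvgP u f : (forall n, sqi (u n)) -> sqi f ->
  L2_cvg K mu u f <->
  (fun n => inner (fun x => u n x - f x) (fun x => u n x - f x)) @ \oo --> (0 : R).
Proof.
move=> su sf; rewrite /L2_cvg.
have -> : (fun n => \int[mu]_(x in K) ((u n x - f x) ^+ 2)%:E)%E =
    EFin \o (fun n => inner (fun x => u n x - f x) (fun x => u n x - f x)).
  by apply/funext => n /=; rewrite (@sqi_integral (fun x => u n x - f x))//; exact: sqiB.
split=> [h|h]; last by apply: cvg_EFin => //; exact: nearW.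
have /fine_cvg h' : EFin \o (fun n => inner (fun x => u n x - f x) (fun x => u n x - f x)) @ \oo --> (0 : R)%:E := h.
exact: h'.
Qed.

Lemma inner_cvg u f g : (forall n, sqi (u n)) -> sqi f -> sqi g ->
  L2_cvg K mu u f -> (fun n => inner (u n) g) @ \oo --> inner f g.
Proof.
move=> su sf sg /(L2_cvgP su sf) uf.
apply/cvgrPdist_le => e e0.
have e1 : 0 < e ^+ 2 / (inner g g + 1).
  by rewrite divr_gt0 ?exprn_gt0// ltr_wpDl ?inner_ge0.
move/cvgr_lt : uf => /(_ _ e1); apply: filterS => n h.
have e0' := ltW e0; rewrite distrC -innerBl// -ler_sqr ?nnegrE// real_normK ?num_real//.
apply: le_trans (cauchy_schwarz _ sg) _; first exact: sqiB.
apply: (@le_trans _ _ (e ^+ 2 / (inner g g + 1) * (inner g g + 1))).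
  apply: ler_pM; rewrite ?inner_ge0//; [exact: ltW|by rewrite lerDl].
by rewrite divfK// gt_eqF// ltr_wpDl ?inner_ge0.
Qed.

(** * Orthonormal expansions *)

Section orthonormal_expansion.
Variable Phi : nat -> R * R -> R.
Hypothesis onb : orthonormal_basis K mu Phi.

Let sPhi j : sqi (Phi j).
Proof. by case: onb. Qed.

Let sterm a j : sqi (fun x => a * Phi j x).
Proof. exact: sqiZ. Qed.

Lemma sqi_partial_sum (a : nat -> R) n : sqi (fun x => \sum_(j < n) a j * Phi j x).
Proof. exact: (@sqi_sum n (fun j x => a j * Phi j x)). Qed.

Lemma inner_partial_sum (a : nat -> R) n g : sqi g ->
  inner (fun x => \sum_(j < n) a j * Phi j x) g =
  \sum_(j < n) a j * inner (Phi j) g.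
Proof.
move=> sg; rewrite (@inner_suml n (fun j x => a j * Phi j x))//.
by apply: eq_bigr => j _; rewrite innerZl.
Qed.

Lemma inner_partial_sum_basis (a : nat -> R) n i :
  inner (fun x => \sum_(j < n) a j * Phi j x) (Phi i) =
  if (i < n)%N then a i else 0.
Proof.
have [_ orth _] := onb.
rewrite inner_partial_sum//; under eq_bigr do rewrite orth.
case: ifPn => [ilt|ige].
  rewrite (bigD1 (Ordinal ilt))//= eqxx mulr1 big1 ?addr0// => j ji.
  rewrite (_ : (j == i :> nat) = false) ?mulr0//.
  by apply/negbTE; apply: contra ji => /eqP ji; apply/eqP/val_inj.
apply: big1 => j _; rewrite (_ : (j == i :> nat) = false) ?mulr0//.
by apply/negbTE; apply: contra ige => /eqP <-.
Qed.

Lemma inner_partial_sums (a : nat -> R) n :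
  inner (fun x => \sum_(j < n) a j * Phi j x) (fun x => \sum_(j < n) a j * Phi j x) =
  \sum_(j < n) a j ^+ 2.
Proof.
rewrite inner_partial_sum; last exact: sqi_partial_sum.
apply: eq_bigr => j _; rewrite innerC inner_partial_sum_basis ltn_ord.
by rewrite expr2.
Qed.

(** Inner products pass to the L2 limit, and the i-th coefficient of the partial sums is constant
    from n = i + 1 on. *)
Lemma coef_L2_limit (a : nat -> R) h i : sqi h ->
  L2_cvg K mu (fun n x => \sum_(j < n) a j * Phi j x) h -> inner (Phi i) h = a i.
Proof.
move=> sh ah; rewrite innerC.
have := inner_cvg (fun n => sqi_partial_sum a n) sh (sPhi i) ah.
move=> /cvg_lim <- //; apply: lim_near_cst => //.
by exists i.+1 => // n /= ni; rewrite inner_partial_sum_basis ni.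
Qed.

Lemma parseval f g : sqi f -> sqi g ->
  (fun n => \sum_(j < n) inner (Phi j) f * inner (Phi j) g) @ \oo --> inner f g.
Proof.
move=> sf sg; have [_ _ /(_ f sf) hf] := onb.
have := inner_cvg (fun n => sqi_partial_sum (fun j => inner (Phi j) f) n) sf sg hf.
rewrite (_ : (fun n => inner _ g) = (fun n => \sum_(j < n) inner (Phi j) f * inner (Phi j) g))//.
by apply/funext => n; exact: (inner_partial_sum (fun j => inner (Phi j) f) n sg).
Qed.

Lemma bessel f n : sqi f -> \sum_(j < n) inner (Phi j) f ^+ 2 <= inner f f.
Proof.
move=> sf; have := parseval sf sf.
under eq_fun do under eq_bigr do rewrite -expr2.
move=> h; rewrite -(cvg_lim _ h)//; apply: limr_ge; first by apply/cvg_ex; exists (inner f f).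
exists n => // m /= nm; rewrite -(subnKC nm) big_split_ord /= lerDl.
by apply: sumr_ge0 => j _; exact: sqr_ge0.
Qed.

End orthonormal_expansion.

(** The Weierstrass test: the sums converge uniformly on K at the rate [tail n], and over a set of
    finite measure this implies convergence in L2. The limit is an explicit pointwise sum, with no
    appeal to completeness of L2. *)
Lemma normally_convergent_L2 (F : nat -> R * R -> R) (M : nat -> R) :
  (mu K < +oo)%E -> (forall j, sqi (F j)) ->
  (forall j x, K x -> `|F j x| <= M j) -> cvgn (series M) ->
  exists2 h, sqi h & L2_cvg K mu (fun n x => \sum_(j < n) F j x) h.
Proof.
move=> muK sF FM cM.
have K0 : K !=set0 \/ K = set0 by have [|] := eqVneq K set0; [right|left; apply/set0P].
case: K0 => [[x0 Kx0]|K0]; last first.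
  exists (fun=> 0); first exact: sqi0.
  rewrite /L2_cvg (_ : (fun n => _) = cst 0%E); first exact: cvg_cst.
  by apply/funext => n; rewrite K0 integral_set0.
have M0 j : 0 <= M j by apply: le_trans (FM j x0 Kx0).
pose h x := limn (fun n => \sum_(j < n) F j x : R).
have serE x : (fun n => \sum_(j < n) F j x) = series (F ^~ x).
  by apply/funext => n; rewrite /series /= big_mkord.
have cF x : K x -> cvgn (fun n => \sum_(j < n) F j x : R).
  move=> Kx; rewrite serE; apply: normed_cvg.
  by apply: (series_le_cvg _ M0 _ cM) => n //=; exact: FM.
pose tail n := limn (series M) - series M n.
have tail0 : tail @ \oo --> (0 : R).
  by rewrite -[X in _ --> X](subrr (limn (series M))); apply: cvgB => //; exact: cvg_cst.
have tailP n x : K x -> `|\sum_(j < n) F j x - h x| <= tail n.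
  move=> Kx; rewrite distrC.
  have hc : (fun m => `|\sum_(j < m) F j x - \sum_(j < n) F j x|) @ \oo -->
      `|h x - \sum_(j < n) F j x|.
    by apply: cvg_norm; apply: cvgB; [exact: cF|exact: cvg_cst].
  rewrite -(cvg_lim _ hc)//; apply: limr_le; first by apply/cvg_ex; eexists; exact: hc.
  exists n => // m /= nm; rewrite -(subnKC nm) big_split_ord /= addrAC subrr add0r.
  apply: le_trans (ler_norm_sum _ _ _) _.
  apply: (@le_trans _ _ (series M m - series M n)).
    rewrite (_ : series M m = series M n + \sum_(i < m - n) M (n + i)%N); last first.
      by rewrite /series /= -{1}(subnKC nm) !big_mkord big_split_ord.
    by rewrite addrAC subrr add0r; apply: ler_sum => j _; exact: FM.
  rewrite lerD2r; apply: nondecreasing_cvgn_le => //.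
  by apply: nondecreasing_series => i _ _.
have mh : measurable_fun K h.
  apply: (@measurable_fun_cvg _ _ _ _ (fun n x => \sum_(j < n) F j x)).
    by move=> n; case: (sqi_sum n sF).
  by move=> x Kx; exact: cF.
have hb x : K x -> `|h x| <= tail 0%N.
  by move=> Kx; have := tailP 0%N x Kx; rewrite big_ord0 sub0r normrN.
have int_le (g : R * R -> R) (c : R) : measurable_fun K g -> 0 <= c -> (forall x, K x -> `|g x| <= c) ->
    (\int[mu]_(x in K) (g x ^+ 2)%:E <= (c ^+ 2)%:E * mu K)%E.
  move=> mg c0 gc; rewrite -integral_cst//; apply: ge0_le_integral => //.
  - by move=> x _; rewrite lee_fin sqr_ge0.
  - by apply/measurable_EFinP; exact: measurable_funX.
  - move=> x Kx /=; rewrite lee_fin -(real_normK (num_real (g x))).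
    by rewrite lerXn2r ?nnegrE//; exact: gc.
have tail_ge0 n : 0 <= tail n by apply: le_trans (tailP n x0 Kx0).
have muKfin : mu K \is a fin_num by rewrite ge0_fin_numE.
exists h.
  split => //; apply: le_lt_trans (int_le h _ mh (tail_ge0 0%N) hb) _.
  by rewrite -(fineK muKfin) -EFinM ltry.
rewrite /L2_cvg.
apply: (@squeeze_cvge _ _ _ _ (cst 0%E) _ (fun n => (tail n ^+ 2)%:E * mu K)%E).
- apply: nearW => n; apply/andP; split.
    by apply: integral_ge0 => x _; rewrite lee_fin sqr_ge0.
  apply: int_le => //.
    apply: measurable_funB => //; by case: (sqi_sum n sF).
  by move=> x Kx; exact: tailP.
- exact: cvg_cst.
- rewrite -(fineK muKfin); under eq_fun do rewrite -EFinM.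
  apply: cvg_EFin; first exact: nearW.
  rewrite [X in _ --> X](_ : _ = 0 ^+ 2 * fine (mu K)); last by rewrite expr0n mul0r.
  apply: cvgM; last exact: cvg_cst.
  by apply: cvgM.
Qed.

End square_integrable.

(** * Growth of the eigenvalues *)

Lemma exists_left_kernel (F : fieldType) (m n : nat) (A : 'M[F]_(m, n)) :
  (n < m)%N -> exists2 c : 'rV[F]_m, c != 0 & c *m A = 0.
Proof.
move=> nm; have : kermx A != 0.
  by rewrite -mxrank_eq0 mxrank_ker subn_eq0 -ltnNge (leq_ltn_trans (rank_leq_col A)).
by move=> /rowV0Pn[c /sub_kermxP cA c0]; exists c.
Qed.

Section eigenvalues.
Context {R : realType}.
Variables (p : 'I_3 -> R * R) (K : set (R * R)).
Variable (mu : {measure set (R * R) -> \bar R}).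
Variables (lam : nat -> R) (Phi : nat -> R * R -> R).
Hypothesis p_eq : equilateral p.
Hypothesis K_gasket : sierpinski_gasket p K.
Hypothesis mu_gasket : gasket_measure p K mu.
Hypothesis eig : dirichlet_eigensystem p K mu lam Phi.
Implicit Types f g h : R * R -> R.
Local Notation sqi := (square_integrable K mu).
Local Notation inner := (inner K mu).
Local Notation dom := (dirichlet_domain p K).

Lemma gasket_measurable : measurable K.
Proof. by case: K_gasket => _ cK _; exact: compact_plane_measurable. Qed.

Lemma gasket_mass : mu K = 1%E.
Proof.
case: mu_gasket => /(_ [::]) + _; rewrite expr0 /=.
by rewrite (_ : id @` K = K)// image_id.
Qed.

Let mK := gasket_measurable.

Lemma bounded_sqi f (C : R) : measurable_fun K f -> (forall x, K x -> f x ^+ 2 <= C) ->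
  sqi f /\ inner f f <= C.
Proof.
move=> mf fC.
have le : (\int[mu]_(x in K) (f x ^+ 2)%:E <= C%:E)%E.
  rewrite -[leRHS]mule1 -gasket_mass -integral_cst//; apply: ge0_le_integral => //.
  - by move=> x _; rewrite lee_fin sqr_ge0.
  - by apply/measurable_EFinP; exact: measurable_funX.
have sf : sqi f by split => //; exact: le_lt_trans le (ltry _).
by split => //; rewrite -lee_fin -sqi_integral.
Qed.

Lemma within_continuous_sqi f : {within K, continuous f} -> sqi f.
Proof.
move=> cf; case: K_gasket => K0 cK _.
have cf2 : {within K, continuous (fun x => f x ^+ 2)}.
  by move=> x; apply: cvgM; exact: cf.
have [c _ hc] := compact_EVT_max K0 cK cf2.
apply: (@bounded_sqi f (f c ^+ 2) (within_continuous_measurable_fun cf) _).1.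
by move=> x Kx; apply: hc; exact/mem_set.
Qed.

Lemma dirichlet_domain_sqi f : dom f -> sqi f.
Proof. by move=> [cf _ _]; exact: within_continuous_sqi. Qed.

Lemma dirichlet_domain_energy f : dom f -> finite_energy p f.
Proof. by case. Qed.

Lemma eigen_onb : orthonormal_basis K mu Phi.
Proof. by case: eig. Qed.

Lemma eigenfun_dom j : dom (Phi j).
Proof. by case: eig => _ _ _ _ /(_ j)[]. Qed.

Lemma eigenfun_sqi j : sqi (Phi j).
Proof. exact/dirichlet_domain_sqi/eigenfun_dom. Qed.

Lemma eigenvalue_gt0 j : 0 < lam j.
Proof. by case: eig => l0 lnd _ _ _; exact: lt_le_trans l0 (lnd 0%N j (leq0n j)). Qed.

Lemma eigenvalue_le i j : (i <= j)%N -> lam i <= lam j.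
Proof. by case: eig => _ lnd _ _ _; exact: lnd. Qed.

Lemma inner_eigenfun i j : inner (Phi i) (Phi j) = (i == j)%:R.
Proof. by case: eigen_onb => _ /(_ i j). Qed.

Lemma energy_eigenfun j g : dom g -> energy_form p (Phi j) g = lam j * inner (Phi j) g.
Proof.
move=> dg; case: eig => _ _ _ _ /(_ j)[_ _ /(_ g dg) ->].
rewrite innerZl//; [by rewrite mulNr opprK|exact: eigenfun_sqi|exact: dirichlet_domain_sqi].
Qed.

Lemma eigenfun_sup j x : K x -> Phi j x ^+ 2 <= 48 * lam j.
Proof.
move=> Kx; apply: le_trans (dirichlet_sup p_eq K_gasket (eigenfun_dom j) Kx) _.
by rewrite energy_eigenfun ?inner_eigenfun ?eqxx ?mulr1//; exact: eigenfun_dom.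
Qed.

Lemma dirichlet_domain0 : dom (fun=> 0).
Proof.
split; first by move=> x; exact: cvg_cst.
- apply/(finite_energyP p_eq K_gasket); exists 0 => m.
  rewrite (graph_energyE p_eq K_gasket).
  have := edge_sumZl p m 0 (fun=> 0) (fun=> 0); under eq_fun do rewrite mulr0.
  by move=> ->; rewrite mul0r mulr0.
- by [].
Qed.

Lemma dirichlet_domain_partial_sum (c : nat -> R) n : dom (fun x => \sum_(j < n) c j * Phi j x).
Proof.
elim: n => [|n IH].
  by have := dirichlet_domain0; congr dom; apply/funext => x; rewrite big_ord0.
have := dirichlet_domain_lin p_eq K_gasket (c n) (eigenfun_dom n) IH.
by congr dom; apply/funext => x; rewrite big_ord_recr /= addrC.
Qed.

Lemma energy_form0l g : finite_energy p g -> energy_form p (fun=> 0) g = 0.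
Proof.
move=> fg; have := energy_formDl p_eq K_gasket 1 (dirichlet_domain_energy dirichlet_domain0) (dirichlet_domain_energy dirichlet_domain0) fg.
under [X in energy_form p X g]eq_fun do rewrite mulr0 addr0.
set e := energy_form p _ g; clearbody e; lra.
Qed.

Lemma energy_partial_sum (c : nat -> R) n g : dom g ->
  energy_form p (fun x => \sum_(j < n) c j * Phi j x) g =
  \sum_(j < n) c j * (lam j * inner (Phi j) g).
Proof.
move=> dg; elim: n => [|n IH].
  rewrite big_ord0 (_ : (fun x => \sum_(j < 0) c j * Phi j x) = (fun=> 0)).
    exact/energy_form0l/dirichlet_domain_energy.
  by apply/funext => x; rewrite big_ord0.
rewrite (_ : (fun x => _) = (fun x => c n * Phi n x + \sum_(j < n) c j * Phi j x)).
  rewrite (energy_formDl p_eq K_gasket); try exact: dirichlet_domain_energy.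
  - by rewrite big_ord_recr /= -IH -energy_eigenfun// addrC.
  - exact/dirichlet_domain_energy/eigenfun_dom.
  - exact/dirichlet_domain_energy/dirichlet_domain_partial_sum.
by apply/funext => x; rewrite big_ord_recr /= addrC.
Qed.

Lemma energy_partial_sums (c : nat -> R) n :
  energy_form p (fun x => \sum_(j < n) c j * Phi j x) (fun x => \sum_(j < n) c j * Phi j x) =
  \sum_(j < n) lam j * c j ^+ 2.
Proof.
rewrite energy_partial_sum; last exact: dirichlet_domain_partial_sum.
apply: eq_bigr => j _; rewrite innerC (inner_partial_sum_basis mK eigen_onb) ltn_ord.
by rewrite mulrCA -expr2.
Qed.

(* A combination of the first 3^m + 1 eigenfunctions can be made to vanish at
   one corner of each of the 3^m cells, so that its supremum is controlled by
   the oscillation over the cells. *)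
Lemma eigenvalue_lower m : 1 <= 48 * lam (3 ^ m)%N * (16 / 25) ^+ m.
Proof.
pose N := #|{: m.-tuple 'I_3}|.
have NE : N = (3 ^ m)%N by rewrite /N card_tuple card_ord.
pose A : 'M[R]_(N.+1, N) := \matrix_(j, k) Phi j (cell_map p (enum_val k : m.-tuple 'I_3) (p 0)).
have [c c0 cA] := exists_left_kernel A (ltnSn N).
pose d (j : nat) : R := if insub j is Some i then c 0 (i : 'I_N.+1) else 0.
have dE (i : 'I_N.+1) : d i = c 0 i by rewrite /d valK.
pose f x := \sum_(j < N.+1) d j * Phi j x.
have df : dom f by exact: dirichlet_domain_partial_sum.
have f0 (w : m.-tuple 'I_3) : f (cell_map p w (p 0)) = 0.
  have := congr1 (fun B : 'rV_N => B 0 (enum_rank w)) cA; rewrite !mxE => <-.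
  by apply: eq_bigr => j _; rewrite mxE enum_rankK dE.
have norm_f : inner f f = \sum_(j < N.+1) d j ^+ 2.
  exact: (inner_partial_sums mK eigen_onb).
have norm_pos : 0 < inner f f.
  rewrite norm_f lt_neqAle eq_sym; apply/andP; split; last first.
    by apply: sumr_ge0 => j _; exact: sqr_ge0.
  rewrite psumr_eq0; last by move=> j _; exact: sqr_ge0.
  apply: contra c0 => /allP h; apply/eqP/rowP => i; rewrite mxE -dE.
  by have := h i (mem_index_enum i); rewrite sqrf_eq0 => /eqP.
have energy_f : energy_form p f f <= lam (3 ^ m)%N * inner f f.
  rewrite energy_partial_sums norm_f mulr_sumr; apply: ler_sum => j _.
  by rewrite ler_wpM2r ?sqr_ge0//; apply: eigenvalue_le; rewrite -NE -ltnS.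
have E0 := energy_form_ge0 p_eq K_gasket (dirichlet_domain_energy df).
have q2 : ((4 / 5) ^+ m ^+ 2 : R) = (16 / 25) ^+ m.
  by rewrite exprAC; congr (_ ^+ _); field.
have q0 : (0 : R) <= (16 / 25) ^+ m by rewrite exprn_ge0// divr_ge0.
have [cf _ _] := df.
have sup_f : inner f f <= 48 * energy_form p f f * (16 / 25) ^+ m.
  apply: (@bounded_sqi f _ (within_continuous_measurable_fun cf) _).2.
  move=> x Kx; have [w [sw [y Ky <-]]] := gasket_cover K_gasket m Kx.
  have sw' : size w == m by apply/eqP.
  have := cell_osc p_eq K_gasket w cf (dirichlet_domain_energy df) Ky.
  rewrite (f0 (Tuple sw')) subr0 sw -ler_sqr ?nnegrE ?mulr_ge0 ?sqrtr_ge0 ?exprn_ge0 ?divr_ge0//.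
  rewrite real_normK ?num_real// [X in _ <= X -> _]exprMn q2 exprMn sqr_sqrtr ?mulr_ge0//.
  by move/le_trans; apply; rewrite le_eqVlt; apply/orP; left; apply/eqP; ring.
(* The conclusion is ||f||^2 <= 48 (16/25)^m E(f) <= 48 (16/25)^m lam ||f||^2 divided by ||f||^2,
   with lam the eigenvalue of index 3^m. *)
rewrite -(ler_pM2r norm_pos) mul1r.
apply: le_trans sup_f _.
rewrite -!mulrA (mulrC ((16 / 25) ^+ m)) (mulrA (lam _)) ler_wpM2l//.
by rewrite ler_wpM2r.
Qed.

End eigenvalues.

(** * Copies of a function in the cells *)

Section transplant.
Context {R : realType}.
Variables (p : 'I_3 -> R * R) (K : set (R * R)).
Hypothesis p_eq : equilateral p.
Hypothesis K_gasket : sierpinski_gasket p K.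
Implicit Types f g h : R * R -> R.
Local Notation dom := (dirichlet_domain p K).

Definition double_map (i : 'I_3) (z : R * R) : R * R := (2 : R) *: (z - p i) + p i.

Lemma half_mapK i : cancel (half_map p i) (double_map i).
Proof.
move=> z; rewrite /double_map /half_map addrK scalerA mulfV ?scale1r ?subrK//.
Qed.

Lemma continuous_double_map i : continuous (double_map i).
Proof.
move=> z; apply: cvgD; last exact: cvg_cst.
by apply: cvgZl_tmp; apply: cvgB; [exact: cvg_id|exact: cvg_cst].
Qed.

Lemma continuous_half_map i : continuous (half_map p i).
Proof.
move=> z; apply: cvgD; last exact: cvg_cst.
by apply: cvgZl_tmp; apply: cvgB; [exact: cvg_id|exact: cvg_cst].
Qed.

Lemma closed_half_map_gasket i : closed (half_map p i @` K).
Proof.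
apply: compact_closed; first exact: (@norm_hausdorff _ (R * R)%type).
apply: continuous_compact; last by case: K_gasket.
exact/continuous_subspaceT/continuous_half_map.
Qed.

(* The copy of [f] in the cell [i], extended by 0. *)
Definition transplant1 i f z : R :=
  if z \in half_map p i @` K then f (double_map i z) else 0.

Fixpoint transplant (w : seq 'I_3) f : R * R -> R :=
  if w is i :: w' then transplant1 i (transplant w' f) else f.

Definition boundary_vanishing f := forall i, f (p i) = 0.

(** Cell i meets another cell only at an image of a vertex, where f vanishes: the two possible
    values of the copy agree there. *)
Lemma transplant1_half_map i j f x : boundary_vanishing f -> K x ->
  transplant1 i f (half_map p j x) = if i == j then f x else 0.
Proof.
move=> f0 Kx; rewrite /transplant1; case: eqVneq => [<-|ij].
  by rewrite mem_set ?half_mapK//; exists x.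
case: ifPn => // /set_mem[y Ky yx].
by have [yE _] := half_map_overlap p_eq K_gasket ij Ky Kx yx; rewrite -yx half_mapK yE.
Qed.

Lemma transplant1_vanishing i f : boundary_vanishing f -> boundary_vanishing (transplant1 i f).
Proof.
move=> f0 j; rewrite -(half_map_vertex p j) transplant1_half_map//; last first.
  exact: (gasket_vertex p_eq K_gasket).
by case: ifP => // _; exact: f0.
Qed.

(** Pasting over two closed sets, the cell i and the union of the other cells: the copy is
    [f \o double_map i] on the first and 0 on the second. *)
Lemma transplant1_continuous i f : boundary_vanishing f -> {within K, continuous f} ->
  {within K, continuous (transplant1 i f)}.
Proof.
move=> f0 cf.
have KE : K = half_map p i @` K `|` \bigcup_(j in [set j | j != i]) half_map p j @` K.
  apply/seteqP; split=> [z /(gasket_split K_gasket)[j [y Ky <-]]|z].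
    have [->|ji] := eqVneq j i; first by left; exists y.
    by right; exists j => //; exists y.
  by move=> [[y Ky <-]|[j _ [y Ky <-]]]; exact: gasket_half_map.
rewrite KE; apply: withinU_continuous.
- exact: closed_half_map_gasket.
- by apply: closed_bigcup; [exact: finite_finset|move=> j _; exact: closed_half_map_gasket].
- apply: (@subspace_eq_continuous _ _ _ (f \o double_map i)).
    by move=> z hz; rewrite /from_subspace /= /transplant1 ifT.
  apply/subspace_continuousP => _ [y Ky <-] /=.
  have /subspace_continuousP/(_ _ Ky) := cf.
  rewrite half_mapK; apply: cvg_trans.
  move=> U hU; have {}hU : nbhs y (fun z => K z -> U (f z)) by exact: hU.
  have c : double_map i z @[z --> half_map p i y] --> y.
    by rewrite -[X in _ --> X](half_mapK i y); exact: continuous_double_map.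
  have {c}hU : nbhs (half_map p i y) (fun z => K (double_map i z) -> U (f (double_map i z))).
    exact: c hU.
  change (nbhs (half_map p i y) (fun z => (half_map p i @` K) z -> U (f (double_map i z)))).
  by apply: filterS hU => z hz [x Kx xz]; apply: hz; rewrite -xz half_mapK.
- apply: (@subspace_eq_continuous _ _ _ (fun=> 0)); last by move=> x; exact: cvg_cst.
  move=> _ /set_mem[j ji [y Ky <-]]; rewrite /from_subspace /= transplant1_half_map// eq_sym.
  by rewrite (negbTE ji).
Qed.

Lemma eq_edge_sum m f g : (forall x, K x -> f x = g x) -> edge_sum p m f f = edge_sum p m g g.
Proof.
elim: m f g => [|m IH] f g fg /=.
  apply: eq_bigr => i _; apply: eq_bigr => j _.
  by rewrite !fg//; exact: (gasket_vertex p_eq K_gasket).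
apply: eq_bigr => i _; apply: IH => x Kx /=; apply: fg; exact: gasket_half_map.
Qed.

Lemma edge_sum_transplant1 i m f : boundary_vanishing f ->
  edge_sum p m.+1 (transplant1 i f) (transplant1 i f) = edge_sum p m f f.
Proof.
move=> f0 /=; rewrite (bigD1 i)//= big1 ?addr0.
  by apply: eq_edge_sum => x Kx /=; rewrite transplant1_half_map ?eqxx.
move=> j ji; rewrite (@eq_edge_sum _ _ (fun x => 0 * f x)).
  by rewrite edge_sumZl mul0r.
by move=> x Kx /=; rewrite transplant1_half_map// eq_sym (negbTE ji) mul0r.
Qed.

Lemma transplant1_dom i f : dom f -> dom (transplant1 i f).
Proof.
move=> [cf ff f0]; split.
- exact: transplant1_continuous.
- have [C fC] := (finite_energyP p_eq K_gasket f).1 ff.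
  (* Monotonicity moves from level m to level m + 1, where the copy has the edge sum of f at level
     m, with a normalization larger by 5/3. *)
  apply/(finite_energyP p_eq K_gasket); exists (5 / 3 * C) => m.
  apply: le_trans (graph_energy_nd p_eq K_gasket (transplant1 i f) (leqnSn m)) _.
  rewrite (graph_energyE p_eq K_gasket) edge_sum_transplant1// exprS -!mulrA.
  rewrite !ler_pM2l ?invr_gt0// mulrA.
  by have := fC m; rewrite (graph_energyE p_eq K_gasket).
- exact: transplant1_vanishing.
Qed.

Lemma transplant_dom w f : dom f -> dom (transplant w f).
Proof. by elim: w => //= i w IH df; exact/transplant1_dom/IH. Qed.

Lemma transplant_cell_map v w f x : dom f -> size v = size w -> K x ->
  transplant v f (cell_map p w x) = if v == w then f x else 0.
Proof.
move=> df; elim: v w => [|i v IH] [|j w]//= [vw] Kx.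
have [_ _ f0] := transplant_dom v df.
rewrite transplant1_half_map//; last exact: gasket_cell_map.
rewrite eqseq_cons; case: eqVneq => //= _; exact: IH.
Qed.

Lemma edge_sum_cells_le m k f (C : R) :
  (forall w, size w = m -> edge_sum p k (f \o cell_map p w) (f \o cell_map p w) <= C) ->
  edge_sum p (m + k) f f <= 3 ^+ m * C.
Proof.
elim: m f => [|m IH] f fC; first by rewrite expr0 mul1r; exact: (fC [::]).
rewrite addSn /= exprS -mulrA; apply: (@le_trans _ _ (\sum_(i < 3) (3 ^+ m * C))).
  apply: ler_sum => i _; apply: IH => w sw; apply: (fC (i :: w)); by rewrite /= sw.
by rewrite sumr_const card_ord mulr_natl.
Qed.

Lemma dirichlet_domain_sum (I : finType) (c : I -> R) (F : I -> R * R -> R) :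
  (forall i, dom (F i)) -> dom (fun x => \sum_i c i * F i x).
Proof.
move=> dF; rewrite (_ : (fun x => _) = (fun x => \sum_(i <- enum I) c i * F i x)).
  elim: (enum I) => [|i s IH].
    have := dirichlet_domain0 p_eq K_gasket; congr dom; apply/funext => x; by rewrite big_nil.
  have := dirichlet_domain_lin p_eq K_gasket (c i) (dF i) IH.
  by congr dom; apply/funext => x; rewrite big_cons.
by apply/funext => x; rewrite big_enum.
Qed.

Lemma energy_form_le f (C : R) n : finite_energy p f ->
  (forall m, (n <= m)%N -> graph_energy p m f f <= C) -> energy_form p f f <= C.
Proof.
move=> ff h; have := energy_form_cvg p_eq K_gasket ff ff => c.
rewrite -(cvg_lim _ c)//; apply: limr_le; first by apply/cvg_ex; exists (energy_form p f f).
by exists n.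
Qed.

(** Each of the 3^m cells carries a copy of f, placed m levels deeper and hence renormalized by
    (5/3)^m, and 3^m (5/3)^m = 5^m. *)
Lemma energy_patchwork m (b : m.-tuple 'I_3 -> R) f (B : R) : dom f ->
  (forall w, b w ^+ 2 <= B) ->
  energy_form p (fun x => \sum_w b w * transplant w f x)
    (fun x => \sum_w b w * transplant w f x) <= 5 ^+ m * B * energy_form p f f.
Proof.
move=> df bB; set g := fun x => _.
have dg : dom g by apply: (@dirichlet_domain_sum _ b (fun w : m.-tuple 'I_3 => transplant w f)) => w; exact: transplant_dom.
have [_ ff _] := df; have [_ fg _] := dg.
apply: (@energy_form_le _ _ m fg) => k mk; rewrite -(subnKC mk) (graph_energyE p_eq K_gasket).
have B0 : 0 <= B by apply: le_trans (bB [tuple of nseq m 0]); exact: sqr_ge0.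
have c0 : (0 : R) <= (5 / 3) ^+ (m + (k - m))%N / 3 by rewrite divr_ge0// exprn_ge0// divr_ge0.
apply: le_trans (ler_wpM2l c0 (@edge_sum_cells_le m (k - m)%N g
  (B * edge_sum p (k - m)%N f f) _)) _.
  move=> w sw; have sw' : size w == m by apply/eqP.
  rewrite (@eq_edge_sum _ _ (fun x => b (Tuple sw') * f x)).
    by rewrite edge_sumZl edge_sumZr mulrA -expr2 ler_wpM2r// edge_sum_ge0.
  move=> x Kx /=; rewrite /g (bigD1 (Tuple sw'))//= big1 ?addr0.
    by rewrite transplant_cell_map// eqxx.
  move=> v vw; rewrite transplant_cell_map ?size_tuple//.
  by rewrite (_ : (_ == _) = false) ?mulr0//; apply: contraNF vw => /eqP vw; apply/eqP/val_inj.
have := energy_form_ge p_eq K_gasket (k - m)%N ff; rewrite (graph_energyE p_eq K_gasket) => h.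
have := ler_wpM2l (mulr_ge0 (exprn_ge0 m (ler0n R 5)) B0) h.
apply: le_trans; rewrite le_eqVlt; apply/orP; left; apply/eqP.
rewrite exprD expr_div_n.
have : (3 : R) ^+ m != 0 by rewrite expf_neq0.
by move=> h3; field.
Qed.

End transplant.

(** * Variational bounds and polynomial growth *)

Section eigenvalue_growth.
Context {R : realType}.
Variables (p : 'I_3 -> R * R) (K : set (R * R)).
Variable (mu : {measure set (R * R) -> \bar R}).
Variables (lam : nat -> R) (Phi : nat -> R * R -> R).
Hypothesis p_eq : equilateral p.
Hypothesis K_gasket : sierpinski_gasket p K.
Hypothesis mu_gasket : gasket_measure p K mu.
Hypothesis eig : dirichlet_eigensystem p K mu lam Phi.
Implicit Types f g h : R * R -> R.
Local Notation sqi := (square_integrable K mu).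
Local Notation inner := (inner K mu).
Local Notation dom := (dirichlet_domain p K).

Let mK := gasket_measurable K_gasket.
Let onb := eigen_onb eig.
Let sPhi := eigenfun_sqi K_gasket mu_gasket eig.

(** Expand the nonnegative energy of g - S, where S is the n-th partial expansion of g: both E(S, S)
    and E(S, g) equal the left-hand side. *)
Lemma energy_bessel g n : dom g ->
  \sum_(j < n) lam j * inner (Phi j) g ^+ 2 <= energy_form p g g.
Proof.
move=> dg; pose S x := \sum_(j < n) inner (Phi j) g * Phi j x.
have dS : dom S by exact: (dirichlet_domain_partial_sum p_eq K_gasket eig (fun j => inner (Phi j) g) n).
have fg := dirichlet_domain_energy dg; have fS := dirichlet_domain_energy dS.
have dh := dirichlet_domain_lin p_eq K_gasket (-1) dS dg.
have := energy_form_ge0 p_eq K_gasket (dirichlet_domain_energy dh).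
have fh := dirichlet_domain_energy dh.
rewrite (energy_formDl p_eq K_gasket (-1) fS fg fh).
rewrite (energy_formC p_eq K_gasket S (fun x => -1 * S x + g x)) (energy_formC p_eq K_gasket g (fun x => -1 * S x + g x)).
rewrite (energy_formDl p_eq K_gasket (-1) fS fg fS) (energy_formDl p_eq K_gasket (-1) fS fg fg).
rewrite (energy_formC p_eq K_gasket g S).
have -> : energy_form p S S = \sum_(j < n) lam j * inner (Phi j) g ^+ 2.
  exact: (energy_partial_sums p_eq K_gasket mu_gasket eig (fun j => inner (Phi j) g) n).
have -> : energy_form p S g = \sum_(j < n) lam j * inner (Phi j) g ^+ 2.
  rewrite (energy_partial_sum p_eq K_gasket mu_gasket eig (fun j => inner (Phi j) g) n dg).
  by apply: eq_bigr => j _; ring.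
lra.
Qed.

(** Half of the min-max principle: only terms with j >= n remain in the Parseval sum of g, where
    lam_n <= lam_j, and [energy_bessel] concludes. *)
Lemma energy_ge_eigenvalue n g : dom g -> (forall j, (j < n)%N -> inner (Phi j) g = 0) ->
  lam n * inner g g <= energy_form p g g.
Proof.
move=> dg g0; have sg := dirichlet_domain_sqi K_gasket mu_gasket dg.
have h : (fun M => lam n * \sum_(j < M) inner (Phi j) g * inner (Phi j) g) @ \oo --> lam n * inner g g.
  by apply: cvgM; [exact: cvg_cst|exact: (parseval mK onb)].
rewrite -(cvg_lim _ h)//; apply: limr_le; first by apply/cvg_ex; exists (lam n * inner g g).
apply: nearW => M; apply: le_trans (energy_bessel M dg).
rewrite mulr_sumr; apply: ler_sum => j _.
have [jn|nj] := ltnP j n; first by rewrite g0// mulr0 expr0n !mulr0.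
by rewrite -expr2 ler_wpM2r ?sqr_ge0//; exact: (eigenvalue_le eig).
Qed.

Lemma inner_lincomb (I : finType) (c : I -> R) (F : I -> R * R -> R) h :
  (forall i, sqi (F i)) -> sqi h ->
  inner (fun x => \sum_i c i * F i x) h = \sum_i c i * inner (F i) h.
Proof.
move=> sF sh; have [] : sqi (fun x => \sum_(i <- enum I) c i * F i x) /\
    inner (fun x => \sum_(i <- enum I) c i * F i x) h = \sum_(i <- enum I) c i * inner (F i) h.
  elim: (enum I) => [|i s [IHs IH]].
    under eq_fun do rewrite big_nil; split; first exact: sqi0.
    rewrite big_nil /Defs.inner /Rintegral integral0_eq//.
    by move=> x _; rewrite mul0r.
  under eq_fun do rewrite big_cons; split; first exact: sqi_lin.
  by rewrite innerDl// IH big_cons.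
by move=> _; under eq_fun do rewrite big_enum; rewrite big_enum.
Qed.

(** [Phi 0%N] is nonzero somewhere and, by [cell_osc], varies little on a deep enough cell. With
    this bound the L2 norm of a rescaled copy is estimated from the measure of one cell, with no
    change of variables in [mu]. *)
Lemma eigenfun_nonvanishing :
  exists v : seq 'I_3, exists2 e : R, 0 < e &
    forall x, K x -> e <= `|Phi 0%N (cell_map p v x)|.
Proof.
set f := Phi 0%N; have df : dom f := eigenfun_dom eig 0.
have [cf ff _] := df.
have [x Kx fx] : exists2 x, K x & f x != 0.
  apply/not_exists2P => h; have := inner_eigenfun eig 0 0.
  rewrite eqxx /Defs.inner /Rintegral integral0_eq.
    by move/eqP; rewrite /= eq_sym oner_eq0.
  move=> y Ky; have [//|/negP] := h y; rewrite negbK => /eqP.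
  by rewrite -/f => ->; rewrite mulr0.
pose B := 4 * Num.sqrt (3 * energy_form p f f).
have e0 : 0 < `|f x| / 4 by rewrite divr_gt0// normr_gt0.
have [n hn] : exists n : nat, B * (4 / 5) ^+ n < `|f x| / 4.
  have : (fun n => B * (4 / 5) ^+ n) @ \oo --> (0 : R).
    rewrite -[X in _ --> X](mulr0 B); apply: cvgM; first exact: cvg_cst.
    by apply: cvg_expr; rewrite ger0_norm ?divr_ge0//; lra.
  by move/cvgr_lt => /(_ _ e0) [n _ hn]; exists n; apply: hn => /=.
have [v [sv [y Ky yx]]] := gasket_cover K_gasket n Kx.
exists v; exists (`|f x| / 4) => // z Kz.
have h1 := cell_osc p_eq K_gasket v cf ff Kz.
have h2 := cell_osc p_eq K_gasket v cf ff Ky.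
rewrite -/B sv in h1 h2; rewrite yx in h2.
have := ler_normD (f x - f (cell_map p v (p 0))) (f (cell_map p v (p 0)) - f (cell_map p v z)).
have := ler_normD (f x - f (cell_map p v z)) (f (cell_map p v z)).
rewrite subrK addrA subrK (distrC (f (cell_map p v (p 0)))) -/f => h3 h4.
have := normr_ge0 (f x); lra.
Qed.

Lemma inner_ge_cell g (w : seq 'I_3) (e : R) : sqi g -> 0 <= e ->
  (forall x, K x -> e <= `|g (cell_map p w x)|) ->
  e ^+ 2 * 3^-1 ^+ size w <= inner g g.
Proof.
move=> sg e0 he; rewrite -lee_fin -sqi_integral//.
set A := cell_map p w @` K.
have AK : A `<=` K by move=> _ [x Kx <-]; exact: gasket_cell_map.
have mA : measurable A.
  apply: compact_plane_measurable; apply: continuous_compact.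
    apply: continuous_subspaceT; rewrite /A; elim: (w) => [|i v IH] x /=; first exact: cvg_id.
    by apply: continuous_comp; [exact: IH|exact: continuous_half_map].
  by case: K_gasket.
have [mg _] := sg.
have m2 : measurable_fun K (fun x => (g x ^+ 2)%:E).
  by apply/measurable_EFinP; exact: measurable_funX.
apply: (@le_trans _ _ (\int[mu]_(x in A) (g x ^+ 2)%:E)%E); last first.
  apply: ge0_subset_integral => //.
  by move=> x _; rewrite lee_fin sqr_ge0.
have -> : ((e ^+ 2 * 3^-1 ^+ size w)%:E = \int[mu]_(x in A) (e ^+ 2)%:E)%E.
  by rewrite integral_cst// (mu_gasket.1 w).
apply: ge0_le_integral => //.
- by move=> x _; rewrite lee_fin sqr_ge0.
- exact: measurable_funS m2.
- move=> _ [x Kx <-]; rewrite lee_fin -[leRHS]real_normK ?num_real//.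
  by rewrite ler_sqr ?nnegrE//; exact: he.
Qed.

(* The test function is a combination of 3^m disjoint copies of [Phi 0] that is
   orthogonal to the first n < 3^m eigenfunctions. *)
Lemma eigenvalue_upper : exists2 C : R, 0 <= C &
  forall m n, (n < 3 ^ m)%N -> lam n <= C * 15 ^+ m.
Proof.
have [v [e e0 he]] := eigenfun_nonvanishing.
have df : dom (Phi 0%N) := eigenfun_dom eig 0.
have E0 := energy_form_ge0 p_eq K_gasket (dirichlet_domain_energy df).
set E := energy_form p (Phi 0%N) (Phi 0%N) in E0.
(* The final comparison is lam_n b^2 e^2 3^-(m + |v|) <= 5^m b^2 E, with b the largest coefficient;
   whence 15 = 3 * 5. *)
exists (E * 3 ^+ size v / e ^+ 2) => [|m n n3].
  by rewrite divr_ge0 ?sqr_ge0// mulr_ge0// exprn_ge0.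
pose N := #|{: m.-tuple 'I_3}|.
have NE : N = (3 ^ m)%N by rewrite /N card_tuple card_ord.
pose G (w : m.-tuple 'I_3) := transplant p K w (Phi 0%N).
have dG w : dom (G w) by exact: (transplant_dom p_eq K_gasket).
pose A : 'M[R]_(N, n) := \matrix_(k, j) inner (Phi j) (G (enum_val k)).
have [|c c0 cA] := exists_left_kernel A; first by rewrite NE.
pose b (w : m.-tuple 'I_3) : R := c 0 (enum_rank w).
pose g x := \sum_w b w * G w x.
have dg : dom g by exact: (dirichlet_domain_sum p_eq K_gasket).
have sg := dirichlet_domain_sqi K_gasket mu_gasket dg.
have g0 j : (j < n)%N -> inner (Phi j) g = 0.
  move=> jn; have := congr1 (fun B : 'rV_n => B 0 (Ordinal jn)) cA; rewrite !mxE => <-.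
  rewrite innerC inner_lincomb//; last by move=> w; exact: dirichlet_domain_sqi (dG w).
  rewrite (reindex (fun k : 'I_N => enum_val k : m.-tuple 'I_3))/=; last first.
    by exists enum_rank => k _; rewrite ?enum_valK ?enum_rankK.
  by apply: eq_bigr => k _; rewrite /b enum_valK innerC !mxE.
(* The largest coefficient bounds the energy from above over all the cells, and the norm from below
   through the single cell of [w0]. *)
have [w0 _ hw0] := @arg_maxP _ _ _ [tuple of nseq m 0] xpredT (fun w => `|b w|) isT.
have b0 : 0 < `|b w0|.
  rewrite lt_neqAle normr_ge0 andbT eq_sym; apply: contra c0 => /eqP bw0.
  apply/eqP/rowP => k; rewrite mxE; have /= := hw0 (enum_val k) isT; rewrite bw0 normr_le0.
  by rewrite /b enum_valK => /eqP.
have up : energy_form p g g <= 5 ^+ m * b w0 ^+ 2 * E.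
  apply: (energy_patchwork p_eq K_gasket) => // w.
  by rewrite -[leLHS]real_normK ?num_real// -[leRHS]real_normK ?num_real// ler_sqr ?nnegrE//; exact: hw0.
have low : (`|b w0| * e) ^+ 2 * 3^-1 ^+ (m + size v) <= inner g g.
  have -> : (m + size v)%N = size (w0 ++ v) by rewrite size_cat size_tuple.
  apply: inner_ge_cell => //; first by rewrite mulr_ge0// ltW.
  move=> x Kx; rewrite cell_map_cat /g (bigD1 w0)//= big1 ?addr0.
    rewrite /G transplant_cell_map ?eqxx//; last exact: gasket_cell_map.
    by rewrite normrM ler_wpM2l//; exact: he.
  move=> w ww0; rewrite /G transplant_cell_map ?size_tuple//; last exact: gasket_cell_map.
  rewrite (_ : (_ == _) = false) ?mulr0//; apply: contraNF ww0 => /eqP ww0.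
  exact/eqP/val_inj.
have lo := energy_ge_eigenvalue dg g0.
have l0 := ltW (eigenvalue_gt0 eig n).
have := le_trans (le_trans (ler_wpM2l l0 low) lo) up.
rewrite exprMn -normrX ger0_norm ?sqr_ge0//.
have b2 : 0 < b w0 ^+ 2 by rewrite -[ltRHS]real_normK ?num_real// exprn_gt0.
rewrite (_ : lam n * _ = b w0 ^+ 2 * (lam n * (e ^+ 2 * 3^-1 ^+ (m + size v)))); last by ring.
rewrite (_ : 5 ^+ m * _ * E = b w0 ^+ 2 * (5 ^+ m * E)); last by ring.
rewrite ler_pM2l// => h.
have e2 : 0 < e ^+ 2 by rewrite exprn_gt0.
have q : (0 : R) < 3 ^+ (m + size v) by rewrite exprn_gt0.
rewrite mulrA exprVn ler_pdivrMr// in h.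
rewrite (_ : 15 = 3 * 5); last by ring.
rewrite exprMn mulrAC ler_pdivlMr//; apply: le_trans h _.
by rewrite exprD le_eqVlt; apply/orP; left; apply/eqP; ring.
Qed.

(* The cube is there because 3 <= (25/16)^3. *)
Lemma eigenvalue_ge_linear : exists2 c : R, 0 < c & forall j, c * j.+1%:R <= lam j ^+ 3.
Proof.
have l0 : 0 < lam 0%N ^+ 3 by rewrite exprn_gt0// (eigenvalue_gt0 eig).
(* At index j + 1, cubing 1 <= 48 lam (16/25)^m gives 3^m <= 48^3 lam^3, and j + 2 <= 3 * 3^m by the
   choice of m. *)
pose c1 : R := (3 * 48 ^+ 3)^-1; have c10 : 0 < c1 by rewrite invr_gt0 mulr_gt0// exprn_gt0.
exists (Num.min (lam 0%N ^+ 3) c1) => [|[|j]]; first by rewrite lt_min l0.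
  by rewrite mulr1 ge_min lexx.
apply: (@le_trans _ _ (c1 * j.+2%:R)); first by rewrite ler_wpM2r// ge_min lexx orbT.
pose m := trunc_log 3 j.+1.
have mj : (3 ^ m <= j.+1)%N by exact: trunc_logP.
have jm : (j.+1 < 3 ^ m.+1)%N by exact: trunc_log_ltn.
have q0 : (0 : R) < (16 / 25) ^+ m by rewrite exprn_gt0// divr_gt0.
have low : 1 <= 48 * lam j.+1 * (16 / 25) ^+ m.
  apply: le_trans (eigenvalue_lower p_eq K_gasket mu_gasket eig m) _.
  by rewrite ler_pM2r// ler_pM2l//; exact: (eigenvalue_le eig).
have q3 : (3 : R) ^+ m * ((16 / 25) ^+ m) ^+ 3 <= 1.
  rewrite exprAC -exprMn exprn_ile1//; last by rewrite !exprS expr0; lra.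
have {}low : 1 <= (48 * lam j.+1 * (16 / 25) ^+ m) ^+ 3.
  by rewrite -[leLHS](expr1n _ 3) lerXn2r ?nnegrE// (le_trans _ low).
have m3 : (j.+2%:R : R) <= 3 * 3 ^+ m by rewrite -exprS -natrX ler_nat.
have q30 : (0 : R) < ((16 / 25) ^+ m) ^+ 3 by rewrite exprn_gt0.
rewrite /c1 mulrC ler_pdivrMr ?mulr_gt0 ?exprn_gt0//.
apply: le_trans m3 _; rewrite -(ler_pM2r q30) -mulrA.
apply: (@le_trans _ _ 3); first by rewrite ger_pMr.
apply: (@le_trans _ _ (3 * (48 * lam j.+1 * (16 / 25) ^+ m) ^+ 3)).
  by rewrite ler_pMr.
by rewrite le_eqVlt; apply/orP; left; apply/eqP; ring.
Qed.

(** With 3^m <= j + 1 < 3^(m+1), [eigenvalue_upper] gives the bound 15 C 15^m, and 15^m <= (3^m)^3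
    because 15 <= 27. *)
Lemma eigenvalue_le_cubic : exists2 C : R, 0 <= C & forall j, lam j <= C * j.+1%:R ^+ 3.
Proof.
have [C C0 hC] := eigenvalue_upper.
exists (C * 15); first by rewrite mulr_ge0.
move=> j; pose m := trunc_log 3 j.+1.
have mj : (3 ^ m <= j.+1)%N by exact: trunc_logP.
have jm : (j < 3 ^ m.+1)%N by apply: ltn_trans (ltnSn j) _; exact: trunc_log_ltn.
apply: le_trans (hC _ _ jm) _; rewrite exprS -!mulrA ler_wpM2l// ler_wpM2l//.
apply: (@le_trans _ _ ((3 ^+ m) ^+ 3)).
  by rewrite exprAC lerXn2r// ?nnegrE// !exprS ?expr0; lra.
by rewrite lerXn2r ?nnegrE// ?exprn_ge0// -natrX ler_nat.
Qed.

End eigenvalue_growth.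

(** * The random distribution *)

Section rapid_decay.
Context {R : realType}.
Implicit Types u v : nat -> R.

Definition rapidly_decreasing u :=
  forall k : nat, exists2 M : R, 0 <= M & forall j, j.+1%:R ^+ k * `|u j| <= M.

Definition polynomially_bounded v :=
  exists (M : R) (k : nat), 0 <= M /\ forall j, `|v j| <= M * j.+1%:R ^+ k.

Lemma polynomially_boundedM u v : polynomially_bounded u -> polynomially_bounded v ->
  polynomially_bounded (fun j => u j * v j).
Proof.
move=> [M [k [M0 hM]]] [N [l [N0 hN]]]; exists (M * N), (k + l)%N.
split=> [|j]; first exact: mulr_ge0.
by rewrite normrM exprD mulrACA; exact: ler_pM.
Qed.

Lemma rapidly_decreasingM u v : rapidly_decreasing u -> polynomially_bounded v ->
  rapidly_decreasing (fun j => v j * u j).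
Proof.
move=> du [N [l [N0 hN]]] k; have [M M0 hM] := du (k + l)%N.
exists (N * M) => [|j]; first exact: mulr_ge0.
rewrite normrM mulrCA; apply: (@le_trans _ _ (N * j.+1%:R ^+ l * (j.+1%:R ^+ k * `|u j|))).
  by rewrite ler_wpM2r ?mulr_ge0 ?exprn_ge0.
by rewrite -mulrA ler_wpM2l// mulrA -exprD addnC.
Qed.

Lemma pair_weight_ge j : (2 * j.+1%:R ^+ 2)^-1 <= pair_weight R j.
Proof.
rewrite /pair_weight lef_pV2 ?posrE ?mulr_gt0 ?exprn_gt0//.
rewrite expr2 mulrCA ler_wpM2l//.
by rewrite -natrM ler_nat mul2n -addnn addSn ltnS leq_addl.
Qed.

Lemma rapidly_decreasing_weight u : rapidly_decreasing u ->
  exists2 M : R, 0 <= M & forall j, `|u j| <= M * pair_weight R j.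
Proof.
move=> /(_ 2%N)[M M0 hM]; exists (2 * M) => [|j]; first exact: mulr_ge0.
apply: (@le_trans _ _ (2 * M * (2 * j.+1%:R ^+ 2)^-1)).
  by rewrite ler_pdivlMr ?mulr_gt0 ?exprn_gt0// mulrCA ler_wpM2l// mulrC.
by rewrite ler_wpM2l ?mulr_ge0// pair_weight_ge.
Qed.

Lemma pair_weight_series_le (M : R) n : 0 <= M -> series (fun j => M * pair_weight R j) n <= M.
Proof.
move=> M0; rewrite /series /= big_mkord -mulr_sumr pair_weight_sum.
by rewrite ler_piMr// gerBl invr_ge0.
Qed.

Lemma is_cvg_pair_weight_series (M : R) : 0 <= M -> cvgn (series (fun j => M * pair_weight R j)).
Proof.
move=> M0; apply: nondecreasing_is_cvgn.
  by apply: nondecreasing_series => j _ _; rewrite mulr_ge0// ltW// pair_weight_gt0.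
by exists M => _ [n _ <-]; exact: pair_weight_series_le.
Qed.

Lemma weight_bounded_series u (M : R) : 0 <= M -> (forall j, `|u j| <= M * pair_weight R j) ->
  cvgn (series u) /\ `|limn (series u)| <= M.
Proof.
move=> M0 uM.
have cn : cvgn [normed series u].
  apply: (@series_le_cvg R _ (fun j => M * pair_weight R j)) => //.
  - by move=> j /=; exact: normr_ge0.
  - by move=> j; rewrite mulr_ge0// ltW// pair_weight_gt0.
  - exact: is_cvg_pair_weight_series.
split; first exact: normed_cvg.
apply: le_trans (lim_series_norm cn) _; apply: limr_le => //; apply: nearW => n.
apply: le_trans (pair_weight_series_le n M0); rewrite /series /=.
by apply: ler_sum => j _; exact: uM.
Qed.

End rapid_decay.

(** * Powers of the Laplacian on the Schwartz space *)

Section spectral_calculus.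
Context {R : realType}.
Variables (p : 'I_3 -> R * R) (K : set (R * R)).
Variable (mu : {measure set (R * R) -> \bar R}).
Variables (lam : nat -> R) (Phi : nat -> R * R -> R).
Hypothesis p_eq : equilateral p.
Hypothesis K_gasket : sierpinski_gasket p K.
Hypothesis mu_gasket : gasket_measure p K mu.
Hypothesis eig : dirichlet_eigensystem p K mu lam Phi.
Implicit Types f g h : R * R -> R.
Local Notation sqi := (square_integrable K mu).
Local Notation inner := (inner K mu).
Local Notation dom := (dirichlet_domain p K).
Local Notation schwartz := (schwartz p K mu Phi).
Local Notation npow := (neg_laplacian_pow K mu lam Phi).
Local Notation norm := (schwartz_norm K mu lam Phi).

Let mK := gasket_measurable K_gasket.
Let onb := eigen_onb eig.
Let sPhi := eigenfun_sqi K_gasket mu_gasket eig.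
Let lam0 := eigenvalue_gt0 eig.

Lemma schwartz_sqi f : schwartz f -> sqi f.
Proof. by move=> [cf _ _]; exact: (within_continuous_sqi K_gasket mu_gasket). Qed.

Lemma schwartz_coef f : schwartz f -> rapidly_decreasing (fun j => inner (Phi j) f).
Proof.
move=> [_ _ h] k; have := h k => c.
have /cvg_seq_bounded[M [_ hM]] : cvgn (fun n => n.+1%:R ^+ k * `|inner (Phi n) f|).
  by apply/cvg_ex; exists 0.
exists (`|M| + 1) => [|j]; first exact: addr_ge0.
apply: le_trans (ler_norm _) _; apply: hM => //.
by rewrite (le_lt_trans (ler_norm M))// ltrDl.
Qed.

Lemma schwartz_lin (a : R) f g : schwartz f -> schwartz g -> schwartz (fun x => a * f x + g x).
Proof.
move=> sf sg; have [cf f0 df] := sf; have [cg g0 dg] := sg; split.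
- move=> x; apply: cvgD; last exact: cg.
  by apply: cvgM; [exact: cvg_cst|exact: cf].
- by move=> i; rewrite f0 g0 mulr0 addr0.
- move=> k.
  have h : (fun n => `|a| * (n.+1%:R ^+ k * `|inner (Phi n) f|) +
      n.+1%:R ^+ k * `|inner (Phi n) g|) @ \oo --> (0 : R).
    rewrite -[X in _ --> X](addr0 0); apply: cvgD; last exact: dg.
    by rewrite -[X in _ --> X](mulr0 `|a|); apply: cvgM; [exact: cvg_cst|exact: df].
  apply: (@squeeze_cvgr nat _ _ R (fun=> 0) _ _ _ _ _ h); last exact: cvg_cst.
  apply: nearW => n; rewrite mulr_ge0 ?exprn_ge0//= innerDr//; try exact: schwartz_sqi.
  rewrite mulrCA -normrM -mulrDr ler_wpM2l ?exprn_ge0//.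
  exact: ler_normD.
Qed.

Lemma schwartz0 : schwartz (fun=> 0).
Proof.
split => // [x|k]; first exact: cvg_cst.
rewrite (_ : (fun n => _) = (fun=> 0)); first exact: cvg_cst.
apply/funext => n; have := innerZl mK 0 (sqi0 K mu) (sPhi n).
under [X in inner X _]eq_fun do rewrite mul0r.
by rewrite innerC mul0r => ->; rewrite normr0 mulr0.
Qed.

Lemma polynomially_bounded_eigenvalue : polynomially_bounded lam.
Proof.
have [C C0 hC] := eigenvalue_le_cubic p_eq K_gasket mu_gasket eig.
by exists C, 3%N; split=> // j; rewrite ger0_norm ?hC// ltW.
Qed.

Lemma polynomially_bounded_powR (a : R) : polynomially_bounded (fun j => lam j `^ a).
Proof.
have [a0|a0] := leP 0 a; last first.
  exists (lam 0%N `^ a), 0%N; split=> [|j]; first exact: powR_ge0.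
  rewrite mulr1 ger0_norm ?powR_ge0// -(opprK a) !(powRN _ (- a)).
  rewrite lef_pV2 ?posrE ?powR_gt0//; apply: ge0_ler_powR; rewrite ?nnegrE ?(ltW (lam0 _))//.
    by rewrite oppr_ge0 ltW.
  exact: (eigenvalue_le eig).
have [M [k [M0 hM]]] := polynomially_bounded_eigenvalue.
have [l hl] : exists l : nat, a <= l%:R.
  by exists (Num.truncn a).+1; rewrite ltW// truncnS_gt.
(* M + 1 makes the base at least 1, so that the exponent a may be raised to the integer l. *)
exists ((M + 1) ^+ l), (k * l)%N; split=> [|j]; first by rewrite exprn_ge0// addr_ge0.
have j1 : (1 : R) <= j.+1%:R ^+ k by rewrite exprn_ege1// ler1n.
have h : lam j <= (M + 1) * j.+1%:R ^+ k.
  rewrite mulrDl mul1r; have := hM j; rewrite ger0_norm; last exact: ltW.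
  by move=> {}hM; rewrite (le_trans hM)// lerDl (le_trans _ j1).
have h1 : 1 <= (M + 1) * j.+1%:R ^+ k by rewrite -[leLHS]mul1r ler_pM// lerDr.
rewrite ger0_norm ?powR_ge0// exprM -exprMn.
have h0 : 0 <= (M + 1) * j.+1%:R ^+ k by exact: le_trans h1.
apply: (@le_trans _ _ (((M + 1) * j.+1%:R ^+ k) `^ a)).
  by apply: ge0_ler_powR; rewrite ?nnegrE ?(ltW (lam0 _)).
by rewrite -(powR_mulrn l h0); exact: ler_powR.
Qed.

(** Since |Phi_j| <= B lam_j on K and the decay of the coefficients absorbs every power of lam_j,
    the series converges normally, and [xget] has a function to choose. *)
Lemma neg_laplacian_powP (a : R) f : schwartz f ->
  sqi (npow a f) /\
  L2_cvg K mu (fun n x => \sum_(j < n) lam j `^ a * inner (Phi j) f * Phi j x) (npow a f).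
Proof.
move=> sf; apply: (@xgetPex _ (cst 0) [set h | sqi h /\
  L2_cvg K mu (fun n x => \sum_(j < n) lam j `^ a * inner (Phi j) f * Phi j x) h]).
have [M M0 hM] := rapidly_decreasing_weight (rapidly_decreasingM (rapidly_decreasingM
  (schwartz_coef sf) (polynomially_bounded_powR a)) (polynomially_bounded_eigenvalue)).
(* From 2 |Phi_j| <= 1 + Phi_j^2, Phi_j^2 <= 48 lam_j and 1 <= lam_j / lam_0: a bound linear in
   lam_j, free of square roots. *)
pose B := 48 + (lam 0%N)^-1.
have B0 : 0 <= B by rewrite addr_ge0// invr_ge0 ltW.
have [h sh hh] : exists2 h, sqi h &
    L2_cvg K mu (fun n x => \sum_(j < n) lam j `^ a * inner (Phi j) f * Phi j x) h.
  apply: (@normally_convergent_L2 _ _ _ mK (fun j x => lam j `^ a * inner (Phi j) f * Phi j x)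
    (fun j => B * M * pair_weight R j)).
  - by rewrite (gasket_mass mu_gasket) ltry.
  - by move=> j; exact: sqiZ.
  - move=> j x Kx; rewrite normrM.
    apply: (@le_trans _ _ (`|lam j `^ a * inner (Phi j) f| * (B * lam j))).
      rewrite ler_wpM2l//.
      have := eigenfun_sup p_eq K_gasket mu_gasket eig j Kx => h2.
      have lj := lam0 j.
      have h3 : 1 <= (lam 0%N)^-1 * lam j.
        by rewrite mulrC ler_pdivlMr// mul1r; exact: (eigenvalue_le eig).
      have h4 : `|Phi j x| ^+ 2 <= 48 * lam j by rewrite real_normK ?num_real.
      rewrite /B mulrDl; have := sqr_ge0 (`|Phi j x| - 1); rewrite sqrrB expr1n mulr1 mulr2n.
      have := normr_ge0 (Phi j x); lra.
    rewrite -!mulrA (mulrCA _ B) ler_wpM2l//.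
    by have := hM j; rewrite normrM (ger0_norm (ltW (lam0 j))) mulrC.
  - by apply: is_cvg_pair_weight_series; rewrite mulr_ge0.
by exists h.
Qed.

Lemma neg_laplacian_pow_coef (a : R) f j : schwartz f ->
  inner (Phi j) (npow a f) = lam j `^ a * inner (Phi j) f.
Proof.
move=> sf; have [sh hh] := neg_laplacian_powP a sf.
exact: (coef_L2_limit mK onb (a := fun j => lam j `^ a * inner (Phi j) f)).
Qed.

Lemma inner_neg_laplacian_pow (a : R) f g : schwartz f -> schwartz g ->
  (fun n => \sum_(j < n) (lam j `^ a * inner (Phi j) f) * (lam j `^ a * inner (Phi j) g)) @ \oo
    --> inner (npow a f) (npow a g).
Proof.
move=> sf sg; have [sh _] := neg_laplacian_powP a sf; have [sk _] := neg_laplacian_powP a sg.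
rewrite (_ : (fun n => _) =
    (fun n => \sum_(j < n) inner (Phi j) (npow a f) * inner (Phi j) (npow a g))).
  exact: (parseval mK onb).
apply/funext => n; apply: eq_bigr => j _.
exact: (f_equal2 *%R (esym (neg_laplacian_pow_coef a j sf)) (esym (neg_laplacian_pow_coef a j sg))).
Qed.

(** A single term of Bessel's inequality for (-Delta)^k f. *)
Lemma coef_le_schwartz_norm k f j : schwartz f ->
  lam j ^+ k * `|inner (Phi j) f| <= norm k f.
Proof.
move=> sf; have [sh _] := neg_laplacian_powP k%:R sf.
have lk : 0 <= lam j ^+ k by rewrite exprn_ge0// ltW.
rewrite -(ger0_norm lk) -normrM -sqrtr_sqr; apply: ler_wsqrtr.
rewrite (_ : \int[mu]_(x in K) _ = inner (npow k%:R f) (npow k%:R f)); last first.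
  by apply: eq_Rintegral => x _; rewrite expr2.
apply: le_trans (bessel mK onb j.+1 sh).
rewrite big_ord_recr /= (neg_laplacian_pow_coef k%:R j sf) powR_mulrn ?lerDr; last exact: ltW.
by apply: sumr_ge0 => i _; exact: sqr_ge0.
Qed.

(** As c (j + 1) <= lam_j^3, a weight of degree q costs lam_j^(3q): the norm of index 3q alone
    suffices, with a constant independent of f and j. *)
Lemma coef_decay_schwartz_norm q : exists (k : nat) (B : R), 0 <= B /\
  forall f j, schwartz f -> j.+1%:R ^+ q * `|inner (Phi j) f| <= B * norm k f.
Proof.
have [c c0 hc] := eigenvalue_ge_linear p_eq K_gasket mu_gasket eig.
exists (3 * q)%N, (c^-1 ^+ q); split=> [|f j sf]; first by rewrite exprn_ge0// invr_ge0 ltW.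
apply: (@le_trans _ _ (c^-1 ^+ q * (lam j ^+ (3 * q) * `|inner (Phi j) f|))).
  rewrite mulrA ler_wpM2r// exprM -exprMn lerXn2r ?nnegrE//.
    by rewrite mulr_ge0 ?invr_ge0 ?exprn_ge0// ltW.
  by rewrite mulrC ler_pdivlMr// mulrC.
by rewrite ler_wpM2l ?coef_le_schwartz_norm// exprn_ge0// invr_ge0 ltW.
Qed.

End spectral_calculus.

(** The law of the field is known one test function at a time, so the covariance is recovered from
    the second moments of X, Y and X + Y, whose finiteness gives the integrability. *)
Lemma integral_mul_polarization (d : measure_display) (T : measurableType d) (R : realType)
    (P : {measure set T -> \bar R}) (X Y : T -> R) (a b c : R) :
  measurable_fun setT X -> measurable_fun setT Y ->
  (\int[P]_w ((X w) ^+ 2)%:E = a%:E)%E -> (\int[P]_w ((Y w) ^+ 2)%:E = b%:E)%E ->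
  (\int[P]_w ((X w + Y w) ^+ 2)%:E = (a + 2 * c + b)%:E)%E ->
  (\int[P]_w (X w * Y w)%:E = c%:E)%E.
Proof.
move=> mX mY iX iY iXY.
have int (Z : T -> R) (z : R) : measurable_fun setT Z ->
    (\int[P]_w ((Z w) ^+ 2)%:E = z%:E)%E -> P.-integrable setT (EFin \o (fun w => Z w ^+ 2)).
  move=> mZ iZ; apply/integrableP; split.
    by apply/measurable_EFinP; exact: measurable_funX.
  under eq_integral do rewrite /= ger0_norm ?sqr_ge0//.
  by rewrite iZ ltry.
have hX := int _ _ mX iX; have hY := int _ _ mY iY.
have hXY : P.-integrable setT (EFin \o (fun w => (X w + Y w) ^+ 2)).
  by apply: int iXY; exact: measurable_funD.
have hD : P.-integrable setT (EFin \o (fun w => (X w + Y w) ^+ 2 - X w ^+ 2)).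
  by have := integrableB measurableT hXY hX.
have hE : P.-integrable setT (EFin \o (fun w => (X w + Y w) ^+ 2 - X w ^+ 2 - Y w ^+ 2)).
  by have := integrableB measurableT hD hY.
transitivity (\int[P]_w ((2^-1)%:E * ((X w + Y w) ^+ 2 - X w ^+ 2 - Y w ^+ 2)%:E))%E.
  by apply: eq_integral => w _; rewrite -EFinM; congr EFin; field.
rewrite integralZl//.
under eq_integral do rewrite EFinB.
rewrite (integralB_EFin measurableT hD hY).
under eq_integral do rewrite EFinB.
rewrite (integralB_EFin measurableT hXY hX) iXY iX iY -!EFinB -EFinM; congr EFin; by field.
Qed.

(** * The random field and its law *)

Section white_noise.
Context {R : realType}.
Variables (p : 'I_3 -> R * R) (K : set (R * R)).
Variable (mu : {measure set (R * R) -> \bar R}).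
Variables (lam : nat -> R) (Phi : nat -> R * R -> R) (s : R).
Hypothesis p_eq : equilateral p.
Hypothesis K_gasket : sierpinski_gasket p K.
Hypothesis mu_gasket : gasket_measure p K mu.
Hypothesis eig : dirichlet_eigensystem p K mu lam Phi.
Implicit Types f g h : R * R -> R.
Local Notation inner := (inner K mu).
Local Notation schwartz := (schwartz p K mu Phi).
Local Notation npow := (neg_laplacian_pow K mu lam Phi).
Local Notation norm := (schwartz_norm K mu lam Phi).

Let mK := gasket_measurable K_gasket.
Let sPhi := eigenfun_sqi K_gasket mu_gasket eig.

Definition field_coef f (j : nat) : R := lam j `^ (- s) * inner (Phi j) f.

Variables (d : measure_display) (T : measurableType d) (P : probability T R).
Variable Z : nat -> T -> R.
Hypothesis mZ : forall n, measurable_fun setT (Z n).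
Hypothesis Z_bounded : forall w, polynomially_bounded (Z ^~ w).
Hypothesis Z_law : forall n (c : nat -> R) (A : set R), measurable A ->
  P ((fun w => \sum_(j < n) c j * Z j w) @^-1` A) =
  centered_normal (Num.sqrt (\sum_(j < n) c j ^+ 2)) A.

Definition spectral_field (w : T) f : R :=
  limn (fun n => \sum_(j < n) field_coef f j * Z j w : R).

Lemma field_coef_lin (a : R) f g j : schwartz f -> schwartz g ->
  field_coef (fun x => a * f x + g x) j = a * field_coef f j + field_coef g j.
Proof.
move=> sf sg; rewrite /field_coef (innerDr mK) //; first by ring.
- exact: (schwartz_sqi K_gasket mu_gasket sf).
- exact: (schwartz_sqi K_gasket mu_gasket sg).
Qed.

(** For a fixed outcome lam_j^-s Z_j grows at most like (j + 1)^q. Decay of order q + 2 of the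
    coefficients, drawn from a single norm, leaves a summable majorant; [k] and [B] depend on the
    outcome but not on f, which is what continuity requires. *)
Lemma spectral_field_bound w : exists (k : nat) (B : R), 0 <= B /\ forall f, schwartz f ->
  cvgn (series (fun j => field_coef f j * Z j w)) /\
  `|limn (series (fun j => field_coef f j * Z j w))| <= B * norm k f.
Proof.
have [D [q [D0 hD]]] := polynomially_boundedM
  (polynomially_bounded_powR p_eq K_gasket mu_gasket eig (- s)) (Z_bounded w).
have [k [B [B0 hB]]] := coef_decay_schwartz_norm p_eq K_gasket mu_gasket eig (q + 2).
exists k, (2 * D * B); split=> [|f sf]; first by rewrite !mulr_ge0.
apply: weight_bounded_series => [|j].
  by rewrite !mulr_ge0// sqrtr_ge0.
apply: (@le_trans _ _ (2 * D * (B * norm k f) * (2 * j.+1%:R ^+ 2)^-1)); last first.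
  by rewrite -!mulrA !ler_wpM2l// ?sqrtr_ge0// pair_weight_ge.
rewrite ler_pdivlMr ?mulr_gt0 ?exprn_gt0//.
rewrite /field_coef mulrAC normrM.
apply: (@le_trans _ _ (D * j.+1%:R ^+ q * `|inner (Phi j) f| * (2 * j.+1%:R ^+ 2))).
  by rewrite ler_wpM2r ?mulr_ge0 ?exprn_ge0// ler_wpM2r.
have := ler_wpM2l D0 (hB f j sf); rewrite exprD => h.
rewrite (_ : D * _ * _ * _ = 2 * (D * (j.+1%:R ^+ q * j.+1%:R ^+ 2 * `|inner (Phi j) f|))); last by ring.
by rewrite -[leRHS]mulrA ler_pM2l.
Qed.

Lemma series_ord (u : nat -> R) : series u = (fun n => \sum_(j < n) u j).
Proof. by apply/funext => n; rewrite /series /= big_mkord. Qed.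

Lemma spectral_field_cvg w f : schwartz f ->
  (fun n => \sum_(j < n) field_coef f j * Z j w) @ \oo --> spectral_field w f.
Proof.
have [k [B [_ hB]]] := spectral_field_bound w.
by move=> /hB[+ _]; rewrite series_ord.
Qed.

Lemma spectral_field_lin w (a : R) f g : schwartz f -> schwartz g ->
  spectral_field w (fun x => a * f x + g x) = a * spectral_field w f + spectral_field w g.
Proof.
move=> sf sg; apply: cvg_lim => //.
rewrite (_ : (fun n => _) = (fun n => a * (\sum_(j < n) field_coef f j * Z j w) +
  \sum_(j < n) field_coef g j * Z j w)).
  apply: cvgD; last exact: spectral_field_cvg.
  by apply: cvgM; [exact: cvg_cst|exact: spectral_field_cvg].
apply/funext => n; rewrite mulr_sumr -big_split /=; apply: eq_bigr => j _.
by rewrite field_coef_lin//; ring.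
Qed.

Lemma spectral_field_dual w : schwartz_dual p K mu lam Phi (spectral_field w).
Proof.
split=> [a f g sf sg|f sf e e0]; first exact: spectral_field_lin.
have [k [B [B0 hB]]] := spectral_field_bound w.
(* [B] may be 0, and the radius below divides by the constant. *)
have B1 : 0 < B + 1 by rewrite ltr_wpDl.
exists k, (e / (B + 1)); split=> [|g sg /(_ k (leqnn k)) gf]; first exact: divr_gt0.
have gfE : (g - f) = (fun x => -1 * f x + g x).
  by apply/funext => x /=; rewrite mulN1r addrC.
have sgf : schwartz (g - f) by rewrite gfE; exact: (schwartz_lin K_gasket mu_gasket eig).
have -> : spectral_field w g - spectral_field w f = spectral_field w (g - f).
  by rewrite gfE spectral_field_lin// mulN1r addrC.
have [_] := hB _ sgf; rewrite series_ord => h; apply: le_lt_trans h _.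
rewrite ltr_pdivlMr// in gf; apply: le_lt_trans gf.
by rewrite mulrC ler_wpM2l ?sqrtr_ge0// lerDl.
Qed.

Lemma measurable_spectral_field f : schwartz f -> measurable_fun setT (fun w => spectral_field w f).
Proof.
move=> sf; apply: (@measurable_fun_cvg _ _ _ _ (fun n w => \sum_(j < n) field_coef f j * Z j w)).
  by move=> n; apply: measurable_sum => j; apply: measurable_funM.
by move=> w _; exact: spectral_field_cvg.
Qed.

Lemma field_coef_sqr_sum f g : schwartz f -> schwartz g ->
  (fun n => \sum_(j < n) field_coef f j * field_coef g j) @ \oo --> inner (npow (- s) f) (npow (- s) g).
Proof. by move=> sf sg; exact: (inner_neg_laplacian_pow p_eq K_gasket mu_gasket eig). Qed.

Lemma spectral_field_law f : schwartz f -> forall A : set R, measurable A ->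
  P ((fun w => spectral_field w f) @^-1` A) =
  centered_normal (Num.sqrt (inner (npow (- s) f) (npow (- s) f))) A.
Proof.
move=> sf; apply: (gaussian_series_law mZ Z_law (c := field_coef f)).
- exact: sqrtr_ge0.
- by move=> w; exact: spectral_field_cvg.
- rewrite sqr_sqrtr ?inner_ge0//; have := field_coef_sqr_sum sf sf.
  by under eq_fun do under eq_bigr do rewrite -expr2.
Qed.

Lemma spectral_field_variance f : schwartz f ->
  (\int[P]_w ((spectral_field w f) ^+ 2)%:E = (inner (npow (- s) f) (npow (- s) f))%:E)%E.
Proof.
move=> sf; have h := spectral_field_law sf.
rewrite (centered_normal_second_moment _ (measurable_spectral_field sf) h) ?sqrtr_ge0//.
by rewrite sqr_sqrtr// inner_ge0.
Qed.

Lemma inner_neg_laplacian_pow_add f g : schwartz f -> schwartz g ->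
  inner (npow (- s) (fun x => 1 * f x + g x)) (npow (- s) (fun x => 1 * f x + g x)) =
  inner (npow (- s) f) (npow (- s) f) + 2 * inner (npow (- s) f) (npow (- s) g) +
  inner (npow (- s) g) (npow (- s) g).
Proof.
move=> sf sg.
have sfg : schwartz (fun x => 1 * f x + g x) by exact: (schwartz_lin K_gasket mu_gasket eig).
have c1 := field_coef_sqr_sum sfg sfg.
have E : (fun n => \sum_(j < n) field_coef (fun x => 1 * f x + g x) j *
    field_coef (fun x => 1 * f x + g x) j) =
  (fun n => \sum_(j < n) field_coef f j * field_coef f j +
    2 * (\sum_(j < n) field_coef f j * field_coef g j) +
    \sum_(j < n) field_coef g j * field_coef g j).
  apply/funext => n; rewrite mulr_sumr -!big_split /=; apply: eq_bigr => j _.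
  by rewrite field_coef_lin//; ring.
rewrite E in c1; apply: (cvg_unique _ c1) => //.
apply: cvgD; last exact: field_coef_sqr_sum.
apply: cvgD; first exact: field_coef_sqr_sum.
by apply: cvgM; [exact: cvg_cst|exact: field_coef_sqr_sum].
Qed.

Lemma spectral_field_covariance f g : schwartz f -> schwartz g ->
  (\int[P]_w (spectral_field w f * spectral_field w g)%:E =
   (inner (npow (- s) f) (npow (- s) g))%:E)%E.
Proof.
move=> sf sg.
apply: (integral_mul_polarization (measurable_spectral_field sf) (measurable_spectral_field sg)
  (spectral_field_variance sf) (spectral_field_variance sg)).
rewrite -inner_neg_laplacian_pow_add// -spectral_field_variance.
  by apply: eq_integral => w _; rewrite spectral_field_lin// mul1r.
exact: (schwartz_lin K_gasket mu_gasket eig).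
Qed.

(** By linearity a combination of values is one value of the field, which reduces joint normality to
    [spectral_field_law]. *)
Lemma spectral_field_lincomb n (c : 'I_n -> R) (t : 'I_n -> R * R -> R) :
  (forall i, schwartz (t i)) ->
  exists2 h, schwartz h & forall w, \sum_(i < n) c i * spectral_field w (t i) = spectral_field w h.
Proof.
elim: n c t => [|n IH] c t st.
  have s0 := schwartz0 K_gasket mu_gasket eig; exists (fun=> 0) => // w.
  have := spectral_field_lin w 1 s0 s0; rewrite big_ord0.
  rewrite (_ : (fun=> 1 * 0 + 0) = (fun=> 0)); last by apply/funext => x; rewrite mulr0 addr0.
  by set e := spectral_field w _; clearbody e; lra.
have [h sh hE] := IH (fun i => c (lift ord0 i)) (fun i => t (lift ord0 i)) (fun i => st _).
exists (fun x => c ord0 * t ord0 x + h x); first exact: (schwartz_lin K_gasket mu_gasket eig).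
by move=> w; rewrite big_ord_recl hE spectral_field_lin.
Qed.

Lemma spectral_field_gaussian : centered_gaussian_family P schwartz (fun f w => spectral_field w f).
Proof.
move=> n c t st; have [h sh hE] := spectral_field_lincomb c st.
rewrite (_ : (fun x => _) = (fun w => spectral_field w h)); last by apply/funext => w; exact: hE.
split; first exact: measurable_spectral_field.
exists (Num.sqrt (inner (npow (- s) h) (npow (- s) h))); first exact: sqrtr_ge0.
exact: spectral_field_law.
Qed.

Lemma measurable_spectral_distribution : measurable_fun setT
  (spectral_field : T -> g_sigma_algebraType (schwartz_cylinders p K mu Phi)).
Proof.
apply: (@measurability _ _ T (g_sigma_algebraType (schwartz_cylinders p K mu Phi)) _ _
  (schwartz_cylinders p K mu Phi)) => //.
move=> _ [_ [f [A [sf mA ->]]] <-].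
exact: (measurable_spectral_field sf).
Qed.

End white_noise.

Theorem theorem2p12 (R : realType) (p : 'I_3 -> R * R) (K : set (R * R))
    (mu : {measure set (R * R) -> \bar R})
    (lam : nat -> R) (Phi : nat -> R * R -> R) (s : R) :
  equilateral p ->
  sierpinski_gasket p K ->
  gasket_measure p K mu ->
  dirichlet_eigensystem p K mu lam Phi ->
  0 <= s ->
  exists (d : measure_display) (Omega : measurableType d)
         (P : probability Omega R)
         (X : Omega -> g_sigma_algebraType (schwartz_cylinders p K mu Phi)),
    [/\ forall w, schwartz_dual p K mu lam Phi (X w),
        measurable_fun setT X,
        centered_gaussian_family P (schwartz p K mu Phi) (fun f w => X w f)
      & forall f g, schwartz p K mu Phi f -> schwartz p K mu Phi g ->
          ('E_P[(fun w => X w f * X w g)%R] =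
           (\int[mu]_(x in K) (neg_laplacian_pow K mu lam Phi (- s) f x *
                               neg_laplacian_pow K mu lam Phi (- s) g x))%R%:E)%E].
Proof.
move=> p_eq K_gasket mu_gasket eig _.
have [Z [mZ Z_growth Z_law]] := gaussian_sequence R.
have Z_bounded w : polynomially_bounded (Z ^~ w).
  have [C hC] := Z_growth w; have C0 : 0 <= C.
    have := le_trans (sqr_ge0 (Z 0%N w)) (hC 0%N).
    by rewrite pmulr_lge0// mulr_gt0.
  (* The constant comes from 2 |Z_j| <= 1 + Z_j^2 and (j + 1)(j + 2) <= 2 (j + 1)^2. *)
  exists (2 * C + 1), 2%N; split=> [|j]; first by rewrite addr_ge0// mulr_ge0.
  have h : `|Z j w| ^+ 2 <= C * (2 * j.+1%:R ^+ 2).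
    rewrite real_normK ?num_real//; apply: le_trans (hC j) _; rewrite ler_wpM2l//.
    by rewrite expr2 mulrCA ler_wpM2l// -natrM ler_nat mul2n -addnn addSn ltnS leq_addl.
  have j1 : (1 : R) <= j.+1%:R ^+ 2 by rewrite exprn_ege1// ler1n.
  have := sqr_ge0 (`|Z j w| - 1); rewrite sqrrB expr1n mulr1 mulr2n => h2.
  have := normr_ge0 (Z j w); nra.
exists _, _, (fair_bits R), (spectral_field K mu lam Phi s Z).
split.
- by move=> w; exact: (spectral_field_dual s p_eq K_gasket mu_gasket eig Z_bounded).
- exact: (measurable_spectral_distribution s p_eq K_gasket mu_gasket eig mZ Z_bounded).
- exact: (spectral_field_gaussian s p_eq K_gasket mu_gasket eig mZ Z_bounded Z_law).
- move=> f g sf sg; rewrite unlock.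
  exact: (spectral_field_covariance s p_eq K_gasket mu_gasket eig mZ Z_bounded Z_law).
Qed.
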